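(* Let $\sigma(t):=(x(t),y(t))$ be a real analytic locally convex curve on the $xy$-plane with an arc-length parameter $t$ (so $\sigma''(t)\neq0$ for all $t$). Let $\tilde\sigma(t):=(t,x(t),y(t))$ be the associated null curve in $\mathbb{R}^3_1$, and let $t=\psi(x,y)$ be the graph (locally near $\sigma$) of the zero mean curvature surface $$\hat\phi_{\tilde\sigma}(r,s):=\begin{cases}\dfrac{\tilde\sigma(r+i\sqrt{s})+\tilde\sigma(r-i\sqrt{s})}{2} & (s\ge0),\\[8pt] \dfrac{\tilde\sigma(r+\sqrt{|s|})+\tilde\sigma(r-\sqrt{|s|})}{2} & (s<0),\end{cases}$$ for sufficiently small $|s|$. Then $\psi$ is a real analytic stream function satisfying $$(\rho^2c^2-\psi_y^2)\psi_{xx}+2\psi_x\psi_y\psi_{xy}+(\rho^2c^2-\psi_x^2)\psi_{yy}=0$$ with $p=p_0-\frac1\rho$ (i.e. $c\rho=1$), which changes from being subsonic to supersonic at the curve $\sigma$. Moreover, $$(u,v):=\frac1\rho(\psi_y,-\psi_x)$$ gives the velocity vector of the flow such that: (1) $u^2+v^2$ diverges to $\infty$ as $(x,y)$ approaches the image of $\sigma$. (2) The flow changes from being subsonic to being supersonic across $\sigma$. (3) The acceleration vector $\sigma''(t)$ points to the supersonic region.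
   Context: $\mathbb{R}^3_1=\{(t,x,y)\}$ is Lorentz–Minkowski $3$-space with metric of signature $(-,+,+)$. The analytic extension of a real analytic curve to complex arguments is denoted by the same letter; $\hat\phi_{\tilde\sigma}$ is a real analytic zero mean curvature immersion near $s=0$. Flow. One considers a steady, irrotational ($v_x-u_y=0$), two-dimensional barotropic flow on the $xy$-plane without external forces, with velocity $(u,v)$, density $\rho>0$ and pressure $p=p(\rho)$; the local speed of sound $c>0$ is defined by $c^2=dp/d\rho$. The stream function $\psi$ is a (locally defined) function with $\psi_x=-\rho v$, $\psi_y=\rho u$. Here the pressure law is $p=p_0-1/\rho$ with $p_0$ a constant, which gives $c\rho=1$, and the density of the flow with stream function $\psi$ is $$\rho=\rho_0\,|1-\psi_x^2-\psi_y^2|^{1/2}$$ with a positive constant $\rho_0$ (so $\rho=0$ and $c=\infty$ on $\sigma$, and the flow is considered off $\sigma$). The flow is subsonic (resp. supersonic) at a point if the speed $\sqrt{u^2+v^2}$ is less than (resp. greater than) $c$, equivalently if $1-\psi_x^2-\psi_y^2>0$ (resp. $<0$). *)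

(* Defs.v *)
From Stdlib Require Import Reals.
From Coquelicot Require Import Coquelicot.

Open Scope R_scope.

Definition interval (a b : Rbar) (t : R) : Prop := Rbar_lt a t /\ Rbar_lt t b.

Definition subset {T : Type} (A B : T -> Prop) : Prop := forall q, A q -> B q.

(** * Analyticity *)

(** Used with [K] the reals and with [K] the complex numbers. *)
Definition analytic_at {K : AbsRing} (f : K -> K) (z0 : K) : Prop :=
  exists (a : nat -> K) (e : R), 0 < e /\
    forall z : K, abs (minus z z0) < e ->
      @is_pseries K (AbsRing_NormedModule K) a (minus z z0) (f z).

(** Real analyticity in two variables: [f] is near [q0] the sum of an absolutely
    convergent double power series, summed here by homogeneous degree. *)
Definition analytic2_at (f : R * R -> R) (q0 : R * R) : Prop :=
  exists (a : nat -> nat -> R) (e : R), 0 < e /\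
    forall q : R * R, Rabs (fst q - fst q0) < e -> Rabs (snd q - snd q0) < e ->
      let term j k := a j k * (fst q - fst q0) ^ j * (snd q - snd q0) ^ k in
      ex_series (fun n : nat => sum_f_R0 (fun j => Rabs (term j (n - j)%nat)) n) /\
      is_series (fun n : nat => sum_f_R0 (fun j => term j (n - j)%nat) n) (f q).

Definition analytic_extension (J : R -> Prop) (f : R -> R)
    (D : C -> Prop) (F : C -> C) : Prop :=
  open D /\
  (forall t, J t -> D (RtoC t)) /\
  (forall z, D z -> @analytic_at C_AbsRing F z) /\
  (forall t, J t -> F (RtoC t) = RtoC (f t)).

(** * The surface *)

Definition cplus (r s : R) : C := (RtoC r + Ci * RtoC (sqrt s))%C.
Definition cminus (r s : R) : C := (RtoC r - Ci * RtoC (sqrt s))%C.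

(** One coordinate of the surface. It is kept complex valued; its values are
    real near [s = 0], and [is_graph] below only admits real points. *)
Definition fold (F : C -> C) (r s : R) : C :=
  if Rle_dec 0 s
  then ((F (cplus r s) + F (cminus r s)) / RtoC 2)%C
  else ((F (RtoC (r + sqrt (Rabs s))) + F (RtoC (r - sqrt (Rabs s)))) / RtoC 2)%C.

(** The surface of the null curve [z |-> (z, X z, Y z)], in the coordinate
    order [(t, x, y)]. *)
Definition phi_hat (X Y : C -> C) (r s : R) : C * C * C :=
  (fold (fun z => z) r s, fold X r s, fold Y r s).

Definition real_point (t : R) (q : R * R) : C * C * C :=
  (RtoC t, RtoC (fst q), RtoC (snd q)).

(** [phi_hat] at [(r, s)] only evaluates the curve inside its domain [J] or
    inside the domain [D] of its extension. *)
Definition phi_defined (J : R -> Prop) (D : C -> Prop) (r s : R) : Prop :=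
  J r /\
  (0 <= s -> D (cplus r s) /\ D (cminus r s)) /\
  (s < 0 -> J (r + sqrt (Rabs s)) /\ J (r - sqrt (Rabs s))).

(** The image of [W] under [phi] is the graph of [psi] over [U]. *)
Definition is_graph (phi : R -> R -> C * C * C) (W U : R * R -> Prop)
    (psi : R * R -> R) : Prop :=
  open W /\ open U /\
  forall (t : R) (q : R * R),
    (exists r s, W (r, s) /\ phi r s = real_point t q) <-> (U q /\ t = psi q).

(** The arc of the curve that lies on the sheet [W] of the surface. *)
Definition arc (x y : R -> R) (W : R * R -> Prop) (q : R * R) : Prop :=
  exists t, W (t, 0) /\ q = (x t, y t).

(** * Flows *)

Definition partial_x (f : R * R -> R) (q : R * R) : R :=
  Derive (fun a => f (a, snd q)) (fst q).
Definition partial_y (f : R * R -> R) (q : R * R) : R :=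
  Derive (fun b => f (fst q, b)) (snd q).

Definition C1_at (f : R * R -> R) (q : R * R) : Prop :=
  locally q (fun q' => ex_derive (fun a => f (a, snd q')) (fst q') /\
                       ex_derive (fun b => f (fst q', b)) (snd q')) /\
  continuous (partial_x f) q /\ continuous (partial_y f) q.

(** Steady, irrotational, barotropic flow on [E] without external forces, with
    velocity [(u, v)], density [rho] and pressure law [p]: conservation of mass,
    the Euler equations of motion, and vanishing vorticity. *)
Definition steady_flow (E : R * R -> Prop) (p : R -> R)
    (u v rho : R * R -> R) : Prop :=
  forall q, E q ->
    C1_at u q /\ C1_at v q /\ C1_at rho q /\
    0 < rho q /\ ex_derive p (rho q) /\ 0 < Derive p (rho q) /\
    partial_x (fun q' => rho q' * u q') q + partial_y (fun q' => rho q' * v q') q = 0 /\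
    rho q * (u q * partial_x u q + v q * partial_y u q) = - partial_x (fun q' => p (rho q')) q /\
    rho q * (u q * partial_x v q + v q * partial_y v q) = - partial_y (fun q' => p (rho q')) q /\
    partial_x v q - partial_y u q = 0.

Definition stream_function (E : R * R -> Prop) (psi u v rho : R * R -> R) : Prop :=
  forall q, E q -> partial_x psi q = - (rho q * v q) /\ partial_y psi q = rho q * u q.

Definition sound_speed (p : R -> R) (rho : R * R -> R) (q : R * R) : R :=
  sqrt (Derive p (rho q)).

Definition speed (u v : R * R -> R) (q : R * R) : R :=
  sqrt ((u q) ^ 2 + (v q) ^ 2).

Definition subsonic (E : R * R -> Prop) (u v c : R * R -> R) (q : R * R) : Prop :=
  E q /\ speed u v q < c q.
Definition supersonic (E : R * R -> Prop) (u v c : R * R -> R) (q : R * R) : Prop :=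
  E q /\ c q < speed u v q.

(** The equation of the stream function, [k] standing for [rho^2 * c^2]. *)
Definition stream_equation (k : R) (psi : R * R -> R) (q : R * R) : Prop :=
  (k - (partial_y psi q) ^ 2) * partial_x (partial_x psi) q
  + 2 * partial_x psi q * partial_y psi q * partial_y (partial_x psi) q
  + (k - (partial_x psi q) ^ 2) * partial_y (partial_y psi) q = 0.

Definition pressure (p0 : R) (d : R) : R := p0 - 1 / d.

Definition density (rho0 : R) (psi : R * R -> R) (q : R * R) : R :=
  rho0 * sqrt (Rabs (1 - (partial_x psi q) ^ 2 - (partial_y psi q) ^ 2)).

(** Every line crossing the curve transversally at parameter [t] passes there
    from region [A] to region [B], in one of the two directions. *)
Definition changes_across (x y : R -> R) (t : R) (A B : R * R -> Prop) : Prop :=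
  forall w1 w2 : R, Derive x t * w2 - Derive y t * w1 <> 0 ->
    exists e, 0 < e /\
      ((forall h, 0 < h < e -> A (x t - h * w1, y t - h * w2) /\
                               B (x t + h * w1, y t + h * w2)) \/
       (forall h, 0 < h < e -> B (x t - h * w1, y t - h * w2) /\
                               A (x t + h * w1, y t + h * w2))).

Definition points_into (x y : R -> R) (t w1 w2 : R) (A : R * R -> Prop) : Prop :=
  exists e, 0 < e /\ forall h, 0 < h < e -> A (x t + h * w1, y t + h * w2).

(* Main.v *)
Require Import Defs.
From Stdlib Require Import Arith Reals Lra Lia Psatz ClassicalEpsilon.
From Coquelicot Require Import Coquelicot.

Open Scope R_scope.

(** The surface is [(r, A(r, s), B(r, s))], where [A] and [B] are real analytic
    near [s = 0]: for a power series [sum a_n z^n] centred at [t], the mean of the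
    values at [h + i sqrt s] and [h - i sqrt s] is [sum a_n P_n(h, s)] with
    polynomials [P_n]. Write [R = (A_r, B_r)] and [T = (A_s, B_s)]. For [s < 0] the
    arc-length condition gives [R.T = 0] and [|R|^2 = 1 + 4 s |T|^2] directly, and by
    analyticity in [s] both identities hold everywhere; moreover [T = - sigma'' / 2]
    at [s = 0], so [(A, B)] is a local diffeomorphism there. Its inverse is analytic
    and [psi] is its first component, so [psi(A, B) = r]. Differentiating this once
    gives [grad psi = R / |R|^2] and [1 - |grad psi|^2 = 4 s |T|^2 / |R|^2], whose sign
    is that of [s]; differentiating twice gives the stream equation. The equations of
    motion then follow from the stream equation and Bernoulli's law.

    Analyticity is handled through bounds on derivatives: the functions whose
    derivatives of order [k] are bounded by [K M^k k! / (k+1)^2] form an algebra,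
    stable under reciprocals, locally uniform series, and (after enlarging [M])
    differentiation and composition with the local inverse; by Taylor's formula
    they are sums of double power series. *)

(** [sqrt s] is not analytic at [s = 0], exactly where the two branches of [fold] meet. Both
    branches average [F] over [h + z] and [h - z] with [z^2 = - s], so odd powers of [z] cancel and
    one power series in [(h, s)] serves both signs. The metric identities need checking only for
    [s < 0], where the surface is the mean of two real points of the curve; no Cauchy theory is
    needed. Double power series are awkward to multiply, invert and compose, whereas bounds on all
    derivatives pass through each operation by a product or chain rule; series occur only when
    entering and leaving this class. The claim covers every sheet [W] in [Omega] that is a graph,
    however large. Hence all facts are proved near a point, where [psi] is identified with the first
    component of a local inverse. The crossing statements come from the gradient of the discriminant
    on the curve, which is normal to the curve and nonzero. *)

(** * Squares and partial derivatives in the plane *)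

Definition rect (c : R * R) (d : R) (q : R * R) : Prop :=
  Rabs (fst q - fst c) < d /\ Rabs (snd q - snd c) < d.

Lemma ball_Rabs (z e w : R) : ball z e w -> Rabs (w - z) < e.
Proof. exact (fun H => H). Qed.

Lemma Rabs_ball (z e w : R) : Rabs (w - z) < e -> ball z e w.
Proof. exact (fun H => H). Qed.

Lemma exists_below3 (a b c : R) : 0 < a -> 0 < b -> 0 < c ->
  exists d, 0 < d /\ d <= a /\ d <= b /\ d <= c.
Proof.
  intros Ha Hb Hc. exists (Rmin a (Rmin b c)).
  assert (H1 := Rmin_l a (Rmin b c)). assert (H2 := Rmin_r a (Rmin b c)).
  assert (H3 := Rmin_l b c). assert (H4 := Rmin_r b c).
  split; [repeat apply Rmin_pos; auto|]. lra.
Qed.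

Lemma locally_rect (q : R * R) (P : R * R -> Prop) :
  locally q P <-> exists d, 0 < d /\ forall p, rect q d p -> P p.
Proof.
  split.
  - intros [e He]; exists e; split; [apply cond_pos|].
    intros p [H1 H2]; apply He; split; assumption.
  - intros [d [Hd H]]; exists (mkposreal d Hd); intros p [H1 H2].
    apply H; split; assumption.
Qed.

Lemma open_rect (c : R * R) (d : R) : open (rect c d).
Proof.
  intros q Hq; apply locally_rect; pose proof Hq as [H1 H2].
  set (e := Rmin (d - Rabs (fst q - fst c)) (d - Rabs (snd q - snd c))).
  assert (He1 := Rmin_l (d - Rabs (fst q - fst c)) (d - Rabs (snd q - snd c))).
  assert (He2 := Rmin_r (d - Rabs (fst q - fst c)) (d - Rabs (snd q - snd c))).
  fold e in He1, He2; exists e; split.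
  - apply Rmin_pos; apply Rlt_0_minus; assumption.
  - intros p [K1 K2]; split.
    + replace (fst p - fst c) with ((fst p - fst q) + (fst q - fst c)) by ring.
      eapply Rle_lt_trans; [apply Rabs_triang|].
      apply Rlt_le_trans with (e + Rabs (fst q - fst c)); [apply Rplus_lt_compat_r, K1|].
      clearbody e; revert He1; generalize (Rabs (fst q - fst c)); intros; lra.
    + replace (snd p - snd c) with ((snd p - snd q) + (snd q - snd c)) by ring.
      eapply Rle_lt_trans; [apply Rabs_triang|].
      apply Rlt_le_trans with (e + Rabs (snd q - snd c)); [apply Rplus_lt_compat_r, K2|].
      clearbody e; revert He2; generalize (Rabs (snd q - snd c)); intros; lra.
Qed.

Lemma rect_center (c : R * R) (d : R) : 0 < d -> rect c d c.
Proof. intros; split; unfold Rminus; rewrite Rplus_opp_r, Rabs_R0; assumption. Qed.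

Lemma rect_le (c : R * R) (d d' : R) (q : R * R) : d <= d' -> rect c d q -> rect c d' q.
Proof. intros H [H1 H2]; split; lra. Qed.

Lemma locally_fst_line (q : R * R) (P : R * R -> Prop) :
  locally q P -> locally (fst q) (fun a => P (a, snd q)).
Proof.
  intros H; apply locally_rect in H; destruct H as [d [Hd H]].
  exists (mkposreal d Hd); intros a Ha; apply H; split; simpl; [exact Ha|].
  unfold Rminus; rewrite Rplus_opp_r, Rabs_R0; assumption.
Qed.

Lemma locally_snd_line (q : R * R) (P : R * R -> Prop) :
  locally q P -> locally (snd q) (fun b => P (fst q, b)).
Proof.
  intros H; apply locally_rect in H; destruct H as [d [Hd H]].
  exists (mkposreal d Hd); intros a Ha; apply H; split; simpl; [|exact Ha].
  unfold Rminus; rewrite Rplus_opp_r, Rabs_R0; assumption.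
Qed.

Definition ex_partials (f : R * R -> R) (q : R * R) : Prop :=
  ex_derive (fun a => f (a, snd q)) (fst q) /\ ex_derive (fun b => f (fst q, b)) (snd q).

Definition is_partials (f : R * R -> R) (q : R * R) (l m : R) : Prop :=
  is_derive (fun a => f (a, snd q)) (fst q) l /\ is_derive (fun b => f (fst q, b)) (snd q) m.

Lemma is_partials_unique (f : R * R -> R) (q : R * R) (l m : R) :
  is_partials f q l m -> partial_x f q = l /\ partial_y f q = m.
Proof. intros [H1 H2]; split; apply is_derive_unique; assumption. Qed.

Lemma is_partials_ex (f : R * R -> R) (q : R * R) (l m : R) :
  is_partials f q l m -> ex_partials f q.
Proof. intros [H1 H2]; split; eexists; eassumption. Qed.

Lemma ex_partials_is (f : R * R -> R) (q : R * R) :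
  ex_partials f q -> is_partials f q (partial_x f q) (partial_y f q).
Proof. intros [H1 H2]; split; apply Derive_correct; assumption. Qed.

Lemma is_partials_ext (f g : R * R -> R) (q : R * R) (l m : R) :
  locally q (fun p => f p = g p) -> is_partials f q l m -> is_partials g q l m.
Proof.
  intros H [H1 H2]; split.
  - eapply is_derive_ext_loc; [|exact H1]. exact (locally_fst_line _ _ H).
  - eapply is_derive_ext_loc; [|exact H2]. exact (locally_snd_line _ _ H).
Qed.

Lemma partial_ext (f g : R * R -> R) (q : R * R) :
  locally q (fun p => f p = g p) ->
  partial_x f q = partial_x g q /\ partial_y f q = partial_y g q.
Proof.
  intros H; split; apply Derive_ext_loc.
  - exact (locally_fst_line _ _ H).
  - exact (locally_snd_line _ _ H).
Qed.

Lemma is_partials_plus (f g : R * R -> R) (q : R * R) (l m l' m' : R) :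
  is_partials f q l m -> is_partials g q l' m' ->
  is_partials (fun p => f p + g p) q (l + l') (m + m').
Proof.
  intros [H1 H2] [K1 K2]; split.
  - exact (is_derive_plus _ _ _ _ _ H1 K1).
  - exact (is_derive_plus _ _ _ _ _ H2 K2).
Qed.

Lemma is_derive_Rmult (f g : R -> R) (t l m : R) :
  is_derive f t l -> is_derive g t m ->
  is_derive (fun s => f s * g s) t (l * g t + f t * m).
Proof.
  intros H K; apply (is_derive_mult f g t l m H K). intros; apply Rmult_comm.
Qed.

Lemma is_partials_mult (f g : R * R -> R) (q : R * R) (l m l' m' : R) :
  is_partials f q l m -> is_partials g q l' m' ->
  is_partials (fun p => f p * g p) q (l * g q + f q * l') (m * g q + f q * m').
Proof.
  destruct q as [q1 q2]; intros [H1 H2] [K1 K2]; split.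
  - exact (is_derive_Rmult _ _ _ _ _ H1 K1).
  - exact (is_derive_Rmult _ _ _ _ _ H2 K2).
Qed.

Lemma is_partials_const (k : R) (q : R * R) : is_partials (fun _ => k) q 0 0.
Proof. split; apply is_derive_Reals, derivable_pt_lim_const. Qed.

Lemma is_partials_fst (q : R * R) : is_partials fst q 1 0.
Proof.
  split; simpl; [apply (is_derive_id (K := R_AbsRing))|].
  apply is_derive_Reals, derivable_pt_lim_const.
Qed.

Lemma is_partials_snd (q : R * R) : is_partials snd q 0 1.
Proof.
  split; simpl; [|apply (is_derive_id (K := R_AbsRing))].
  apply is_derive_Reals, derivable_pt_lim_const.
Qed.

Lemma is_partials_comp (f : R * R -> R) (h : R -> R) (q : R * R) (l m k : R) :
  is_partials f q l m -> is_derive h (f q) k ->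
  is_partials (fun p => h (f p)) q (k * l) (k * m).
Proof.
  destruct q as [q1 q2]; intros [H1 H2] K; simpl in *; split; simpl.
  - rewrite Rmult_comm; exact (is_derive_comp h (fun a => f (a, q2)) q1 k l K H1).
  - rewrite Rmult_comm; exact (is_derive_comp h (fun b => f (q1, b)) q2 k m K H2).
Qed.

(** * Functions with controlled derivatives *)

(** [c k] bounds every composite of [k <= n] operators [partial_x], [partial_y], in any order, so
    symmetry of mixed derivatives is not presupposed. The recursion differentiates once and shifts
    [c], which makes every closure property an induction on [n]. *)
Fixpoint smooth_bound (n : nat) (V : R * R -> Prop) (c : nat -> R) (f : R * R -> R) : Prop :=
  (forall q, V q -> Rabs (f q) <= c O) /\
  match n with
  | O => True
  | S n => (forall q, V q -> ex_partials f q) /\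
           smooth_bound n V (fun k => c (S k)) (partial_x f) /\
           smooth_bound n V (fun k => c (S k)) (partial_y f)
  end.

Lemma smooth_bound_le n : forall V c d f, (forall k, (k <= n)%nat -> c k <= d k) ->
  smooth_bound n V c f -> smooth_bound n V d f.
Proof.
  induction n as [|n IH]; intros V c d f H [H0 H1]; split; simpl; auto.
  - intros q Hq; eapply Rle_trans; [apply H0, Hq|apply H; lia].
  - intros q Hq; eapply Rle_trans; [apply H0, Hq|apply H; lia].
  - destruct H1 as [H1 [H2 H3]]; repeat split; try apply H1; auto;
      eapply IH; try eassumption; intros; simpl; apply H; lia.
Qed.

Lemma smooth_bound_subset n : forall (V W : R * R -> Prop) c f, subset W V ->
  smooth_bound n V c f -> smooth_bound n W c f.
Proof.
  induction n as [|n IH]; intros V W c f H [H0 H1]; split; simpl; auto.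
  destruct H1 as [H1 [H2 H3]]; repeat split; try apply H1; auto; eapply IH; eassumption.
Qed.

Lemma smooth_bound_pred n : forall V c f, smooth_bound (S n) V c f -> smooth_bound n V c f.
Proof.
  induction n as [|n IH]; intros V c f [H0 H1].
  - split; auto.
  - destruct H1 as [H1 [H2 H3]].
    split; [exact H0|]; repeat split; try apply H1; auto.
Qed.

Lemma smooth_bound_ext n : forall (V : R * R -> Prop) c f g, open V ->
  (forall q, V q -> f q = g q) -> smooth_bound n V c f -> smooth_bound n V c g.
Proof.
  induction n as [|n IH]; intros V c f g HV E [H0 H1].
  - split; auto. intros q Hq; rewrite <- E; auto.
  - destruct H1 as [H1 [H2 H3]].
    assert (L : forall q, V q -> locally q (fun p => f p = g p)).
    { intros q Hq; generalize (HV q Hq); apply filter_imp; auto. }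
    split; [intros q Hq; rewrite <- E; auto|]; split; [|split].
    + intros q Hq; eapply is_partials_ex, is_partials_ext; [apply L, Hq|].
      apply ex_partials_is, H1, Hq.
    + eapply IH; [auto| |exact H2]; intros q Hq; apply (partial_ext f g q (L q Hq)).
    + eapply IH; [auto| |exact H3]; intros q Hq; apply (partial_ext f g q (L q Hq)).
Qed.

(** The inductive step with the first derivatives given by formulas; openness of [V] allows
    replacing [partial_x f] by a function that agrees with it only on [V]. *)
Lemma smooth_bound_S n (V : R * R -> Prop) c f fx fy : open V ->
  (forall q, V q -> Rabs (f q) <= c O) -> (forall q, V q -> is_partials f q (fx q) (fy q)) ->
  smooth_bound n V (fun k => c (S k)) fx -> smooth_bound n V (fun k => c (S k)) fy ->
  smooth_bound (S n) V c f.
Proof.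
  intros HV B D Hx Hy. split; [exact B|].
  split; [intros q Hq; eapply is_partials_ex, D, Hq|].
  split; [apply smooth_bound_ext with fx|apply smooth_bound_ext with fy]; auto;
    intros q Hq; symmetry; apply (is_partials_unique _ _ _ _ (D q Hq)).
Qed.

Lemma smooth_bound_plus n : forall (V : R * R -> Prop) c d f g, open V ->
  smooth_bound n V c f -> smooth_bound n V d g ->
  smooth_bound n V (fun k => c k + d k) (fun q => f q + g q).
Proof.
  induction n as [|n IH]; intros V c d f g HV [H0 H1] [K0 K1];
    assert (B : forall q, V q -> Rabs (f q + g q) <= c O + d O)
      by (intros q Hq; eapply Rle_trans; [apply Rabs_triang|apply Rplus_le_compat; auto]);
    [split; auto|].
  destruct H1 as [H1 [H2 H3]], K1 as [K1 [K2 K3]].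
  apply (smooth_bound_S n V _ _ (fun q => partial_x f q + partial_x g q)
    (fun q => partial_y f q + partial_y g q) HV B).
  - intros q Hq; apply is_partials_plus; apply ex_partials_is; auto.
  - exact (IH V _ _ _ _ HV H2 K2).
  - exact (IH V _ _ _ _ HV H3 K3).
Qed.

(** The binomial convolution [sum_j C(k,j) c_j d_(k-j)], by Pascal's rule. *)
Fixpoint bconv (c d : nat -> R) (k : nat) : R :=
  match k with
  | O => c O * d O
  | S k => bconv (fun j => c (S j)) d k + bconv c (fun j => d (S j)) k
  end.

(** The recursion of [bconv] copies the product rule, so no binomial coefficient enters here. *)
Lemma smooth_bound_mult n : forall (V : R * R -> Prop) c d f g, open V ->
  smooth_bound n V c f -> smooth_bound n V d g ->
  smooth_bound n V (bconv c d) (fun q => f q * g q).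
Proof.
  induction n as [|n IH]; intros V c d f g HV Hf Hg;
    pose proof Hf as [H0 H1]; pose proof Hg as [K0 K1];
    assert (B : forall q, V q -> Rabs (f q * g q) <= c O * d O)
      by (intros q Hq; rewrite Rabs_mult; apply Rmult_le_compat; auto using Rabs_pos);
    [split; auto|].
  destruct H1 as [H1 [H2 H3]], K1 as [K1 [K2 K3]].
  apply smooth_bound_pred in Hf; apply smooth_bound_pred in Hg.
  apply (smooth_bound_S n V _ _ (fun q => partial_x f q * g q + f q * partial_x g q)
    (fun q => partial_y f q * g q + f q * partial_y g q) HV B).
  - intros q Hq; apply is_partials_mult; apply ex_partials_is; auto.
  - exact (smooth_bound_plus n V _ _ _ _ HV (IH V _ _ _ _ HV H2 Hg) (IH V _ _ _ _ HV Hf K2)).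
  - exact (smooth_bound_plus n V _ _ _ _ HV (IH V _ _ _ _ HV H3 Hg) (IH V _ _ _ _ HV Hf K3)).
Qed.

Lemma sum_pascal (u : nat -> R) (n : nat) :
  sum_f_R0 (fun j => Binomial.C (S n) j * u j) (S n) =
  sum_f_R0 (fun j => Binomial.C n j * (u (S j) + u j)) n.
Proof.
  (* Cutting both sums at [m] leaves the boundary term [C n m * u (S m)]; at [m = n] it is the
     missing last summand. *)
  assert (H : forall m, (m <= n)%nat ->
    sum_f_R0 (fun j => Binomial.C (S n) j * u j) m + Binomial.C n m * u (S m) =
    sum_f_R0 (fun j => Binomial.C n j * (u (S j) + u j)) m).
  { induction m as [|m IH]; intros Hm.
    - simpl; rewrite !C_n_0; ring.
    - simpl sum_f_R0; rewrite <- IH, <- pascal by lia; ring. }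
  rewrite <- H by lia. simpl sum_f_R0. rewrite !C_n_n; ring.
Qed.

Lemma bconv_sum k : forall c d,
  bconv c d k = sum_f_R0 (fun j => Binomial.C k j * (c j * d (k - j)%nat)) k.
Proof.
  induction k as [|k IH]; intros c d.
  - simpl; rewrite C_n_0; ring.
  - cbn [bconv]. rewrite !IH.
    rewrite (sum_pascal (fun j => c j * d (S k - j)%nat)).
    rewrite <- plus_sum. apply sum_eq; intros j Hj.
    replace (S k - j)%nat with (S (k - j)) by lia.
    replace (S k - S j)%nat with (k - j)%nat by lia. ring.
Qed.

Lemma bconv_scal k : forall (a b : R) c d,
  bconv (fun j => a * c j) (fun j => b * d j) k = a * b * bconv c d k.
Proof.
  induction k as [|k IH]; intros; simpl; [ring|].
  rewrite (IH a b (fun j => c (S j)) d), (IH a b c (fun j => d (S j))); ring.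
Qed.

(** * Weights *)

(** The square in the denominator makes the weights submultiplicative, up to the
    factor [8], for binomial convolution. *)
Definition weight (M : R) (k : nat) : R := M ^ k * INR (fact k) / (INR k + 1) ^ 2.

Lemma INR1_pos k : 0 < INR k + 1.
Proof. pose proof (pos_INR k); lra. Qed.

Lemma weight_pos M k : 0 < M -> 0 < weight M k.
Proof.
  intros; unfold weight; apply Rdiv_lt_0_compat.
  - apply Rmult_lt_0_compat; [apply pow_lt; auto|apply INR_fact_lt_0].
  - apply pow_lt, INR1_pos.
Qed.

Lemma weight_0 M : weight M 0 = 1.
Proof. unfold weight; simpl; field. Qed.

(** Telescoping: [1 / (k + 2)^2 <= 1 / (k + 1) - 1 / (k + 2)]. *)
Lemma sum_inv_sq k : sum_f_R0 (fun j => 1 / (INR j + 1) ^ 2) k <= 2 - 1 / (INR k + 1).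
Proof.
  induction k as [|k IH].
  - simpl; lra.
  - rewrite tech5; eapply Rle_trans; [apply Rplus_le_compat_r, IH|].
    cbv beta; rewrite S_INR. pose proof (pos_INR k). set (z := INR k) in *.
    assert (0 <= 1 / (z + 1) - 1 / (z + 1 + 1) - 1 / (z + 1 + 1) ^ 2); [|lra].
    replace (1 / (z + 1) - 1 / (z + 1 + 1) - 1 / (z + 1 + 1) ^ 2)
      with (1 / ((z + 1) * (z + 1 + 1) ^ 2)) by (field; repeat split; lra).
    apply Rlt_le, Rdiv_lt_0_compat; [lra|]. apply Rmult_lt_0_compat; [lra|apply pow_lt; lra].
Qed.

(** The factorials cancel the binomial coefficient and leave the sum of
    [1 / ((j + 1)^2 (k - j + 1)^2)]. With [x = j] and [y = k - j], [(x + y + 1)^2 <= 2 ((x + 1)^2 +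
    (y + 1)^2)] splits each term into two summands with factor [2 / (k + 1)^2], and each of the two
    sums is at most 2, whence [8 = 2 * (2 + 2)]. *)
Lemma weight_bconv M k : 0 < M -> bconv (weight M) (weight M) k <= 8 * weight M k.
Proof.
  intros HM; rewrite bconv_sum.
  set (P := M ^ k * INR (fact k)).
  assert (HP : 0 < P) by (apply Rmult_lt_0_compat; [apply pow_lt; auto|apply INR_fact_lt_0]).
  assert (Hk := pos_INR k).
  apply Rle_trans with (sum_f_R0 (fun j => P * 2 / (INR k + 1) ^ 2 *
     (1 / (INR j + 1) ^ 2 + 1 / (INR (k - j) + 1) ^ 2)) k).
  - apply sum_Rle; intros j Hj.
    assert (Hj0 := pos_INR j). assert (Hj1 := pos_INR (k - j)).
    assert (E : INR k = INR j + INR (k - j)) by (rewrite <- plus_INR; f_equal; lia).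
    replace (Binomial.C k j * (weight M j * weight M (k - j)))
      with (P * (1 / (INR j + 1) ^ 2 * (1 / (INR (k - j) + 1) ^ 2))).
    2:{ unfold Binomial.C, weight, P. replace k with (j + (k - j))%nat at 1 by lia.
        rewrite pow_add. field; repeat split; try lra; apply INR_fact_neq_0. }
    replace (P * 2 / (INR k + 1) ^ 2 * (1 / (INR j + 1) ^ 2 + 1 / (INR (k - j) + 1) ^ 2))
      with (P * (2 / (INR k + 1) ^ 2 * (1 / (INR j + 1) ^ 2 + 1 / (INR (k - j) + 1) ^ 2)))
      by (field; repeat split; lra).
    apply Rmult_le_compat_l; [lra|].
    rewrite E. set (x := INR j) in *. set (y := INR (k - j)) in *.
    assert (Hx : 0 < x + 1) by lra. assert (Hy : 0 < y + 1) by lra.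
    assert (Hz : 0 < x + y + 1) by lra.
    replace (2 / (x + y + 1) ^ 2 * (1 / (x + 1) ^ 2 + 1 / (y + 1) ^ 2))
      with ((2 * ((x + 1) ^ 2 + (y + 1) ^ 2) / (x + y + 1) ^ 2) *
            (1 / (x + 1) ^ 2 * (1 / (y + 1) ^ 2))) by (field; repeat split; lra).
    rewrite <- (Rmult_1_l (1 / (x + 1) ^ 2 * (1 / (y + 1) ^ 2))) at 1.
    apply Rmult_le_compat_r.
    + apply Rlt_le, Rmult_lt_0_compat; (apply Rdiv_lt_0_compat; [lra|apply pow_lt; lra]).
    + apply Rmult_le_reg_r with ((x + y + 1) ^ 2); [apply pow_lt; lra|].
      unfold Rdiv; rewrite Rmult_assoc, Rinv_l by (apply pow_nonzero; lra). pose proof (pow2_ge_0 (x - y)); nra.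
  - erewrite sum_eq; [|intros i _; apply Rmult_comm].
    rewrite <- scal_sum, plus_sum.
    rewrite (sum_f_R0_skip (fun j => 1 / (INR j + 1) ^ 2)).
    assert (HS := sum_inv_sq k).
    assert (0 < 1 / (INR k + 1)) by (apply Rdiv_lt_0_compat; lra).
    unfold weight; fold P.
    replace (8 * (P / (INR k + 1) ^ 2)) with (P * 2 / (INR k + 1) ^ 2 * 4) by (field; repeat split; lra).
    apply Rmult_le_compat_l; [|lra].
    apply Rlt_le, Rdiv_lt_0_compat; [lra|apply pow_lt; lra].
Qed.

Lemma weight_le M M' k : 0 < M <= M' -> weight M k <= weight M' k.
Proof.
  intros H; unfold weight, Rdiv. apply Rmult_le_compat_r.
  - apply Rlt_le, Rinv_0_lt_compat, pow_lt, INR1_pos.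
  - apply Rmult_le_compat_r; [apply pos_INR|apply pow_incr; lra].
Qed.

Lemma pow2_ge k : INR k + 1 <= 2 ^ k.
Proof.
  induction k as [|k IH]; [simpl; lra|].
  rewrite S_INR; simpl. pose proof (pos_INR k). lra.
Qed.

(** Cost of one differentiation: the extra factor [k + 1] from the factorial is absorbed by [2 ^ k],
    that is, by doubling [M]. *)
Lemma weight_S_le M k : 0 < M -> weight M (S k) <= M * weight (2 * M) k.
Proof.
  intros HM; unfold weight. rewrite Rpow_mult_distr, fact_simpl, mult_INR, S_INR.
  simpl (M ^ S k). assert (Hk := pos_INR k).
  assert (HF := INR_fact_lt_0 k). assert (HP := pow_lt M k HM).
  set (F := INR (fact k)) in *; set (P := M ^ k) in *; set (z := INR k) in *.
  assert (H2 := pow2_ge k). fold z in H2. set (t := 2 ^ k) in *.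
  apply Rle_trans with (M * P * F * (t / (z + 1) ^ 2)); [|right; field; repeat split; lra].
  replace (M * P * ((z + 1) * F) / (z + 1 + 1) ^ 2)
    with (M * P * F * ((z + 1) / (z + 1 + 1) ^ 2)) by (field; repeat split; lra).
  apply Rmult_le_compat_l.
  - apply Rlt_le; repeat apply Rmult_lt_0_compat; auto.
  - unfold Rdiv; apply Rmult_le_compat; [lra| |lra|].
    + apply Rlt_le, Rinv_0_lt_compat, pow_lt; lra.
    + apply Rinv_le_contravar; [apply pow_lt; lra|]. apply pow_incr; lra.
Qed.

(** The ratio of the two weights is [M (k + 1)^3 / (k + 2)^2], smallest at [k = 0], where it is
    [M / 4]. This lets a large [M] absorb constants in inductions on the order. *)
Lemma weight_S_ge M k : 0 < M -> M / 4 * weight M k <= weight M (S k).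
Proof.
  intros HM; unfold weight. rewrite fact_simpl, mult_INR, S_INR.
  simpl (M ^ S k). assert (Hk := pos_INR k).
  assert (HF := INR_fact_lt_0 k). assert (HP := pow_lt M k HM).
  set (F := INR (fact k)) in *; set (P := M ^ k) in *; set (z := INR k) in *.
  replace (M * P * ((z + 1) * F) / (z + 1 + 1) ^ 2)
    with (M * P * F * ((z + 1) / (z + 1 + 1) ^ 2)) by (field; repeat split; lra).
  replace (M / 4 * (P * F / (z + 1) ^ 2)) with (M * P * F * (1 / (4 * (z + 1) ^ 2))) by (field; repeat split; lra).
  apply Rmult_le_compat_l.
  - apply Rlt_le; repeat apply Rmult_lt_0_compat; auto.
  - apply Rmult_le_reg_r with (4 * (z + 1) ^ 2 * (z + 1 + 1) ^ 2).
    { apply Rmult_lt_0_compat; [apply Rmult_lt_0_compat; [lra|]|]; apply pow_lt; lra. }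
    field_simplify; [|lra|lra]. nra.
Qed.

Lemma weight_le_fact M k : 0 < M -> weight M k <= M ^ k * INR (fact k).
Proof.
  intros HM; unfold weight. rewrite <- (Rdiv_1_r (M ^ k * INR (fact k))) at 2.
  apply Rmult_le_compat_l.
  - apply Rlt_le, Rmult_lt_0_compat; [apply pow_lt; auto|apply INR_fact_lt_0].
  - apply Rinv_le_contravar; [lra|]. pose proof (pos_INR k); nra.
Qed.

(** The way back from plain factorial bounds to weights, by [(k + 1)^2 <= 4 ^ k]. *)
Lemma fact_le_weight M k : 0 < M -> M ^ k * INR (fact k) <= weight (4 * M) k.
Proof.
  intros HM; unfold weight. assert (HF := INR_fact_lt_0 k). assert (HP := pow_lt M k HM).
  rewrite Rpow_mult_distr. assert (Hk := INR1_pos k).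
  apply Rmult_le_reg_r with ((INR k + 1) ^ 2); [apply pow_lt; auto|].
  unfold Rdiv; rewrite (Rmult_assoc _ (/ _)), Rinv_l by (apply pow_nonzero; lra).
  rewrite Rmult_1_r, (Rmult_assoc (4 ^ k)), (Rmult_comm (4 ^ k)).
  apply Rmult_le_compat_l; [apply Rlt_le, Rmult_lt_0_compat; auto|].
  replace 4 with (2 * 2) by ring; rewrite Rpow_mult_distr.
  pose proof (pow2_ge k). simpl; nra.
Qed.

(** * First-order calculus in the plane *)

Lemma mvt_1d (f : R -> R) (c d a b : R) :
  (forall z, Rabs (z - c) < d -> ex_derive f z) -> Rabs (a - c) < d -> Rabs (b - c) < d ->
  exists z, Rabs (z - c) < d /\ f b - f a = Derive f z * (b - a).
Proof.
  intros H Ha Hb.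
  assert (HH : forall z, Rmin a b <= z <= Rmax a b -> Rabs (z - c) < d).
  { intros z [H1 H2]. apply Rabs_lt_between' in Ha; apply Rabs_lt_between' in Hb.
    apply Rabs_lt_between'. revert H1 H2; unfold Rmin, Rmax; destruct Rle_dec; intros; lra. }
  destruct (MVT_gen f a b (Derive f)) as [z [Hz E]].
  - intros z Hz; apply Derive_correct, H, HH; lra.
  - intros z Hz; apply continuity_pt_filterlim, (ex_derive_continuous (K := R_AbsRing) (V := R_NormedModule)), H, HH, Hz.
  - exists z; split; [apply HH, Hz|exact E].
Qed.

(** Go from [p] to [p'] along the two sides of a right angle; its corner stays in the square, and
    each leg has its own intermediate point. *)
Lemma mvt_2d (f : R * R -> R) (c : R * R) (d : R) (p p' : R * R) :
  (forall z, rect c d z -> ex_partials f z) -> rect c d p -> rect c d p' ->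
  exists z1 z2, rect c d z1 /\ rect c d z2 /\
    f p' - f p = partial_x f z1 * (fst p' - fst p) + partial_y f z2 * (snd p' - snd p).
Proof.
  destruct p as [a b], p' as [a' b'], c as [c1 c2]; intros H [H1 H2] [H1' H2']; simpl in *.
  destruct (mvt_1d (fun z => f (z, b)) c1 d a a') as [z1 [Hz1 E1]]; auto.
  { intros z Hz; apply (H (z, b)); split; auto. }
  destruct (mvt_1d (fun z => f (a', z)) c2 d b b') as [z2 [Hz2 E2]]; auto.
  { intros z Hz; apply (H (a', z)); split; auto. }
  exists (z1, b), (a', z2); split; [split; auto|]; split; [split; auto|].
  unfold partial_x, partial_y; simpl. rewrite <- E1, <- E2; ring.
Qed.

Lemma continuous_rect (f : R * R -> R) (q : R * R) :
  continuous f q <->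
  forall e, 0 < e -> exists d, 0 < d /\ forall p, rect q d p -> Rabs (f p - f q) < e.
Proof.
  split.
  - intros H e He. specialize (H (ball (f q) (mkposreal e He)) (locally_ball _ _)).
    apply locally_rect in H; destruct H as [d [Hd K]]; exists d; split; [exact Hd|].
    intros p Hp; exact (K p Hp).
  - intros H P [e HP]. destruct (H e (cond_pos e)) as [d [Hd K]].
    apply locally_rect; exists d; split; auto. intros p Hp; apply HP, K, Hp.
Qed.

Lemma bounded_partials_continuous (f : R * R -> R) (V : R * R -> Prop) (K : R) (q : R * R) :
  open V -> V q -> (forall p, V p -> ex_partials f p) ->
  (forall p, V p -> Rabs (partial_x f p) <= K /\ Rabs (partial_y f p) <= K) ->
  continuous f q.
Proof.
  intros HV Hq H HK. apply continuous_rect; intros e He.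
  specialize (HV q Hq); apply locally_rect in HV; destruct HV as [d [Hd HV]].
  assert (HK0 : 0 <= K).
  { destruct (HK q Hq) as [HK1 _]. eapply Rle_trans; [apply Rabs_pos|exact HK1]. }
  set (e' := e / (2 * (K + 1))).
  assert (He' : 0 < e') by (apply Rdiv_lt_0_compat; lra).
  exists (Rmin d e'); split; [apply Rmin_pos; auto|].
  intros p Hp.
  destruct (mvt_2d f q d q p) as [z1 [z2 [Hz1 [Hz2 E]]]]; auto.
  - apply rect_center; auto.
  - eapply rect_le; [apply Rmin_l|exact Hp].
  - rewrite E. eapply rect_le in Hp; [|apply Rmin_r]. destruct Hp as [Hp1 Hp2].
    destruct (HK z1 (HV _ Hz1)) as [K1 _], (HK z2 (HV _ Hz2)) as [_ K2].
    eapply Rle_lt_trans; [apply Rabs_triang|]; rewrite !Rabs_mult.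
    apply Rle_lt_trans with (K * Rabs (fst p - fst q) + K * Rabs (snd p - snd q)).
    { apply Rplus_le_compat; apply Rmult_le_compat_r; auto using Rabs_pos. }
    replace e with ((K + 1) * (e' + e')) by (unfold e'; field; lra).
    assert (P1 := Rabs_pos (fst p - fst q)). assert (P2 := Rabs_pos (snd p - snd q)).
    revert Hp1 Hp2 P1 P2. generalize (Rabs (fst p - fst q)), (Rabs (snd p - snd q)); intros; nra.
Qed.

Definition dist1 (p q : R * R) : R := Rabs (fst q - fst p) + Rabs (snd q - snd p).

(** Both points vary, which is stronger than differentiability at [p0]; the inverse function theorem
    needs this for injectivity and for the contraction estimate. *)
Lemma strict_differential (f : R * R -> R) (p0 : R * R) (e : R) : C1_at f p0 -> 0 < e ->
  exists d, 0 < d /\ forall p p', rect p0 d p -> rect p0 d p' ->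
    Rabs (f p' - f p - (partial_x f p0 * (fst p' - fst p) + partial_y f p0 * (snd p' - snd p)))
    <= e * dist1 p p'.
Proof.
  intros (H & Cx & Cy) He. apply locally_rect in H; destruct H as [d [Hd H]].
  rewrite continuous_rect in Cx, Cy.
  destruct (Cx e He) as [d1 [Hd1 H1]], (Cy e He) as [d2 [Hd2 H2]].
  destruct (exists_below3 d d1 d2 Hd Hd1 Hd2) as (d' & Hd' & L & L1 & L2).
  exists d'; split; auto. intros p p' Hp Hp'.
  destruct (mvt_2d f p0 d' p p') as [z1 [z2 [Hz1 [Hz2 E]]]]; auto.
  - intros z Hz; eapply H, rect_le; eassumption.
  - rewrite E.
    replace (_ - _) with ((partial_x f z1 - partial_x f p0) * (fst p' - fst p)
                         + (partial_y f z2 - partial_y f p0) * (snd p' - snd p)) by ring.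
    eapply Rle_trans; [apply Rabs_triang|]; unfold dist1; rewrite !Rabs_mult, Rmult_plus_distr_l.
    apply Rplus_le_compat; apply Rmult_le_compat_r; try apply Rabs_pos; apply Rlt_le.
    + eapply H1, rect_le; eassumption.
    + eapply H2, rect_le; eassumption.
Qed.

Lemma is_derive_comp_2d (f : R * R -> R) (g1 g2 : R -> R) (t l1 l2 : R) :
  locally (g1 t, g2 t) (ex_partials f) ->
  continuous (partial_x f) (g1 t, g2 t) -> continuous (partial_y f) (g1 t, g2 t) ->
  is_derive g1 t l1 -> is_derive g2 t l2 ->
  is_derive (fun s => f (g1 s, g2 s)) t
    (partial_x f (g1 t, g2 t) * l1 + partial_y f (g1 t, g2 t) * l2).
Proof.
  intros H Cx Cy H1 H2. apply is_derive_Reals in H1; apply is_derive_Reals in H2.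
  apply is_derive_Reals.
  apply (derivable_pt_lim_comp_2d (fun u v => f (u, v)) g1 g2); auto.
  intros eps. apply locally_2d_locally, locally_rect.
  assert (He : 0 < eps / 2) by (generalize (cond_pos eps); lra).
  destruct (strict_differential f _ _ (conj H (conj Cx Cy)) He) as [d [Hd K]].
  exists d; split; auto. intros [u v] Hp; specialize (K _ _ (rect_center _ _ Hd) Hp); unfold dist1 in K; simpl in *.
  eapply Rle_trans; [exact K|].
  assert (M1 := Rmax_l (Rabs (u - g1 t)) (Rabs (v - g2 t))).
  assert (M2 := Rmax_r (Rabs (u - g1 t)) (Rabs (v - g2 t))).
  generalize (cond_pos eps); nra.
Qed.

Lemma mixed_partials (f : R * R -> R) (V : R * R -> Prop) (q : R * R) :
  open V -> V q ->
  (forall p, V p -> ex_partials f p /\ ex_partials (partial_x f) p /\ ex_partials (partial_y f) p) ->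
  continuous (partial_x (partial_y f)) q -> continuous (partial_y (partial_x f)) q ->
  partial_x (partial_y f) q = partial_y (partial_x f) q.
Proof.
  destruct q as [x y]; intros HV Hq H C1 C2.
  unfold partial_x, partial_y; simpl.
  apply (Schwarz (fun u v => f (u, v)) x y).
  - apply locally_2d_locally. generalize (HV _ Hq); apply filter_imp.
    intros [u v] Hp; destruct (H _ Hp) as [[H1 H2] [[H3 H4] [H5 H6]]]; simpl in *; auto.
  - rewrite continuous_rect in C1. intros eps; apply locally_2d_locally, locally_rect.
    destruct (C1 eps (cond_pos eps)) as [d [Hd K]]; exists d; split; [exact Hd|].
    intros [u v] Hp; apply (K (u, v) Hp).
  - rewrite continuous_rect in C2. intros eps; apply locally_2d_locally, locally_rect.
    destruct (C2 eps (cond_pos eps)) as [d [Hd K]]; exists d; split; [exact Hd|].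
    intros [u v] Hp; apply (K (u, v) Hp).
Qed.

(** * Analytic functions as functions with weighted derivative bounds *)

Definition analytic_norm (V : R * R -> Prop) (M K : R) (f : R * R -> R) : Prop :=
  forall n, smooth_bound n V (fun k => K * weight M k) f.

Lemma analytic_norm_ex_partials V M K f q : analytic_norm V M K f -> V q -> ex_partials f q.
Proof. intros H Hq. destruct (H 1%nat) as [_ [H1 _]]; auto. Qed.

Lemma analytic_norm_subset (V W : R * R -> Prop) M K f :
  subset W V -> analytic_norm V M K f -> analytic_norm W M K f.
Proof. intros H H1 n; eapply smooth_bound_subset; eauto. Qed.

Lemma analytic_norm_ext (V : R * R -> Prop) M K f g :
  open V -> (forall q, V q -> f q = g q) -> analytic_norm V M K f -> analytic_norm V M K g.
Proof. intros H H1 H2 n; eapply smooth_bound_ext; eauto. Qed.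

Lemma analytic_norm_le (V : R * R -> Prop) M M' K K' f :
  0 < M <= M' -> 0 <= K <= K' -> analytic_norm V M K f -> analytic_norm V M' K' f.
Proof.
  intros HM HK H n; eapply smooth_bound_le; [|apply H].
  intros k _; simpl. apply Rmult_le_compat; try lra.
  - apply Rlt_le, weight_pos; lra.
  - apply weight_le; auto.
Qed.

Lemma analytic_norm_plus (V : R * R -> Prop) M K K' f g : open V ->
  analytic_norm V M K f -> analytic_norm V M K' g ->
  analytic_norm V M (K + K') (fun q => f q + g q).
Proof.
  intros HV H H' n. eapply smooth_bound_le; [|apply (smooth_bound_plus n V _ _ _ _ HV (H n) (H' n))].
  intros k _; simpl; lra.
Qed.

Lemma analytic_norm_mult (V : R * R -> Prop) M K K' f g : open V -> 0 < M -> 0 <= K -> 0 <= K' ->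
  analytic_norm V M K f -> analytic_norm V M K' g ->
  analytic_norm V M (8 * K * K') (fun q => f q * g q).
Proof.
  intros HV HM HK HK' H H' n.
  eapply smooth_bound_le; [|apply (smooth_bound_mult n V _ _ _ _ HV (H n) (H' n))].
  intros k _; simpl; rewrite bconv_scal.
  replace (8 * K * K' * weight M k) with (K * K' * (8 * weight M k)) by ring.
  apply Rmult_le_compat_l; [apply Rmult_le_pos; auto|apply weight_bconv; auto].
Qed.

Lemma smooth_bound_const n : forall (V : R * R -> Prop) (k : R) (c : nat -> R), open V ->
  Rabs k <= c O -> (forall j, 0 <= c (S j)) -> smooth_bound n V c (fun _ => k).
Proof.
  induction n as [|n IH]; intros V k c HV H H0; [split; auto|].
  apply (smooth_bound_S n V c _ (fun _ => 0) (fun _ => 0)); auto;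
    [intros q _; apply is_partials_const|apply IH..]; auto; rewrite Rabs_R0; auto.
Qed.

Lemma analytic_norm_const (V : R * R -> Prop) M k : open V -> 0 < M ->
  analytic_norm V M (Rabs k) (fun _ => k).
Proof.
  intros HV HM n; apply smooth_bound_const; auto.
  - rewrite weight_0; lra.
  - intros j; apply Rmult_le_pos; [apply Rabs_pos|apply Rlt_le, weight_pos; auto].
Qed.

(** Derivatives of order two and more vanish. At order one the bound is
    [K * weight M 1 = K * M / 4], which must be at least 1: hence [4 / M <= K]. *)
Lemma analytic_norm_affine (V : R * R -> Prop) M K f l m : open V -> 0 < M ->
  (forall q, V q -> Rabs (f q) <= K) -> Rabs l <= 1 -> Rabs m <= 1 -> 4 / M <= K ->
  (forall q, V q -> is_partials f q l m) -> analytic_norm V M K f.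
Proof.
  intros HV HM H Hl Hm HK D n.
  assert (HK0 : 0 <= K) by (eapply Rle_trans; [|exact HK]; apply Rlt_le, Rdiv_lt_0_compat; lra).
  assert (W1 : 1 <= K * weight M 1).
  { apply Rle_trans with (4 / M * (M / 4)); [right; field; lra|].
    apply Rmult_le_compat; try lra.
    - apply Rlt_le, Rdiv_lt_0_compat; lra.
    - pose proof (weight_S_ge M 0 HM) as W; rewrite weight_0 in W; lra. }
  assert (W2 : forall j, 0 <= K * weight M (S (S j))).
  { intros j; apply Rmult_le_pos; auto; apply Rlt_le, weight_pos; auto. }
  assert (B : forall q, V q -> Rabs (f q) <= K * weight M 0) by (intros; rewrite weight_0, Rmult_1_r; auto).
  destruct n as [|n]; [split; auto|].
  apply (smooth_bound_S n V _ _ (fun _ => l) (fun _ => m)); auto; apply smooth_bound_const; auto; lra.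
Qed.

Lemma analytic_norm_partial (V : R * R -> Prop) M K f : 0 < M -> 0 <= K -> analytic_norm V M K f ->
  analytic_norm V (2 * M) (K * M) (partial_x f) /\ analytic_norm V (2 * M) (K * M) (partial_y f).
Proof.
  intros HM HK H; split; intros n; specialize (H (S n)); destruct H as [_ [_ [H1 H2]]];
    (eapply smooth_bound_le; [|eassumption]); intros k _; simpl;
    rewrite Rmult_assoc; apply Rmult_le_compat_l; auto; apply weight_S_le; auto.
Qed.

Lemma analytic_norm_continuous (V : R * R -> Prop) M K f q : open V -> V q ->
  analytic_norm V M K f -> continuous f q.
Proof.
  intros HV Hq H. apply (bounded_partials_continuous f V (K * weight M 1)); auto.
  - intros; eapply analytic_norm_ex_partials; eauto.
  - intros p Hp; destruct (H 1%nat) as [_ [_ [[H1 _] [H2 _]]]]; split; auto.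
Qed.

Definition analytic_on (V : R * R -> Prop) (f : R * R -> R) : Prop :=
  exists M K, 0 < M /\ 0 <= K /\ analytic_norm V M K f.

Lemma analytic_on_common (V : R * R -> Prop) f g : analytic_on V f -> analytic_on V g ->
  exists M K, 0 < M /\ 0 <= K /\ analytic_norm V M K f /\ analytic_norm V M K g.
Proof.
  intros [M [K [HM [HK H]]]] [M' [K' [HM' [HK' H']]]].
  exists (Rmax M M'), (Rmax K K').
  assert (A1 := Rmax_l M M'). assert (A2 := Rmax_r M M').
  assert (A3 := Rmax_l K K'). assert (A4 := Rmax_r K K').
  split; [lra|]; split; [lra|]; split; (eapply analytic_norm_le; [| |eassumption]; lra).
Qed.

Lemma analytic_on_subset (V W : R * R -> Prop) f :
  subset W V -> analytic_on V f -> analytic_on W f.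
Proof. intros H (M & K & HM & HK & A); exists M, K; eauto using analytic_norm_subset. Qed.

Lemma analytic_on_ext (V : R * R -> Prop) f g :
  open V -> (forall q, V q -> f q = g q) -> analytic_on V f -> analytic_on V g.
Proof. intros HV H (M & K & HM & HK & A); exists M, K; eauto using analytic_norm_ext. Qed.

Lemma analytic_on_plus (V : R * R -> Prop) f g : open V ->
  analytic_on V f -> analytic_on V g -> analytic_on V (fun q => f q + g q).
Proof.
  intros HV Hf Hg. destruct (analytic_on_common V f g Hf Hg) as (M & K & HM & HK & A & B).
  exists M, (K + K); split; [auto|]; split; [lra|]. apply analytic_norm_plus; auto.
Qed.

Lemma analytic_on_mult (V : R * R -> Prop) f g : open V ->
  analytic_on V f -> analytic_on V g -> analytic_on V (fun q => f q * g q).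
Proof.
  intros HV Hf Hg. destruct (analytic_on_common V f g Hf Hg) as (M & K & HM & HK & A & B).
  exists M, (8 * K * K); split; [auto|]; split; [nra|]. apply analytic_norm_mult; auto.
Qed.

Lemma analytic_on_const (V : R * R -> Prop) k : open V -> analytic_on V (fun _ => k).
Proof.
  intros HV; exists 1, (Rabs k); split; [lra|]; split; [apply Rabs_pos|].
  apply analytic_norm_const; auto; lra.
Qed.

Lemma analytic_on_minus (V : R * R -> Prop) f g : open V ->
  analytic_on V f -> analytic_on V g -> analytic_on V (fun q => f q - g q).
Proof.
  intros HV Hf Hg.
  eapply analytic_on_ext; [auto| |apply (analytic_on_plus V f (fun q => -1 * g q)); auto].
  - intros; simpl; ring.
  - apply analytic_on_mult; auto using analytic_on_const.
Qed.

Lemma analytic_on_partial_x (V : R * R -> Prop) f : analytic_on V f -> analytic_on V (partial_x f).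
Proof.
  intros (M & K & HM & HK & A); exists (2 * M), (K * M); split; [lra|]; split; [nra|].
  apply analytic_norm_partial; auto.
Qed.

Lemma analytic_on_partial_y (V : R * R -> Prop) f : analytic_on V f -> analytic_on V (partial_y f).
Proof.
  intros (M & K & HM & HK & A); exists (2 * M), (K * M); split; [lra|]; split; [nra|].
  apply analytic_norm_partial; auto.
Qed.

Lemma analytic_on_continuous (V : R * R -> Prop) f q : open V -> V q ->
  analytic_on V f -> continuous f q.
Proof. intros HV Hq (M & K & HM & HK & A); eapply analytic_norm_continuous; eauto. Qed.

Lemma analytic_on_ex_partials (V : R * R -> Prop) f q : V q -> analytic_on V f -> ex_partials f q.
Proof. intros Hq (M & K & HM & HK & A); eapply analytic_norm_ex_partials; eauto. Qed.

Lemma analytic_on_mixed_partials (V : R * R -> Prop) f q : open V -> V q -> analytic_on V f ->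
  partial_x (partial_y f) q = partial_y (partial_x f) q.
Proof.
  intros HV Hq H. apply (mixed_partials f V); auto.
  - intros p Hp; split; [|split]; eapply analytic_on_ex_partials;
      eauto using analytic_on_partial_x, analytic_on_partial_y.
  - eapply analytic_on_continuous; eauto using analytic_on_partial_x, analytic_on_partial_y.
  - eapply analytic_on_continuous; eauto using analytic_on_partial_x, analytic_on_partial_y.
Qed.

Lemma analytic_on_is_derive_comp (V : R * R -> Prop) (f : R * R -> R) (g1 g2 : R -> R) (t l1 l2 : R) :
  open V -> analytic_on V f -> V (g1 t, g2 t) -> is_derive g1 t l1 -> is_derive g2 t l2 ->
  is_derive (fun s => f (g1 s, g2 s)) t
    (partial_x f (g1 t, g2 t) * l1 + partial_y f (g1 t, g2 t) * l2).
Proof.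
  intros HV Hf Ht H1 H2. apply is_derive_comp_2d; auto.
  - generalize (HV _ Ht); apply filter_imp; intros; eapply analytic_on_ex_partials; eauto.
  - eapply analytic_on_continuous; eauto using analytic_on_partial_x.
  - eapply analytic_on_continuous; eauto using analytic_on_partial_y.
Qed.

Lemma smooth_bound_scal (a : R) n : forall (V : R * R -> Prop) c f, open V ->
  smooth_bound n V c f -> smooth_bound n V (fun k => Rabs a * c k) (fun q => a * f q).
Proof.
  induction n as [|n IH]; intros V c f HV [H0 H1];
    assert (B : forall q, V q -> Rabs (a * f q) <= Rabs a * c O)
      by (intros q Hq; rewrite Rabs_mult; apply Rmult_le_compat_l; auto using Rabs_pos);
    [split; auto|].
  destruct H1 as [H1 [H2 H3]].
  apply (smooth_bound_S n V _ _ (fun q => a * partial_x f q) (fun q => a * partial_y f q) HV B).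
  - intros q Hq; destruct (ex_partials_is f q (H1 q Hq)) as [L1 L2]; split.
    + exact (is_derive_scal _ _ a _ L1).
    + exact (is_derive_scal _ _ a _ L2).
  - exact (IH V _ _ HV H2).
  - exact (IH V _ _ HV H3).
Qed.

Lemma smooth_bound_opp n (V : R * R -> Prop) c f : open V ->
  smooth_bound n V c f -> smooth_bound n V c (fun q => - f q).
Proof.
  intros HV H. eapply smooth_bound_ext; [auto| |eapply smooth_bound_le; [|exact (smooth_bound_scal (-1) n V c f HV H)]].
  - intros; simpl; ring.
  - intros k _; cbv beta; rewrite Rabs_left by lra; lra.
Qed.

Lemma bconv_le (c c' d d' : nat -> R) (j : nat) :
  (forall i, 0 <= c i <= c' i) -> (forall i, 0 <= d i <= d' i) ->
  0 <= bconv c d j <= bconv c' d' j.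
Proof.
  revert c c' d d'; induction j as [|j IHj]; intros c c' d d' Q1 Q2; simpl.
  - split; [apply Rmult_le_pos; [apply Q1|apply Q2]|apply Rmult_le_compat; try apply Q1; apply Q2].
  - destruct (IHj (fun i => c (S i)) (fun i => c' (S i)) d d'); auto.
    destruct (IHj c c' (fun i => d (S i)) (fun i => d' (S i))); auto. lra.
Qed.

(** From [(1/f)_x = - (1/f)^2 f_x] the bounds propagate by induction on the order. *)
Lemma analytic_on_inv (V : R * R -> Prop) f m : open V -> 0 < m ->
  (forall q, V q -> m <= Rabs (f q)) -> analytic_on V f -> analytic_on V (fun q => / f q).
Proof.
  intros HV Hm Hf (M & K & HM & HK & A).
  set (C := / m). assert (HC : 0 < C) by (apply Rinv_0_lt_compat; auto).
  set (D := K * M). assert (HD : 0 <= D) by (apply Rmult_le_pos; lra).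
  destruct (analytic_norm_partial V M K f HM HK A) as [Ax Ay]; fold D in Ax, Ay.
  (* The double convolution costs [8 * 8], so the induction needs [64 C^2 D weight N k <= C weight N
     (k + 1)]. By [weight_S_ge] it suffices that [N / 4 >= 64 C D]. *)
  set (N := 2 * M + 256 * C * D).
  assert (HN : 2 * M <= N) by (unfold N; nra).
  assert (HN0 : 0 < N) by lra.
  assert (Ax' : analytic_norm V N D (partial_x f)) by (eapply analytic_norm_le; [| |exact Ax]; lra).
  assert (Ay' : analytic_norm V N D (partial_y f)) by (eapply analytic_norm_le; [| |exact Ay]; lra).
  exists N, C; split; [lra|]; split; [lra|].
  assert (nz : forall q, V q -> f q <> 0).
  { intros q Hq E; specialize (Hf q Hq); rewrite E, Rabs_R0 in Hf; lra. }
  assert (L : forall q, V q -> is_partials (fun q => / f q) q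
     (- / f q * / f q * partial_x f q) (- / f q * / f q * partial_y f q)).
  { intros q Hq; apply is_partials_comp; [apply ex_partials_is; eapply analytic_norm_ex_partials; eauto|].
    replace (- / f q * / f q) with (- 1 / f q ^ 2) by (field; auto).
    apply (is_derive_inv (fun z => z)); auto. apply (is_derive_id (K := R_AbsRing)). }
  assert (B : forall q, V q -> Rabs (/ f q) <= C * weight N 0).
  { intros q Hq; rewrite weight_0, Rmult_1_r, Rabs_inv; apply Rinv_le_contravar; auto. }
  assert (W : forall k, 64 * C * C * D * weight N k <= C * weight N (S k)).
  { intros k. apply Rle_trans with (C * (N / 4 * weight N k)).
    - assert (P := weight_pos N k HN0).
      replace (C * (N / 4 * weight N k)) with (C * N / 4 * weight N k) by field.
      apply Rmult_le_compat_r; [lra|]. unfold N. nra.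
    - apply Rmult_le_compat_l; [lra|apply weight_S_ge; auto]. }
  intros n; induction n as [|n IH]; [split; auto|].
  assert (P : forall g, analytic_norm V N D g ->
     smooth_bound n V (fun k => C * weight N (S k)) (fun q => - / f q * / f q * g q)).
  { intros g Hg.
    assert (H := smooth_bound_mult n V _ _ _ _ HV (smooth_bound_mult n V _ _ _ _ HV IH IH) (Hg n)).
    eapply smooth_bound_ext; [auto| |eapply smooth_bound_le; [|exact (smooth_bound_opp n V _ _ HV H)]].
    - intros; simpl; ring.
    - intros k _. cbv beta.
      assert (W0 : forall i, 0 <= weight N i) by (intros; apply Rlt_le, weight_pos; auto).
      assert (W1 : forall i, 0 <= bconv (fun j => C * weight N j) (fun j => C * weight N j) i
                     <= 8 * C * C * weight N i).
      { intros i; rewrite bconv_scal. split.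
        - apply Rmult_le_pos; [nra|].
          apply (bconv_le (weight N) (weight N) (weight N) (weight N)); intros; split; auto; lra.
        - replace (8 * C * C * weight N i) with (C * C * (8 * weight N i)) by ring.
          apply Rmult_le_compat_l; [nra|apply weight_bconv; auto]. }
      assert (W2 : forall i, 0 <= bconv (bconv (fun j => C * weight N j) (fun j => C * weight N j))
                      (fun j => D * weight N j) i <= 64 * C * C * D * weight N i).
      { intros i. destruct (bconv_le (bconv (fun j => C * weight N j) (fun j => C * weight N j))
            (fun j => 8 * C * C * weight N j) (fun j => D * weight N j) (fun j => D * weight N j) i) as [Q1 Q2]; auto.
        - intros j; split; [apply Rmult_le_pos; auto|lra].
        - split; auto. eapply Rle_trans; [exact Q2|]. rewrite bconv_scal.
          replace (64 * C * C * D * weight N i) with (8 * C * C * D * (8 * weight N i)) by ring.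
          apply Rmult_le_compat_l; [|apply weight_bconv; auto].
          assert (0 <= C * C * D) by (apply Rmult_le_pos; nra). lra. }
      eapply Rle_trans; [apply W2|apply W]. }
  exact (smooth_bound_S n V _ _ _ _ HV B L (P _ Ax') (P _ Ay')).
Qed.

Lemma analytic_on_coordinates (c : R * R) (d : R) : 0 < d ->
  analytic_on (rect c d) fst /\ analytic_on (rect c d) snd.
Proof.
  intros Hd.
  assert (B : forall u v, Rabs (u - v) < d -> Rabs u <= Rabs v + d + 1).
  { intros u v H. replace u with (v + (u - v)) by ring.
    eapply Rle_trans; [apply Rabs_triang|lra]. }
  split.
  - exists 4, (Rabs (fst c) + d + 1). assert (P := Rabs_pos (fst c)).
    split; [lra|]; split; [lra|].
    apply analytic_norm_affine with 1 0; auto using open_rect; try (rewrite ?Rabs_R1, ?Rabs_R0; lra); try lra.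
    + intros q [Hq _]; auto.
    + intros q _; apply is_partials_fst.
  - exists 4, (Rabs (snd c) + d + 1). assert (P := Rabs_pos (snd c)).
    split; [lra|]; split; [lra|].
    apply analytic_norm_affine with 0 1; auto using open_rect; try (rewrite ?Rabs_R1, ?Rabs_R0; lra); try lra.
    + intros q [_ Hq]; auto.
    + intros q _; apply is_partials_snd.
Qed.

(** * Series of analytic functions *)

Lemma ex_series_dominated (a b : nat -> R) :
  (forall n, Rabs (a n) <= b n) -> ex_series b -> ex_series a.
Proof. intros H; apply (ex_series_le (K := R_AbsRing) (V := R_CompleteNormedModule) a b H). Qed.

Lemma Series_dominated (a b : nat -> R) :
  (forall n, Rabs (a n) <= b n) -> ex_series b -> Rabs (Series a) <= Series b.
Proof.
  intros H Hb. eapply Rle_trans; [apply Series_Rabs|apply Series_le; auto].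
  - apply ex_series_dominated with b; auto; intros; rewrite Rabs_Rabsolu; auto.
  - intros n; split; [apply Rabs_pos|auto].
Qed.

Lemma ex_series_Rscal (r : R) (c : nat -> R) : ex_series c -> ex_series (fun n => r * c n).
Proof. exact (ex_series_scal_l (K := R_AbsRing) (V := R_NormedModule) r c). Qed.

(** Two uses of the mean value theorem bound the error of the [n]-th difference quotient by
    [r * c n] through the second derivative; summing over [n] replaces any argument by uniform
    convergence. *)
Lemma is_derive_series (f f' f'' : nat -> R -> R) (c : nat -> R) (z d : R) :
  0 < d -> ex_series c ->
  (forall n y, Rabs (y - z) < d -> is_derive (f n) y (f' n y) /\ is_derive (f' n) y (f'' n y) /\
     Rabs (f n y) <= c n /\ Rabs (f' n y) <= c n /\ Rabs (f'' n y) <= c n) ->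
  is_derive (fun y => Series (fun n => f n y)) z (Series (fun n => f' n z)).
Proof.
  intros Hd Hc H.
  assert (Hz : Rabs (z - z) < d) by (unfold Rminus; rewrite Rplus_opp_r, Rabs_R0; auto).
  assert (c0 : forall n, 0 <= c n).
  { intros n; destruct (H n z Hz) as (_ & _ & H1 & _); eapply Rle_trans; [apply Rabs_pos|exact H1]. }
  assert (S0 : 0 <= Series c).
  { replace 0 with (Series (fun _ : nat => 0 * 0)) by (rewrite Series_scal_l; ring).
    apply Series_le; auto. intros n; rewrite Rmult_0_l; split; [lra|apply c0]. }
  assert (E1 : forall y, Rabs (y - z) < d -> ex_series (fun n => f n y)).
  { intros y Hy; apply ex_series_dominated with c; auto; intros n; apply H; auto. }
  assert (E2 : ex_series (fun n => f' n z)).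
  { apply ex_series_dominated with c; auto; intros n; apply H; auto. }
  apply is_derive_Reals; intros eps Heps.
  set (r := Rmin d (eps / (Series c + 1) / 2)).
  assert (Hr : 0 < r) by (apply Rmin_pos; auto; repeat apply Rdiv_lt_0_compat; lra).
  assert (Hr1 : r <= d) by apply Rmin_l.
  exists (mkposreal r Hr); intros h h0 Hh; simpl in Hh.
  assert (Hy : Rabs (z + h - z) < r) by (replace (z + h - z) with h by ring; auto).
  assert (Hz' : Rabs (z - z) < r) by (unfold Rminus; rewrite Rplus_opp_r, Rabs_R0; auto).
  rewrite <- Series_minus by (apply E1; lra).
  unfold Rdiv at 1; rewrite <- Series_scal_r.
  assert (B : forall n, Rabs ((f n (z + h) - f n z) * / h - f' n z) <= r * c n).
  { intros n.
    destruct (mvt_1d (f n) z r z (z + h)) as [y [Hy1 E]]; auto.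
    { intros u Hu; exists (f' n u); apply (H n u); lra. }
    rewrite E, (is_derive_unique _ _ _ (proj1 (H n y ltac:(lra)))).
    replace (f' n y * (z + h - z) * / h - f' n z) with (f' n y - f' n z) by (field; auto).
    destruct (mvt_1d (f' n) z r z y) as [x [Hx1 E']]; auto.
    { intros u Hu; exists (f'' n u); apply (H n u); lra. }
    rewrite E', Rabs_mult.
    destruct (H n x) as (_ & K & _ & _ & K'); [lra|].
    rewrite (is_derive_unique _ _ _ K), Rmult_comm.
    apply Rmult_le_compat; try apply Rabs_pos; lra. }
  assert (EB : ex_series (fun n => r * c n)) by (apply ex_series_Rscal; auto).
  rewrite <- Series_minus; auto.
  2:{ apply (ex_series_scal_r (/ h) (fun n => f n (z + h) - f n z)).
      apply (ex_series_minus (fun n => f n (z + h))); apply E1; lra. }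
  eapply Rle_lt_trans; [apply Series_dominated with (b := fun n => r * c n); auto|].
  rewrite Series_scal_l.
  apply Rle_lt_trans with (eps / (Series c + 1) / 2 * (Series c + 1)).
  - apply Rmult_le_compat; try lra. apply Rmin_r.
  - replace (eps / (Series c + 1) / 2 * (Series c + 1)) with (eps / 2) by (field; lra). lra.
Qed.

(** The bound separates the index of the series from the order of differentiation, so the same
    summable [c] controls the differentiated series at every order. *)
Lemma smooth_bound_series m : forall (V : R * R -> Prop) (c w : nat -> R) (f : nat -> R * R -> R),
  open V -> ex_series c -> (forall N, 0 <= c N) -> (forall k, 0 <= w k) ->
  (forall N n, smooth_bound n V (fun k => c N * w k) (f N)) ->
  smooth_bound m V (fun k => Series c * w k) (fun q => Series (fun N => f N q)).
Proof.
  induction m as [|m IH]; intros V c w f HV Hc c0 w0 H;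
    assert (B : forall q, V q -> Rabs (Series (fun N => f N q)) <= Series c * w O)
      by (intros q Hq; rewrite Rmult_comm, <- Series_scal_l;
          apply Series_dominated; [|apply ex_series_Rscal, Hc];
          intros N; destruct (H N O) as [HN _]; rewrite Rmult_comm; auto);
    [split; auto|].
  - assert (L : forall q, V q -> is_partials (fun q => Series (fun N => f N q)) q
       (Series (fun N => partial_x (f N) q)) (Series (fun N => partial_y (f N) q))).
    { intros [x y] Hq. specialize (HV _ Hq); apply locally_rect in HV; destruct HV as [d [Hd HV]].
      (* One constant for the orders 0, 1 and 2 that [is_derive_series] involves. *)
      set (W := w 0%nat + w 1%nat + w 2%nat).
      assert (C' : ex_series (fun N => c N * W)) by (apply (ex_series_scal_r W), Hc).
      assert (Hb : forall N p, V p -> Rabs (f N p) <= c N * W /\ Rabs (partial_x (f N) p) <= c N * W /\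
         Rabs (partial_y (f N) p) <= c N * W /\ Rabs (partial_x (partial_x (f N)) p) <= c N * W /\
         Rabs (partial_y (partial_y (f N)) p) <= c N * W).
      { intros N p Hp. destruct (H N 2%nat) as [B0 [_ [[B1 [_ [[B2 _] _]]] [B3 [_ [_ [B4 _]]]]]]].
        assert (W0 := w0 0%nat); assert (W1 := w0 1%nat); assert (W2 := w0 2%nat).
        assert (CN := c0 N). unfold W.
        specialize (B0 p Hp); specialize (B1 p Hp); specialize (B2 p Hp).
        specialize (B3 p Hp); specialize (B4 p Hp).
        repeat split; eapply Rle_trans; try eassumption; apply Rmult_le_compat_l; lra. }
      assert (He : forall N p, V p -> ex_partials (f N) p /\ ex_partials (partial_x (f N)) p /\
         ex_partials (partial_y (f N)) p).
      { intros N p Hp. destruct (H N 2%nat) as [_ [B0 [[_ [B1 _]] [_ [B2 _]]]]]; auto. }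
      split; simpl.
      - apply (is_derive_series (fun N a => f N (a, y)) (fun N a => partial_x (f N) (a, y))
                 (fun N a => partial_x (partial_x (f N)) (a, y)) (fun N => c N * W) x d); auto.
        intros n a Ha. assert (Hp : V (a, y)).
        { apply HV; split; simpl; auto; unfold Rminus; rewrite Rplus_opp_r, Rabs_R0; auto. }
        destruct (Hb n _ Hp) as (B0 & B1 & _ & B2 & _), (He n _ Hp) as (D0 & D1 & _).
        split; [exact (Derive_correct _ _ (proj1 D0))|]; split; [exact (Derive_correct _ _ (proj1 D1))|auto].
      - apply (is_derive_series (fun N b => f N (x, b)) (fun N b => partial_y (f N) (x, b))
                 (fun N b => partial_y (partial_y (f N)) (x, b)) (fun N => c N * W) y d); auto.
        intros n b Hb'. assert (Hp : V (x, b)).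
        { apply HV; split; simpl; auto; unfold Rminus; rewrite Rplus_opp_r, Rabs_R0; auto. }
        destruct (Hb n _ Hp) as (B0 & _ & B1 & _ & B2), (He n _ Hp) as (D0 & _ & D1).
        split; [exact (Derive_correct _ _ (proj2 D0))|]; split; [exact (Derive_correct _ _ (proj2 D1))|auto]. }
    apply (smooth_bound_S m V _ _ _ _ HV B L); apply IH; auto; intros N n; apply (H N (S n)).
Qed.

Lemma analytic_norm_series (V : R * R -> Prop) M (c : nat -> R) (f : nat -> R * R -> R) :
  open V -> 0 < M -> ex_series c -> (forall N, 0 <= c N) ->
  (forall N, analytic_norm V M (c N) (f N)) ->
  analytic_norm V M (Series c) (fun q => Series (fun N => f N q)).
Proof.
  intros HV HM Hc c0 H n. apply smooth_bound_series; auto.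
  intros; apply Rlt_le, weight_pos; auto.
Qed.

(** * The folded extension as a power series *)

(** [((h + z)^n + (h - z)^n) / 2] for [z^2 = -s]. *)
Fixpoint sym_pow (n : nat) (h s : R) : R :=
  match n with
  | O => 1
  | S O => h
  | S (S k as m) => 2 * (h * sym_pow m h s) - (h * h + s) * sym_pow k h s
  end.

Lemma sym_pow_SS n h s :
  sym_pow (S (S n)) h s = 2 * (h * sym_pow (S n) h s) - (h * h + s) * sym_pow n h s.
Proof. reflexivity. Qed.

(** [h + z] and [h - z] are the roots of [X^2 - 2 h X + (h^2 + s)], so their power sums obey the
    recurrence that defines [sym_pow]. *)
Lemma sym_pow_complex (z : C) (h s : R) (n : nat) : (z * z)%C = RtoC (- s) ->
  ((pow_n (K := C_AbsRing) (RtoC h + z) n + pow_n (K := C_AbsRing) (RtoC h - z) n) / RtoC 2)%C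
  = RtoC (sym_pow n h s).
Proof.
  intros Hz.
  assert (H2 : RtoC 2 <> RtoC 0) by (intros E; apply RtoC_inj in E; lra).
  enough (H : forall m, ((pow_n (K := C_AbsRing) (RtoC h + z) m + pow_n (K := C_AbsRing) (RtoC h - z) m))%C
       = (RtoC 2 * RtoC (sym_pow m h s))%C) by (rewrite H; field; auto).
  clear n.
  assert (S1 : forall w m, pow_n (K := C_AbsRing) w (S m) = (w * pow_n (K := C_AbsRing) w m)%C) by reflexivity.
  assert (P : forall m,
    ((pow_n (K := C_AbsRing) (RtoC h + z) m + pow_n (K := C_AbsRing) (RtoC h - z) m))%C
       = (RtoC 2 * RtoC (sym_pow m h s))%C /\
    ((pow_n (K := C_AbsRing) (RtoC h + z) (S m) + pow_n (K := C_AbsRing) (RtoC h - z) (S m)))%C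
       = (RtoC 2 * RtoC (sym_pow (S m) h s))%C).
  2:{ intros m; apply P. }
  induction m as [|m [IH1 IH2]].
  - assert (E : forall w, pow_n (K := C_AbsRing) w 0 = RtoC 1) by reflexivity.
    rewrite !S1, !E; simpl. split; [rewrite <- RtoC_plus, <- RtoC_mult; f_equal; ring|].
    replace (RtoC 2) with (RtoC 1 + RtoC 1)%C by (rewrite <- RtoC_plus; f_equal; ring).
    ring.
  - split; [exact IH2|].
    rewrite sym_pow_SS, RtoC_minus, !RtoC_mult, RtoC_plus, RtoC_mult.
    replace (RtoC s) with (- (z * z))%C by (rewrite Hz, RtoC_opp; ring).
    replace (RtoC 2 * (RtoC 2 * (RtoC h * RtoC (sym_pow (S m) h s)) -
       (RtoC h * RtoC h + - (z * z)) * RtoC (sym_pow m h s)))%C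
      with (RtoC 2 * RtoC h * (RtoC 2 * RtoC (sym_pow (S m) h s)) -
       (RtoC h * RtoC h + - (z * z)) * (RtoC 2 * RtoC (sym_pow m h s)))%C by ring.
    rewrite <- IH1, <- IH2, !S1.
    replace (RtoC 2) with (RtoC 1 + RtoC 1)%C by (rewrite <- RtoC_plus; f_equal; ring).
    ring.
Qed.

(** On this square, with [M = 4 / e], the functions [h] and [s] have norm at most [e]. The
    recurrence then asks for [16 e th + 64 e^2 + 8 e <= th^2]; the conditions on [e] make the terms
    at most [1/2], [1/16] and [1/4] of [th^2]. *)
Lemma sym_pow_norm (t th e : R) : 0 < th -> 0 < e -> e <= th / 32 -> e <= th ^ 2 / 32 ->
  forall n, analytic_norm (rect (t, 0) e) (4 / e) (th ^ n)
              (fun q => sym_pow n (fst q - t) (snd q)).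
Proof.
  intros Hth He H1 H2.
  set (V := rect (t, 0) e). assert (HV : open V) by apply open_rect.
  set (M := 4 / e). assert (HM : 0 < M) by (apply Rdiv_lt_0_compat; lra).
  assert (HMe : 4 / M <= e) by (unfold M; right; field; lra).
  assert (Ah : analytic_norm V M e (fun q => fst q - t)).
  { apply analytic_norm_affine with 1 0; auto; try (rewrite ?Rabs_R1, ?Rabs_R0; lra).
    - intros q Hq; apply Rlt_le, Hq.
    - intros q _. replace 1 with (1 + 0) by ring. replace 0 with (0 + 0) at 2 by ring.
      apply (is_partials_plus fst (fun _ => - t)); [apply is_partials_fst|apply is_partials_const]. }
  assert (As : analytic_norm V M e (fun q => snd q)).
  { apply analytic_norm_affine with 0 1; auto; try (rewrite ?Rabs_R1, ?Rabs_R0; lra).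
    - intros q Hq; destruct Hq as [_ Hq]; simpl in Hq; rewrite Rminus_0_r in Hq; lra.
    - intros q _; apply is_partials_snd. }
  assert (P : forall n, 0 < th ^ n) by (intros; apply pow_lt; auto).
  enough (Q : forall n, analytic_norm V M (th ^ n) (fun q => sym_pow n (fst q - t) (snd q)) /\
     analytic_norm V M (th ^ S n) (fun q => sym_pow (S n) (fst q - t) (snd q)))
    by (intros n; apply Q).
  induction n as [|n [IH1 IH2]].
  - split.
    + rewrite pow_O, <- Rabs_R1; exact (analytic_norm_const V M 1 HV HM).
    + rewrite pow_1; eapply analytic_norm_le; [| |exact Ah]; lra.
  - split; [exact IH2|].
    assert (A1 := analytic_norm_mult V M _ _ _ _ HV HM (Rlt_le _ _ He) (Rlt_le _ _ (P _)) Ah IH2).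
    assert (A2 := analytic_norm_mult V M _ _ _ _ HV HM (Rlt_le _ _ He) (Rlt_le _ _ (P _)) Ah IH1).
    assert (A3 := analytic_norm_mult V M _ _ _ _ HV HM (Rlt_le _ _ He) (Rlt_le _ _ (P _)) As IH1).
    assert (Q1 : 0 <= 8 * e * th ^ n) by (specialize (P n); nra).
    assert (A4 := analytic_norm_mult V M _ _ _ _ HV HM (Rlt_le _ _ He) Q1 Ah A2).
    assert (A5 := analytic_norm_plus V M _ _ _ _ HV A4 A3).
    assert (A6 : analytic_norm V M (8 * e * (8 * e * th ^ n) + 8 * e * th ^ n)
       (fun q => - ((fst q - t) * ((fst q - t) * sym_pow n (fst q - t) (snd q))
                 + snd q * sym_pow n (fst q - t) (snd q)))).
    { intros k; apply smooth_bound_opp; auto. }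
    assert (A7 := analytic_norm_plus V M _ _ _ _ HV (analytic_norm_plus V M _ _ _ _ HV A1 A1) A6).
    eapply analytic_norm_ext; [auto| |eapply analytic_norm_le; [| |exact A7]].
    + intros q _; rewrite sym_pow_SS; ring.
    + lra.
    + specialize (P n). simpl (th ^ S (S n)); simpl (th ^ S n).
      set (p := th ^ n) in *. split; [repeat apply Rplus_le_le_0_compat; repeat apply Rmult_le_pos; lra|].
      replace (_ + _) with (p * (16 * e * th + 64 * e * e + 8 * e)) by ring.
      replace (th * (th * p)) with (p * (th * th)) by ring.
      apply Rmult_le_compat_l; [lra|]. simpl in H2. nra.
Qed.

Lemma is_series_C_components (a : nat -> C) (l : C) :
  @is_series C_AbsRing (AbsRing_NormedModule C_AbsRing) a l ->
  is_series (fun n => fst (a n)) (fst l) /\ is_series (fun n => snd (a n)) (snd l).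
Proof.
  intros H.
  assert (S1 : forall n, fst (@sum_n (NormedModule.AbelianMonoid C_AbsRing (AbsRing_NormedModule C_AbsRing)) a n)
            = sum_n (fun n => fst (a n)) n).
  { induction n; [rewrite !sum_O; auto|rewrite !sum_Sn, <- IHn; reflexivity]. }
  assert (S2 : forall n, snd (@sum_n (NormedModule.AbelianMonoid C_AbsRing (AbsRing_NormedModule C_AbsRing)) a n)
            = sum_n (fun n => snd (a n)) n).
  { induction n; [rewrite !sum_O; auto|rewrite !sum_Sn, <- IHn; reflexivity]. }
  assert (H' := proj1 (filterlim_locally _ _) H).
  split; apply filterlim_locally; intros eps; generalize (H' eps); apply filter_imp; intros n Hn;
    unfold ball in *; simpl in *; unfold AbsRing_ball, abs, minus, plus, opp in *; simpl in *.
  - rewrite <- S1. eapply Rle_lt_trans; [|exact Hn].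
    eapply Rle_trans; [|apply Rmax_Cmod]; apply Rmax_l.
  - rewrite <- S2. eapply Rle_lt_trans; [|exact Hn].
    eapply Rle_trans; [|apply Rmax_Cmod]; apply Rmax_r.
Qed.

(** Serves for the imaginary parts of the Taylor coefficients of [F], which is real on the axis.
    Convergence at [e / 2] gives a positive radius, and then power series are unique. *)
Lemma real_on_axis_coefficients (a : nat -> R) (e : R) :
  0 < e -> (forall h, Rabs h < e -> is_series (fun n => h ^ n * a n) 0) -> forall n, a n = 0.
Proof.
  intros He H.
  assert (E : forall h, Rabs h < e -> PSeries a h = 0).
  { intros h Hh. apply is_series_unique. eapply is_series_ext; [|apply H, Hh].
    intros n; simpl; ring. }
  assert (CV : Rbar_lt 0 (CV_radius a)).
  { apply Rbar_lt_le_trans with (Rabs (e / 2)); [simpl; rewrite Rabs_pos_eq; lra|].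
    apply CV_radius_bounded.
    assert (L : is_lim_seq (fun n => (e / 2) ^ n * a n) 0).
    { apply ex_series_lim_0. exists 0. apply H. rewrite Rabs_pos_eq; lra. }
    destruct (filterlim_bounded (fun n => (e / 2) ^ n * a n)) as [M HM]; [exists 0; exact L|].
    exists M; intros n. specialize (HM n). rewrite (Rmult_comm (a n)), (Rabs_pos_eq (e / 2)) by lra. exact HM. }
  intros n. change 0 with ((fun _ : nat => 0) n).
  assert (C0 : CV_radius (fun _ : nat => 0) = p_infty) by apply CV_radius_const_0.
  apply PSeries_ext_recip; auto.
  - rewrite C0; simpl; auto.
  - exists (mkposreal e He); intros h Hh. rewrite PSeries_const_0. apply E.
    apply ball_Rabs in Hh; simpl in Hh.
    rewrite Rminus_0_r in Hh; auto.
Qed.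

Lemma Cmod_cplus_lt (h d : R) (z : C) : Rabs h < d -> Cmod z < d -> Cmod (RtoC h + z) < d + d.
Proof.
  intros H1 H2; eapply Rle_lt_trans; [apply Cmod_triangle|]. rewrite Cmod_R; lra.
Qed.

Lemma half_components (u v : C) : ((u + v) / RtoC 2)%C = ((fst u + fst v) / 2, (snd u + snd v) / 2).
Proof.
  destruct u, v; unfold Cdiv, Cinv, Cmult, Cplus, RtoC; simpl; f_equal; field.
Qed.

(** Merges the two branches of [fold]: [z] is [i sqrt s] or [sqrt |s|], and only [z^2 = - s] matters
    afterwards. *)
Lemma fold_sym (F : C -> C) (t h s : R) :
  exists z : C, (z * z)%C = RtoC (- s) /\ Cmod z = sqrt (Rabs s) /\
    fold F (t + h) s = ((F (RtoC t + (RtoC h + z)) + F (RtoC t + (RtoC h - z))) / RtoC 2)%C.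
Proof.
  unfold fold, cplus, cminus. destruct (Rle_dec 0 s) as [Hs|Hs].
  - exists (Ci * RtoC (sqrt s))%C; split; [|split].
    + replace (Ci * RtoC (sqrt s) * (Ci * RtoC (sqrt s)))%C with (Ci * Ci * (RtoC (sqrt s) * RtoC (sqrt s)))%C by ring.
      rewrite <- RtoC_mult, sqrt_sqrt by auto.
      replace (Ci * Ci)%C with (RtoC (-1)); [rewrite <- RtoC_mult; f_equal; ring|].
      unfold Ci, Cmult, RtoC; simpl; f_equal; ring.
    + rewrite Cmod_mult, Cmod_R, Cmod_Ci, (Rabs_pos_eq s) by auto.
      rewrite Rabs_pos_eq; [ring|apply sqrt_pos].
    + rewrite RtoC_plus. f_equal; f_equal; f_equal; ring.
  - exists (RtoC (sqrt (Rabs s))); split; [|split].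
    + rewrite <- RtoC_mult, sqrt_sqrt by apply Rabs_pos. rewrite Rabs_left by lra; auto.
    + rewrite Cmod_R, Rabs_pos_eq; auto; apply sqrt_pos.
    + rewrite RtoC_minus, !RtoC_plus. f_equal; f_equal; f_equal; ring.
Qed.

Lemma fold_series (F : C -> C) (t e0 : R) :
  @analytic_at C_AbsRing F (RtoC t) -> 0 < e0 ->
  (forall u, Rabs (u - t) < e0 -> snd (F (RtoC u)) = 0) ->
  exists (a : nat -> R) (r K d : R), 0 < r /\ 0 < d /\ 0 <= K /\ (forall n, Rabs (a n) * r ^ n <= K) /\
    forall h s, Rabs h < d -> Rabs s < d ->
      is_series (fun n => a n * sym_pow n h s) (fst (fold F (t + h) s)) /\
      snd (fold F (t + h) s) = 0.
Proof.
  intros [a [e [He H]]] He0 Hreal.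
  assert (Hp : forall w, Cmod w < e ->
     @is_series C_AbsRing (AbsRing_NormedModule C_AbsRing)
       (fun n => (pow_n (K := C_AbsRing) w n * a n)%C) (F (RtoC t + w)%C)).
  { intros w Hw. specialize (H (RtoC t + w)%C).
    assert (E : minus (RtoC t + w)%C (RtoC t) = w).
    { change ((RtoC t + w) - RtoC t = w)%C; ring. }
    change (@minus (AbsRing.AbelianGroup C_AbsRing)) with (@minus C_AbelianGroup) in H.
    rewrite E in H. apply H. exact Hw. }
  assert (Rpow : forall h n, pow_n (K := C_AbsRing) (RtoC h) n = RtoC (h ^ n)).
  { intros h n; induction n; [reflexivity|]. simpl. rewrite RtoC_mult, <- IHn; reflexivity. }
  assert (Hline : forall h, Rabs h < e ->
     is_series (fun n => h ^ n * fst (a n)) (fst (F (RtoC (t + h)))) /\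
     is_series (fun n => h ^ n * snd (a n)) (snd (F (RtoC (t + h))))).
  { intros h Hh. destruct (is_series_C_components _ _ (Hp (RtoC h) ltac:(rewrite Cmod_R; auto))) as [S1 S2].
    rewrite RtoC_plus. split; (eapply is_series_ext; [|eassumption]);
      intros n; cbv beta; rewrite Rpow; unfold Cmult, RtoC; simpl; ring. }
  assert (Im0 : forall n, snd (a n) = 0).
  { apply (real_on_axis_coefficients (fun n => snd (a n)) (Rmin e e0)); [apply Rmin_pos; auto|].
    intros h Hh. destruct (Hline h) as [_ S2]; [eapply Rlt_le_trans; [exact Hh|apply Rmin_l]|].
    rewrite Hreal in S2; auto.
    replace (t + h - t) with h by ring. eapply Rlt_le_trans; [exact Hh|apply Rmin_r]. }
  destruct (filterlim_bounded (fun n => (e / 2) ^ n * fst (a n))) as [K HK].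
  { exists 0. apply ex_series_lim_0. eexists; apply Hline. rewrite Rabs_pos_eq; lra. }
  (* Makes both [|h|] and [|z| = sqrt |s|] less than [e / 2], so that [h + z] and [h - z] lie in the
     disc of convergence. *)
  set (d := Rmin (e / 2) ((e / 2) ^ 2)).
  assert (Hd : 0 < d) by (apply Rmin_pos; [|apply pow_lt]; lra).
  exists (fun n => fst (a n)), (e / 2), K, d.
  split; [lra|]; split; [auto|]; split; [eapply Rle_trans; [exact (Rabs_pos ((e / 2) ^ 0 * fst (a O)))|apply (HK O)]|]; split.
  { intros n. eapply Rle_trans; [|apply (HK n)]. unfold norm; simpl; unfold abs; simpl.
    rewrite Rabs_mult, (Rabs_pos_eq ((e / 2) ^ n)) by (apply pow_le; lra). right; ring. }
  intros h s Hh Hs.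
  destruct (fold_sym F t h s) as [z [Hz [Hm E]]]. rewrite E.
  assert (Hz2 : Cmod z < e / 2).
  { rewrite Hm. rewrite <- (sqrt_pow2 (e / 2)) by lra. apply sqrt_lt_1_alt; split; [apply Rabs_pos|].
    eapply Rlt_le_trans; [exact Hs|apply Rmin_r]. }
  assert (Hh2 : Rabs h < e / 2) by (eapply Rlt_le_trans; [exact Hh|apply Rmin_l]).
  assert (P1 := Hp (RtoC h + z)%C ltac:(assert (X := Cmod_cplus_lt h (e / 2) z Hh2 Hz2); lra)).
  assert (P2 := Hp (RtoC h - z)%C
     ltac:(assert (X := Cmod_cplus_lt h (e / 2) (- z)%C Hh2 ltac:(rewrite Cmod_opp; auto)); unfold Cminus; lra)).
  assert (P := is_series_plus _ _ _ _ P1 P2).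
  destruct (is_series_C_components _ _ P) as [S1 S2].
  assert (T : forall n, plus (pow_n (K := C_AbsRing) (RtoC h + z) n * a n)%C
      (pow_n (K := C_AbsRing) (RtoC h - z) n * a n)%C = RtoC (2 * (fst (a n) * sym_pow n h s))).
  { intros n. change (plus ?u ?v) with (u + v)%C.
    assert (X := sym_pow_complex z h s n Hz).
    assert (H2 : RtoC 2 <> RtoC 0) by (intros Y; apply RtoC_inj in Y; lra).
    replace (pow_n (K := C_AbsRing) (RtoC h + z) n * a n + pow_n (K := C_AbsRing) (RtoC h - z) n * a n)%C
      with (RtoC 2 * ((pow_n (K := C_AbsRing) (RtoC h + z) n + pow_n (K := C_AbsRing) (RtoC h - z) n) / RtoC 2) * a n)%C
      by (field; auto).
    rewrite X. assert (Ea : a n = RtoC (fst (a n))).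
    { rewrite (surjective_pairing (a n)) at 1. rewrite Im0; reflexivity. }
    rewrite Ea at 1. rewrite <- !RtoC_mult. f_equal; ring. }
  rewrite half_components; simpl. split.
  - assert (S0 : is_series (fun n => 2 * (fst (a n) * sym_pow n h s))
        (fst (F (RtoC t + (RtoC h + z))%C) + fst (F (RtoC t + (RtoC h - z))%C))).
    { eapply is_series_ext; [|exact S1]. intros n; exact (f_equal fst (T n)). }
    apply (is_series_scal_l (K := R_AbsRing) (V := R_NormedModule) (/ 2)) in S0.
    unfold Rdiv; rewrite Rmult_comm. eapply is_series_ext; [|exact S0].
    intros n; unfold scal; simpl; unfold mult; simpl; field.
  - assert (S0 : is_series (fun _ : nat => 0) (snd (F (RtoC t + (RtoC h + z))%C) + snd (F (RtoC t + (RtoC h - z))%C))).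
    { eapply is_series_ext; [|exact S2]. intros n; exact (f_equal snd (T n)). }
    apply is_series_unique in S0.
    replace (Series (fun _ : nat => 0)) with (Series (fun _ : nat => 0 * 0)) in S0
      by (apply Series_ext; intros; ring).
    rewrite Series_scal_l in S0. lra.
Qed.

(** Taking the real part loses nothing near the curve: [fold_analytic] shows that the imaginary part
    vanishes there. *)
Definition surface_coord (F : C -> C) (q : R * R) : R := fst (fold F (fst q) (snd q)).

Lemma fold_analytic (F : C -> C) (t e0 : R) :
  @analytic_at C_AbsRing F (RtoC t) -> 0 < e0 ->
  (forall u, Rabs (u - t) < e0 -> snd (F (RtoC u)) = 0) ->
  exists d, 0 < d /\ analytic_on (rect (t, 0) d) (surface_coord F) /\
    forall q, rect (t, 0) d q -> snd (fold F (fst q) (snd q)) = 0.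
Proof.
  intros HF He0 Hreal.
  destruct (fold_series F t e0 HF He0 Hreal) as (a & r & K & d & Hr & Hd & HK & Ha & H).
  (* Half of [r], so that [|a n| th^n <= K 2^-n] is summable. *)
  set (th := r / 2). assert (Hth : 0 < th) by (unfold th; lra).
  destruct (exists_below3 d (th / 32) (th ^ 2 / 32)) as (e & He & L1 & L2 & L3); auto;
    try (apply Rdiv_lt_0_compat; try apply pow_lt; lra).
  assert (HV : open (rect (t, 0) e)) by apply open_rect.
  assert (HM : 0 < 4 / e) by (apply Rdiv_lt_0_compat; lra).
  assert (E : forall q, rect (t, 0) e q ->
     is_series (fun n => a n * sym_pow n (fst q - t) (snd q)) (surface_coord F q) /\
     snd (fold F (fst q) (snd q)) = 0).
  { intros q [H1 H2]; simpl in *. specialize (H (fst q - t) (snd q)).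
    rewrite Rminus_0_r in H2. replace (t + (fst q - t)) with (fst q) in H by ring.
    apply H; lra. }
  exists e; split; [auto|]; split; [|intros q Hq; apply (E q Hq)].
  (* The 8 is the price of [analytic_norm_mult] for the constant factor [a n]. *)
  set (c := fun n => 8 * K * (/ 2) ^ n).
  assert (Hc : ex_series c).
  { apply ex_series_Rscal, ex_series_geom. rewrite Rabs_pos_eq; lra. }
  assert (c0 : forall n, 0 <= c n).
  { intros n; unfold c; apply Rmult_le_pos; [lra|apply pow_le; lra]. }
  exists (4 / e), (Series c); split; [auto|]; split.
  { replace 0 with (Series (fun _ : nat => 0 * 0)) by (rewrite Series_scal_l; ring).
    apply Series_le; auto. intros n; rewrite Rmult_0_l; split; [lra|apply c0]. }
  apply analytic_norm_ext with (fun q => Series (fun n => a n * sym_pow n (fst q - t) (snd q))); auto.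
  { intros q Hq; apply is_series_unique, (E q Hq). }
  apply analytic_norm_series; auto.
  intros n. assert (P : 0 <= th ^ n) by (apply pow_le; lra).
  eapply analytic_norm_le; [| |exact (analytic_norm_mult _ _ _ _ _ _ HV HM (Rabs_pos (a n)) P
    (analytic_norm_const _ _ (a n) HV HM) (sym_pow_norm t th e Hth He L2 L3 n))]; [lra|].
  split; [repeat apply Rmult_le_pos; auto using Rabs_pos; lra|].
  unfold c. rewrite !Rmult_assoc. apply Rmult_le_compat_l; [lra|].
  unfold th, Rdiv; rewrite Rpow_mult_distr, <- Rmult_assoc.
  apply Rmult_le_compat_r; [apply pow_le; lra|apply Ha].
Qed.

(** * Analytic continuation in the second variable *)

Lemma smooth_bound_iter_partial_y n : forall m (V : R * R -> Prop) c f,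
  smooth_bound (n + m) V c f ->
  smooth_bound m V (fun k => c (n + k)%nat) (Nat.iter n partial_y f).
Proof.
  induction n as [|n IH]; intros m V c f H; [exact H|].
  assert (H' : smooth_bound (n + S m) V c f) by (rewrite <- plus_n_Sm; exact H).
  apply IH in H'. destruct H' as [_ [_ [_ H']]]. cbn [Nat.iter].
  eapply smooth_bound_le; [|exact H']. intros k _; cbv beta. rewrite <- plus_n_Sm. simpl. lra.
Qed.

Lemma Derive_n_iter_partial_y (f : R * R -> R) (r s : R) n :
  Derive_n (fun b => f (r, b)) n s = Nat.iter n partial_y f (r, s).
Proof.
  revert s; induction n as [|n IH]; intros s; [reflexivity|].
  simpl. apply Derive_ext; intros b; apply IH.
Qed.

Lemma iter_partial_y_zero (W : R * R -> Prop) (f : R * R -> R) n :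
  open W -> (forall q, W q -> f q = 0) -> forall q, W q -> Nat.iter n partial_y f q = 0.
Proof.
  intros HW H; induction n as [|n IH]; intros q Hq; [auto|]. simpl.
  rewrite (proj2 (partial_ext (Nat.iter n partial_y f) (fun _ => 0) q
     ltac:(generalize (HW q Hq); apply filter_imp; exact IH))).
  apply (is_partials_unique _ _ _ _ (is_partials_const 0 q)).
Qed.

(** All [s]-derivatives vanish for [s < 0], hence at [s = 0] by continuity. For [s > 0] Taylor's
    formula at 0 leaves only the Lagrange remainder, at most [K (M s)^(n+1) <= K 2^-(n+1)] for every
    [n]. The strip [s < 1 / (2 M)] is enough, because the squares may still shrink. *)
Lemma analytic_continuation (t d M K : R) (f : R * R -> R) :
  0 < M -> 0 <= K -> analytic_norm (rect (t, 0) d) M K f ->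
  (forall q, rect (t, 0) d q -> snd q < 0 -> f q = 0) ->
  forall q, rect (t, 0) d q -> Rabs (snd q) < / (2 * M) -> f q = 0.
Proof.
  intros HM HK A Z [r s] Hq Hs; simpl in Hs.
  set (V := rect (t, 0) d) in *.
  assert (Hd : Rabs s < d) by (destruct Hq as [_ H2]; simpl in H2; rewrite Rminus_0_r in H2; auto).
  assert (Hd0 : 0 < d) by (eapply Rle_lt_trans; [apply Rabs_pos|exact Hd]).
  assert (Hr : forall b, Rabs b < d -> V (r, b)).
  { intros b Hb; split; simpl; [apply Hq|rewrite Rminus_0_r; auto]. }
  assert (B : forall n q, V q -> Rabs (Nat.iter n partial_y f q) <= K * (M ^ n * INR (fact n)) /\
     ex_partials (Nat.iter n partial_y f) q).
  { intros n q Hq'. assert (H := smooth_bound_iter_partial_y n 1 V _ f (A (n + 1)%nat)).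
    destruct H as [H1 [H2 _]]. split; [|apply H2; auto].
    eapply Rle_trans; [apply H1, Hq'|]. cbv beta. rewrite Nat.add_0_r.
    apply Rmult_le_compat_l; auto; apply weight_le_fact; auto. }
  assert (OW : open (fun q => V q /\ snd q < 0)).
  { intros [x y] [Hq1 Hq2]; simpl in Hq2. apply filter_and; [apply open_rect; auto|].
    apply locally_rect. exists (- y); split; [lra|].
    intros [x' y'] [_ Hp]; simpl in *. apply Rabs_lt_between' in Hp. lra. }
  assert (N : forall n b, Rabs b < d -> b < 0 -> Nat.iter n partial_y f (r, b) = 0).
  { intros n b Hb Hb'. apply (iter_partial_y_zero _ f n OW); [|split; auto].
    intros q [H1 H2]; auto. }
  destruct (Rlt_le_dec s 0) as [Hs0|Hs0]; [apply Z; auto|].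
  rewrite (Rabs_pos_eq s) in Hs, Hd by auto.
  assert (N0 : forall n, Nat.iter n partial_y f (r, 0) = 0).
  { intros n. destruct (B n (r, 0)) as [_ [_ D]]; [apply Hr; rewrite Rabs_R0; auto|].
    simpl in D. assert (C := ex_derive_continuous (K := R_AbsRing) (V := R_NormedModule) _ _ D).
    destruct (Req_dec (Nat.iter n partial_y f (r, 0)) 0) as [|Ne]; auto. exfalso.
    assert (He : 0 < Rabs (Nat.iter n partial_y f (r, 0))) by (apply Rabs_pos_lt; auto).
    destruct (proj1 (filterlim_locally _ _) C (mkposreal _ He)) as [e He'].
    assert (Pe := cond_pos e).
    set (b := - Rmin (e / 2) (d / 2)).
    assert (Hb : 0 < Rmin (e / 2) (d / 2)) by (apply Rmin_pos; lra).
    assert (Hb1 := Rmin_l (e / 2) (d / 2)). assert (Hb2 := Rmin_r (e / 2) (d / 2)).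
    assert (Eb : Rabs b = Rmin (e / 2) (d / 2)) by (unfold b; rewrite Rabs_Ropp, Rabs_pos_eq; lra).
    specialize (He' b). rewrite (N n b) in He'; [| rewrite Eb; lra | unfold b; lra].
    assert (X : ball 0 e b).
    { apply Rabs_ball.
      rewrite Rminus_0_r, Eb. lra. }
    specialize (He' X). apply ball_Rabs in He'; simpl in He'.
    rewrite Rminus_0_l, Rabs_Ropp in He'. lra. }
  destruct Hs0 as [Hs0|Hs0]; [|subst s; apply (N0 O)].
  assert (S1 : 0 < M * s < / 2).
  { split; [apply Rmult_lt_0_compat; auto|].
    apply Rmult_lt_compat_l with (r := M) in Hs; auto.
    replace (M * / (2 * M)) with (/ 2) in Hs by (field; lra). auto. }
  assert (T : forall n, Rabs (f (r, s)) <= K * (/ 2) ^ (S n)).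
  { intros n. destruct (Taylor_Lagrange (fun b => f (r, b)) n 0 s Hs0) as [z [Hz E]].
    - intros u Hu k Hk. destruct k as [|k]; [exact I|]. simpl.
      eapply ex_derive_ext; [intros b; symmetry; apply Derive_n_iter_partial_y|].
      destruct (B k (r, u)) as [_ [_ D]]; [apply Hr; rewrite Rabs_pos_eq; lra|exact D].
    - rewrite E, sum_eq_R0.
      2:{ intros i _. rewrite Derive_n_iter_partial_y, N0; ring. }
      rewrite Rplus_0_l, Derive_n_iter_partial_y, Rminus_0_r, Rabs_mult.
      destruct (B (S n) (r, z)) as [Bz _]; [apply Hr; rewrite Rabs_pos_eq; lra|].
      assert (F := INR_fact_lt_0 (S n)). assert (P := pow_lt s (S n) Hs0).
      rewrite (Rabs_pos_eq (s ^ S n / INR (fact (S n)))) by (apply Rlt_le, Rdiv_lt_0_compat; auto).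
      apply Rle_trans with (s ^ S n / INR (fact (S n)) * (K * (M ^ S n * INR (fact (S n))))).
      { apply Rmult_le_compat_l; auto. apply Rlt_le, Rdiv_lt_0_compat; auto. }
      replace (s ^ S n / INR (fact (S n)) * (K * (M ^ S n * INR (fact (S n)))))
        with (K * (M * s) ^ S n) by (rewrite Rpow_mult_distr; field; lra).
      apply Rmult_le_compat_l; auto. apply pow_incr; lra. }
  destruct (Req_dec (f (r, s)) 0) as [|Ne]; auto. exfalso.
  apply Rabs_pos_lt in Ne.
  destruct (pow_lt_1_zero (/ 2) ltac:(rewrite Rabs_pos_eq; lra) (Rabs (f (r, s)) / (K + 1))) as [m Hm].
  { apply Rdiv_lt_0_compat; lra. }
  specialize (Hm (S m) ltac:(lia)). specialize (T m).
  rewrite Rabs_pos_eq in Hm by (apply pow_le; lra).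
  apply (Rmult_lt_compat_l (K + 1)) in Hm; [|lra].
  replace ((K + 1) * (Rabs (f (r, s)) / (K + 1))) with (Rabs (f (r, s))) in Hm by (field; lra).
  assert (0 < (/ 2) ^ S m) by (apply pow_lt; lra). lra.
Qed.

(** * First-order identities on the surface *)

Lemma sqrt_lt_of_rect (d s : R) : 0 < d -> Rabs s < (d / 2) ^ 2 -> sqrt (Rabs s) < d / 2.
Proof.
  intros Hd H. rewrite <- (sqrt_pow2 (d / 2)) by lra.
  apply sqrt_lt_1_alt; split; [apply Rabs_pos|auto].
Qed.

Lemma surface_coord_neg (F : C -> C) (x : R -> R) (t d r s : R) :
  (forall u, Rabs (u - t) < d -> F (RtoC u) = RtoC (x u)) ->
  Rabs (r - t) + sqrt (- s) < d -> s < 0 ->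
  surface_coord F (r, s) = (x (r + sqrt (- s)) + x (r - sqrt (- s))) / 2.
Proof.
  intros H Hr Hs. unfold surface_coord, fold; simpl.
  destruct (Rle_dec 0 s) as [|_]; [lra|].
  rewrite Rabs_left by auto. assert (P := sqrt_pos (- s)).
  rewrite !H, half_components; [reflexivity| |].
  - replace (r - sqrt (- s) - t) with (r - t + - sqrt (- s)) by ring.
    eapply Rle_lt_trans; [apply Rabs_triang|]. rewrite Rabs_Ropp, (Rabs_pos_eq (sqrt _)); auto.
  - replace (r + sqrt (- s) - t) with (r - t + sqrt (- s)) by ring.
    eapply Rle_lt_trans; [apply Rabs_triang|]. rewrite (Rabs_pos_eq (sqrt _)); auto.
Qed.

Lemma surface_coord_0 (F : C -> C) (x : R -> R) (r : R) :
  F (RtoC r) = RtoC (x r) -> surface_coord F (r, 0) = x r.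
Proof.
  intros H. unfold surface_coord, fold; simpl.
  destruct (Rle_dec 0 0) as [_|]; [|lra].
  unfold cplus, cminus. rewrite sqrt_0.
  replace (RtoC r + Ci * RtoC 0)%C with (RtoC r) by ring.
  replace (RtoC r - Ci * RtoC 0)%C with (RtoC r) by ring.
  rewrite H, half_components; simpl; field.
Qed.

Lemma is_derive_sqrt_opp (s : R) : s < 0 -> is_derive (fun z => sqrt (- z)) s (- / (2 * sqrt (- s))).
Proof.
  intros Hs. assert (P : 0 < sqrt (- s)) by (apply sqrt_lt_R0; lra).
  auto_derive; [lra|]. field. lra.
Qed.

Lemma locally_abs (t d u : R) : Rabs (u - t) < d -> locally u (fun v => Rabs (v - t) < d).
Proof.
  intros H. assert (P : 0 < d - Rabs (u - t)) by lra.
  exists (mkposreal _ P); intros v Hv.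
  apply ball_Rabs in Hv; simpl in Hv.
  replace (v - t) with ((v - u) + (u - t)) by ring.
  eapply Rle_lt_trans; [apply Rabs_triang|]. lra.
Qed.

Section coordinate.

Variables (F : C -> C) (x : R -> R) (t d : R).
Hypothesis Hd : 0 < d.
Hypothesis HF : forall u, Rabs (u - t) < d -> F (RtoC u) = RtoC (x u).
Hypothesis HA : analytic_on (rect (t, 0) d) (surface_coord F).

Let f := surface_coord F.

Lemma axis_in_rect (u : R) : Rabs (u - t) < d -> rect (t, 0) d (u, 0).
Proof. intros H; split; simpl; auto. rewrite Rminus_0_r, Rabs_R0; auto. Qed.

Lemma curve_is_derive (u : R) : Rabs (u - t) < d -> is_derive x u (partial_x f (u, 0)).
Proof.
  intros Hu. apply is_derive_ext_loc with (fun v => f (v, 0)).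
  - generalize (locally_abs t d u Hu); apply filter_imp; intros v Hv.
    apply surface_coord_0, HF, Hv.
  - apply (ex_partials_is f (u, 0)), (analytic_on_ex_partials (rect (t, 0) d)); auto.
    apply axis_in_rect; auto.
Qed.

Lemma curve_Derive (u : R) : Rabs (u - t) < d -> Derive x u = partial_x f (u, 0).
Proof. intros Hu; apply is_derive_unique, curve_is_derive, Hu. Qed.

Lemma curve_is_derive_2 (u : R) : Rabs (u - t) < d -> is_derive (Derive x) u (partial_x (partial_x f) (u, 0)).
Proof.
  intros Hu. apply is_derive_ext_loc with (fun v => partial_x f (v, 0)).
  - generalize (locally_abs t d u Hu); apply filter_imp; intros v Hv; symmetry; apply curve_Derive, Hv.
  - apply (ex_partials_is (partial_x f) (u, 0)), (analytic_on_ex_partials (rect (t, 0) d));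
      [apply axis_in_rect; auto|apply analytic_on_partial_x, HA].
Qed.

Lemma curve_Derive_2 (u : R) : Rabs (u - t) < d -> Derive_n x 2 u = partial_x (partial_x f) (u, 0).
Proof.
  intros Hu. change (Derive_n x 2 u) with (Derive (fun v => Derive (fun w => x w) v) u).
  apply is_derive_unique, curve_is_derive_2, Hu.
Qed.

Lemma surface_partials_neg (r s : R) : Rabs (r - t) + sqrt (- s) < d -> s < 0 ->
  is_partials f (r, s) ((Derive x (r + sqrt (- s)) + Derive x (r - sqrt (- s))) / 2)
    (- (Derive x (r + sqrt (- s)) - Derive x (r - sqrt (- s))) / (4 * sqrt (- s))).
Proof.
  intros Hr Hs. set (w := sqrt (- s)).
  assert (P : 0 < w) by (apply sqrt_lt_R0; lra).
  assert (D1 : is_derive x (r + w) (Derive x (r + w))).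
  { rewrite curve_Derive; [apply curve_is_derive|];
      replace (r + w - t) with (r - t + w) by ring;
      (eapply Rle_lt_trans; [apply Rabs_triang|]); rewrite (Rabs_pos_eq w); auto; lra. }
  assert (D2 : is_derive x (r - w) (Derive x (r - w))).
  { rewrite curve_Derive; [apply curve_is_derive|];
      replace (r - w - t) with (r - t + - w) by ring;
      (eapply Rle_lt_trans; [apply Rabs_triang|]); rewrite Rabs_Ropp, (Rabs_pos_eq w); auto; lra. }
  set (x' := Derive x) in *. split; simpl.
  - apply is_derive_ext_loc with (fun a => (x (a + w) + x (a - w)) / 2).
    + assert (Hr' : Rabs (r - t) < d - w) by (unfold w; lra).
      generalize (locally_abs t (d - w) r Hr'); apply filter_imp; intros a Ha.
      symmetry; apply (surface_coord_neg F x t d); auto; fold w; lra.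
    + apply (is_derive_ext (fun a => / 2 * (x (a + w) + x (a - w)))); [intros; simpl; field|].
      replace ((x' (r + w) + x' (r - w)) / 2) with (/ 2 * (1 * x' (r + w) + 1 * x' (r - w))) by field.
      apply (is_derive_scal (fun a => x (a + w) + x (a - w)) r (/ 2)).
      apply (is_derive_plus (K := R_AbsRing) (V := R_NormedModule)).
      * apply (is_derive_comp (V := R_NormedModule) x (fun a => a + w)); auto.
        auto_derive; auto; ring.
      * apply (is_derive_comp (V := R_NormedModule) x (fun a => a - w)); auto.
        auto_derive; auto; ring.
  - apply is_derive_ext_loc with (fun b => (x (r + sqrt (- b)) + x (r - sqrt (- b))) / 2).
    + assert (Hs' : s < 0 /\ sqrt (- s) < d - Rabs (r - t)) by lra.
      assert (Q : - (d - Rabs (r - t)) ^ 2 < s).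
      { destruct Hs' as [_ Q]. fold w in Q. assert (W : w * w = - s) by (apply sqrt_sqrt; lra). nra. }
      assert (Pm : 0 < Rmin (- s) (s + (d - Rabs (r - t)) ^ 2)) by (apply Rmin_pos; lra).
      exists (mkposreal _ Pm); intros b Hb.
      apply ball_Rabs in Hb; simpl in Hb.
      assert (M1 := Rmin_l (- s) (s + (d - Rabs (r - t)) ^ 2)).
      assert (M2 := Rmin_r (- s) (s + (d - Rabs (r - t)) ^ 2)). simpl in M1, M2.
      apply Rabs_lt_between in Hb.
      symmetry; apply (surface_coord_neg F x t d); auto; [|lra].
      assert (Pd : 0 < d - Rabs (r - t)) by (unfold w in P; lra).
      enough (sqrt (- b) < d - Rabs (r - t)) by lra.
      rewrite <- (sqrt_pow2 (d - Rabs (r - t))) by lra.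
      apply sqrt_lt_1_alt. simpl; lra.
    + apply (is_derive_ext (fun b => / 2 * (x (r + sqrt (- b)) + x (r - sqrt (- b))))); [intros; simpl; field|].
      replace (- (x' (r + w) - x' (r - w)) / (4 * w))
        with (/ 2 * (- / (2 * w) * x' (r + w) + / (2 * w) * x' (r - w))) by (field; lra).
      apply (is_derive_scal (fun b => x (r + sqrt (- b)) + x (r - sqrt (- b))) s (/ 2)).
      assert (DS := is_derive_sqrt_opp s Hs). fold w in DS.
      apply (is_derive_plus (K := R_AbsRing) (V := R_NormedModule)).
      * apply (is_derive_comp (V := R_NormedModule) x (fun b => r + sqrt (- b))); auto.
        replace (- / (2 * w)) with (0 + - / (2 * w)) by ring.
        apply (is_derive_plus (K := R_AbsRing) (V := R_NormedModule) (fun _ => r)); auto.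
        apply is_derive_Reals, derivable_pt_lim_const.
      * apply (is_derive_comp (V := R_NormedModule) x (fun b => r - sqrt (- b))); auto.
        replace (/ (2 * w)) with (0 - - / (2 * w)) by ring.
        apply (is_derive_minus (K := R_AbsRing) (V := R_NormedModule) (fun _ => r)); auto.
        apply is_derive_Reals, derivable_pt_lim_const.
Qed.

(** At [s = - w^2] the derivative is [- (x'(r + w) - x'(r - w)) / (4 w)], which tends to
    [- x''(r) / 2] as [w] tends to 0; continuity of the derivative in [s] does the rest. *)
Lemma surface_partial_y_0 (r : R) : Rabs (r - t) < d ->
  partial_y f (r, 0) = - / 2 * Derive_n x 2 r.
Proof.
  intros Hr. rewrite curve_Derive_2 by auto.
  set (V := rect (t, 0) d) in *. assert (HV : open V) by apply open_rect.
  assert (Hr0 := axis_in_rect r Hr).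
  assert (C1 : continuous (partial_y f) (r, 0)).
  { apply (analytic_on_continuous V); auto; apply analytic_on_partial_y, HA. }
  assert (C2 : continuous (partial_x (partial_x f)) (r, 0)).
  { apply (analytic_on_continuous V); auto; apply analytic_on_partial_x, analytic_on_partial_x, HA. }
  rewrite continuous_rect in C1, C2.
  apply Rminus_diag_uniq.
  destruct (Req_dec (partial_y f (r, 0) - - / 2 * partial_x (partial_x f) (r, 0)) 0) as [|Ne]; auto.
  exfalso. apply Rabs_pos_lt in Ne.
  set (e := Rabs (partial_y f (r, 0) - - / 2 * partial_x (partial_x f) (r, 0))) in *.
  destruct (C1 (e / 2) ltac:(lra)) as [d1 [Hd1 H1]], (C2 (e / 2) ltac:(lra)) as [d2 [Hd2 H2]].
  (* [w <= 1] gives [w * w <= w], so the point at [- w^2] is within [d1]. The other halves occur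
     because [mvt_1d] places [z] only within [2 w] of [r]. *)
  destruct (exists_below3 (Rmin 1 (d1 / 2)) (d2 / 2) ((d - Rabs (r - t)) / 2)) as (w & Pw & W & W2 & W3);
    try apply Rmin_pos; try lra.
  assert (W0 := Rmin_l 1 (d1 / 2)). assert (W1 := Rmin_r 1 (d1 / 2)).
  assert (Ew : sqrt (- - (w * w)) = w) by (rewrite Ropp_involutive; apply sqrt_square; lra).
  assert (D := surface_partials_neg r (- (w * w))). rewrite Ew in D.
  destruct (is_partials_unique _ _ _ _ (D ltac:(lra) ltac:(nra))) as [_ E]. clear D.
  destruct (mvt_1d (Derive x) r (2 * w) (r - w) (r + w)) as [z [Hz Ez]].
  { intros z Hz; eexists; apply curve_is_derive_2.
    replace (z - t) with (z - r + (r - t)) by ring.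
    eapply Rle_lt_trans; [apply Rabs_triang|]; lra. }
  { replace (r - w - r) with (- w) by ring; rewrite Rabs_Ropp, Rabs_pos_eq; lra. }
  { replace (r + w - r) with w by ring; rewrite Rabs_pos_eq; lra. }
  assert (Hzt : Rabs (z - t) < d).
  { replace (z - t) with (z - r + (r - t)) by ring.
    eapply Rle_lt_trans; [apply Rabs_triang|]; lra. }
  rewrite (is_derive_unique _ _ _ (curve_is_derive_2 z Hzt)) in Ez.
  rewrite Ez in E.
  assert (K1 := H1 (r, - (w * w))). assert (K2 := H2 (z, 0)).
  specialize (K1 ltac:(split; simpl; [unfold Rminus; rewrite Rplus_opp_r, Rabs_R0; auto
     |rewrite Rminus_0_r, Rabs_Ropp, Rabs_pos_eq; nra])).
  specialize (K2 ltac:(split; simpl; [lra|unfold Rminus; rewrite Rplus_opp_r, Rabs_R0; auto])).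
  rewrite E in K1.
  replace (- (partial_x (partial_x f) (z, 0) * (r + w - (r - w))) / (4 * w))
    with (- / 2 * partial_x (partial_x f) (z, 0)) in K1 by (field; lra).
  apply Rabs_lt_between in K1; apply Rabs_lt_between in K2.
  assert (X : e < e); [|lra]. unfold e at 1. apply Rabs_lt_between. lra.
Qed.

End coordinate.

(** Conformality rewritten in [s]: for [s = - w^2] the tangent vectors of [(r, A, B)] along [r] and
    [w] are Lorentz orthogonal, with squares [4 s |T|^2] and [- 4 s |T|^2]. Unlike [w], [s] gives
    identities that are analytic across the curve. *)
Definition null_identities (A B : R * R -> R) (q : R * R) : Prop :=
  partial_x A q ^ 2 + partial_x B q ^ 2 = 1 + 4 * snd q * (partial_y A q ^ 2 + partial_y B q ^ 2) /\
  partial_x A q * partial_y A q + partial_x B q * partial_y B q = 0.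

Definition jacobian (A B : R * R -> R) (q : R * R) : R :=
  partial_x A q * partial_y B q - partial_y A q * partial_x B q.

Lemma analytic_on_jacobian (V : R * R -> Prop) (A B : R * R -> R) : open V ->
  analytic_on V A -> analytic_on V B -> analytic_on V (jacobian A B).
Proof.
  intros; apply analytic_on_minus; auto; apply analytic_on_mult;
    auto using analytic_on_partial_x, analytic_on_partial_y.
Qed.

(** Let [p] and [q] be the unit velocities of the curve at [r + w] and [r - w]. Then
    [R = (p + q) / 2] and [T = - (p - q) / (4 w)], so [R.T = 0] is [|p| = |q|], and the other
    identity is the parallelogram law. *)
Lemma null_identities_neg (X Y : C -> C) (x y : R -> R) (t d r s : R) :
  0 < d ->
  (forall u, Rabs (u - t) < d -> X (RtoC u) = RtoC (x u) /\ Y (RtoC u) = RtoC (y u)) ->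
  (forall u, Rabs (u - t) < d -> Derive x u ^ 2 + Derive y u ^ 2 = 1) ->
  analytic_on (rect (t, 0) d) (surface_coord X) -> analytic_on (rect (t, 0) d) (surface_coord Y) ->
  Rabs (r - t) + sqrt (- s) < d -> s < 0 ->
  null_identities (surface_coord X) (surface_coord Y) (r, s).
Proof.
  intros Hd HXY Harc HA HB Hr Hs.
  assert (DX := surface_partials_neg X x t d Hd (fun u Hu => proj1 (HXY u Hu)) HA r s Hr Hs).
  assert (DY := surface_partials_neg Y y t d Hd (fun u Hu => proj2 (HXY u Hu)) HB r s Hr Hs).
  destruct (is_partials_unique _ _ _ _ DX) as [EX1 EX2], (is_partials_unique _ _ _ _ DY) as [EY1 EY2].
  unfold null_identities; simpl snd. rewrite EX1, EX2, EY1, EY2.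
  set (w := sqrt (- s)) in *. assert (P : 0 < w) by (apply sqrt_lt_R0; lra).
  assert (W : s = - (w * w)) by (unfold w; rewrite sqrt_sqrt; lra).
  assert (A1 : Derive x (r + w) ^ 2 + Derive y (r + w) ^ 2 = 1).
  { apply Harc. replace (r + w - t) with (r - t + w) by ring.
    eapply Rle_lt_trans; [apply Rabs_triang|]; rewrite (Rabs_pos_eq w); lra. }
  assert (A2 : Derive x (r - w) ^ 2 + Derive y (r - w) ^ 2 = 1).
  { apply Harc. replace (r - w - t) with (r - t + - w) by ring.
    eapply Rle_lt_trans; [apply Rabs_triang|]; rewrite Rabs_Ropp, (Rabs_pos_eq w); lra. }
  rewrite W. revert A1 A2.
  generalize (Derive x (r + w)), (Derive x (r - w)), (Derive y (r + w)), (Derive y (r - w)).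
  intros p q p' q' A1 A2. split.
  - apply Rminus_diag_uniq.
    replace (_ - _) with (((p ^ 2 + p' ^ 2) + (q ^ 2 + q' ^ 2)) / 2 - 1) by (field; lra).
    rewrite A1, A2; field.
  - replace (_ + _) with (- ((p ^ 2 + p' ^ 2) - (q ^ 2 + q' ^ 2)) / (8 * w)) by (field; lra).
    rewrite A1, A2; field; lra.
Qed.

Lemma null_identities_rect (X Y : C -> C) (x y : R -> R) (t d : R) :
  0 < d ->
  (forall u, Rabs (u - t) < d -> X (RtoC u) = RtoC (x u) /\ Y (RtoC u) = RtoC (y u)) ->
  (forall u, Rabs (u - t) < d -> Derive x u ^ 2 + Derive y u ^ 2 = 1) ->
  analytic_on (rect (t, 0) d) (surface_coord X) -> analytic_on (rect (t, 0) d) (surface_coord Y) ->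
  exists e, 0 < e /\ e <= d /\ forall q, rect (t, 0) e q ->
    null_identities (surface_coord X) (surface_coord Y) q.
Proof.
  intros Hd HXY Harc HA HB.
  set (A := surface_coord X) in *. set (B := surface_coord Y) in *.
  (* Ensures [|r - t| < d / 2] and [sqrt |s| < d / 2], so that [r + w] and [r - w] stay within [d]
     of [t]. *)
  set (e1 := Rmin (d / 2) ((d / 2) ^ 2)).
  assert (Pe : 0 < e1) by (apply Rmin_pos; [|apply pow_lt]; lra).
  assert (L1 : e1 <= d / 2) by apply Rmin_l.
  assert (L2 : e1 <= (d / 2) ^ 2) by apply Rmin_r.
  set (V := rect (t, 0) e1). assert (HV : open V) by apply open_rect.
  assert (S : subset V (rect (t, 0) d)) by (intros q Hq; eapply rect_le; [|exact Hq]; lra).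
  assert (HA' := analytic_on_subset _ V _ S HA). assert (HB' := analytic_on_subset _ V _ S HB).
  assert (Neg : forall q, V q -> snd q < 0 -> null_identities A B q).
  { intros [r s] [H1 H2] Hs; simpl in *. rewrite Rminus_0_r in H2.
    apply (null_identities_neg X Y x y t d); auto.
    assert (Q := sqrt_lt_of_rect d s Hd ltac:(simpl; lra)). rewrite Rabs_left in Q by lra. lra. }
  set (f1 := fun q => partial_x A q * partial_x A q + partial_x B q * partial_x B q
      - (1 + 4 * snd q * (partial_y A q * partial_y A q + partial_y B q * partial_y B q))).
  set (f2 := fun q => partial_x A q * partial_y A q + partial_x B q * partial_y B q).
  assert (F2 : analytic_on V f2).
  { apply analytic_on_plus; auto; apply analytic_on_mult; auto using analytic_on_partial_x, analytic_on_partial_y. }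
  assert (F1 : analytic_on V f1).
  { apply analytic_on_minus; auto.
    - apply analytic_on_plus; auto; apply analytic_on_mult; auto using analytic_on_partial_x.
    - apply (analytic_on_plus V (fun _ => 1)); auto using analytic_on_const.
      apply (analytic_on_mult V (fun q => 4 * snd q)); auto.
      + apply (analytic_on_mult V (fun _ => 4)); [auto|apply analytic_on_const; auto|].
        apply analytic_on_coordinates; auto.
      + apply analytic_on_plus; auto; apply analytic_on_mult; auto using analytic_on_partial_y. }
  destruct F1 as (M1 & K1 & HM1 & HK1 & F1), F2 as (M2 & K2 & HM2 & HK2 & F2).
  assert (I1 : 0 < / (2 * M1)) by (apply Rinv_0_lt_compat; lra).
  assert (I2 : 0 < / (2 * M2)) by (apply Rinv_0_lt_compat; lra).
  clearbody e1.
  exists (Rmin e1 (Rmin (/ (2 * M1)) (/ (2 * M2)))).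
  split; [repeat apply Rmin_pos; auto|].
  split; [eapply Rle_trans; [apply Rmin_l|lra]|].
  intros q Hq.
  assert (Vq : V q) by (eapply rect_le; [apply Rmin_l|exact Hq]).
  assert (Q1 : Rabs (snd q) < / (2 * M1) /\ Rabs (snd q) < / (2 * M2)).
  { destruct Hq as [_ Hq]; simpl in Hq; rewrite Rminus_0_r in Hq.
    split; (eapply Rlt_le_trans; [exact Hq|]); (eapply Rle_trans; [apply Rmin_r|]); [apply Rmin_l|apply Rmin_r]. }
  assert (Z1 : f1 q = 0).
  { apply (analytic_continuation t e1 M1 K1 f1 HM1 HK1 F1); auto; [|apply Q1].
    intros p Hp Hs; destruct (Neg p Hp Hs) as [N1 _]; unfold f1.
    replace (_ - _) with (partial_x A p ^ 2 + partial_x B p ^ 2 -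
      (1 + 4 * snd p * (partial_y A p ^ 2 + partial_y B p ^ 2))) by ring. lra. }
  assert (Z2 : f2 q = 0).
  { apply (analytic_continuation t e1 M2 K2 f2 HM2 HK2 F2); auto; [|apply Q1].
    intros p Hp Hs; apply (Neg p Hp Hs). }
  split; [|exact Z2]. apply Rminus_diag_uniq. rewrite <- Z1. unfold f1. ring.
Qed.

(** * Squares on which the surface is regular *)

Lemma open_interval (a b : Rbar) (t : R) : interval a b t ->
  exists e, 0 < e /\ forall u, Rabs (u - t) < e -> interval a b u.
Proof.
  intros [H1 H2].
  assert (O := filter_and _ _ (open_Rbar_gt a t H1) (open_Rbar_lt b t H2)).
  destruct O as [e He]. exists e; split; [apply cond_pos|]. intros u Hu; apply He, Hu.
Qed.

(** The interface between the complex curve and what follows: on such a square the surface is known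
    only through the real functions [A] and [B], their identities, and their values and first
    derivatives on the axis. *)
Definition good_rect (J : R -> Prop) (D : C -> Prop) (X Y : C -> C) (x y : R -> R) (t d : R) : Prop :=
  let A := surface_coord X in
  let B := surface_coord Y in
  let V := rect (t, 0) d in
  0 < d /\ analytic_on V A /\ analytic_on V B /\
  (forall r s, V (r, s) -> phi_defined J D r s) /\
  (forall r s, V (r, s) -> phi_hat X Y r s = real_point r (A (r, s), B (r, s))) /\
  (forall q, V q -> null_identities A B q /\ jacobian A B q <> 0) /\
  (forall r, V (r, 0) -> A (r, 0) = x r /\ B (r, 0) = y r /\
     partial_x A (r, 0) = Derive x r /\ partial_x B (r, 0) = Derive y r /\
     partial_y A (r, 0) = - / 2 * Derive_n x 2 r /\ partial_y B (r, 0) = - / 2 * Derive_n y 2 r).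

Lemma fold_id (r s : R) : fold (fun z => z) r s = RtoC r.
Proof.
  assert (H2 : RtoC 2 <> RtoC 0) by (intros Y; apply RtoC_inj in Y; lra).
  unfold fold, cplus, cminus. destruct (Rle_dec 0 s).
  - rewrite half_components; unfold RtoC; simpl; f_equal; field.
  - rewrite half_components; unfold RtoC; simpl; f_equal; field.
Qed.

Lemma phi_defined_rect (J : R -> Prop) (D : C -> Prop) (t e : R) :
  open D -> D (RtoC t) -> 0 < e -> (forall u, Rabs (u - t) < e -> J u) ->
  exists d, 0 < d /\ forall r s, rect (t, 0) d (r, s) -> phi_defined J D r s.
Proof.
  intros HD Ht He HJ. specialize (HD _ Ht).
  apply (locally_rect (RtoC t) D) in HD. destruct HD as [d0 [Hd0 HD]].
  set (m := Rmin e d0). assert (Hm : 0 < m) by (apply Rmin_pos; auto).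
  assert (M1 : m <= e) by apply Rmin_l. assert (M2 : m <= d0) by apply Rmin_r.
  set (d := Rmin (m / 2) ((m / 2) ^ 2)).
  assert (L1 : d <= m / 2) by apply Rmin_l. assert (L2 : d <= (m / 2) ^ 2) by apply Rmin_r.
  exists d; split; [apply Rmin_pos; [|apply pow_lt]; lra|].
  intros r s [H1 H2]; simpl in H1, H2. rewrite Rminus_0_r in H2.
  assert (Q := sqrt_lt_of_rect m s Hm ltac:(lra)). assert (Q0 := sqrt_pos (Rabs s)).
  split; [apply HJ; lra|]. split.
  - intros Hs. rewrite (Rabs_pos_eq s) in Q, Q0 by auto.
    split; apply HD; unfold cplus, cminus, rect; simpl.
    + split.
      * replace (_ - t) with (r - t) by ring. lra.
      * replace (_ - 0) with (sqrt s) by ring. rewrite Rabs_pos_eq; lra.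
    + split.
      * replace (_ - t) with (r - t) by ring. lra.
      * replace (_ - 0) with (- sqrt s) by ring. rewrite Rabs_Ropp, Rabs_pos_eq; lra.
  - intros Hs; split; apply HJ.
    + replace (_ - t) with ((r - t) + sqrt (Rabs s)) by ring.
      eapply Rle_lt_trans; [apply Rabs_triang|]. rewrite (Rabs_pos_eq (sqrt _)); lra.
    + replace (_ - t) with ((r - t) + - sqrt (Rabs s)) by ring.
      eapply Rle_lt_trans; [apply Rabs_triang|]. rewrite Rabs_Ropp, (Rabs_pos_eq (sqrt _)); lra.
Qed.

Lemma good_rect_exists (a b : Rbar) (x y : R -> R) (D : C -> Prop) (X Y : C -> C)
  (arc_length : forall t, interval a b t -> (Derive x t) ^ 2 + (Derive y t) ^ 2 = 1)
  (locally_convex : forall t, interval a b t -> ~ (Derive_n x 2 t = 0 /\ Derive_n y 2 t = 0))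
  (hX : analytic_extension (interval a b) x D X)
  (hY : analytic_extension (interval a b) y D Y) (t : R) :
  interval a b t -> exists d, good_rect (interval a b) D X Y x y t d.
Proof.
  intros Ht. destruct hX as [HD [HJD [HX HXx]]], hY as [_ [_ [HY HYy]]].
  destruct (open_interval a b t Ht) as [e0 [He0 HJ]].
  destruct (fold_analytic X t e0) as [dX [HdX [AX IX]]]; auto.
  { intros u Hu; rewrite HXx; auto. }
  destruct (fold_analytic Y t e0) as [dY [HdY [AY IY]]]; auto.
  { intros u Hu; rewrite HYy; auto. }
  destruct (exists_below3 e0 dX dY He0 HdX HdY) as (d & Hd & L0 & L1 & L2).
  assert (AX' : analytic_on (rect (t, 0) d) (surface_coord X)).
  { eapply analytic_on_subset; [|exact AX]. intros q; apply rect_le; auto. }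
  assert (AY' : analytic_on (rect (t, 0) d) (surface_coord Y)).
  { eapply analytic_on_subset; [|exact AY]. intros q; apply rect_le; auto. }
  assert (HXY : forall u, Rabs (u - t) < d -> X (RtoC u) = RtoC (x u) /\ Y (RtoC u) = RtoC (y u)).
  { intros u Hu; split; [apply HXx|apply HYy]; apply HJ; lra. }
  destruct (null_identities_rect X Y x y t d Hd HXY) as [e [He [Hed HN]]]; auto.
  { intros u Hu; apply arc_length, HJ; lra. }
  destruct (phi_defined_rect (interval a b) D t e0) as [d1 [Hd1 HP]]; auto.
  assert (Axis : forall r, Rabs (r - t) < d ->
     surface_coord X (r, 0) = x r /\ surface_coord Y (r, 0) = y r /\
     partial_x (surface_coord X) (r, 0) = Derive x r /\ partial_x (surface_coord Y) (r, 0) = Derive y r /\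
     partial_y (surface_coord X) (r, 0) = - / 2 * Derive_n x 2 r /\
     partial_y (surface_coord Y) (r, 0) = - / 2 * Derive_n y 2 r).
  { intros r Hr. assert (PX := fun u Hu => proj1 (HXY u Hu)). assert (PY := fun u Hu => proj2 (HXY u Hu)).
    split; [apply surface_coord_0, PX, Hr|]. split; [apply surface_coord_0, PY, Hr|].
    split; [symmetry; exact (curve_Derive X x t d Hd PX AX' r Hr)|].
    split; [symmetry; exact (curve_Derive Y y t d Hd PY AY' r Hr)|].
    split; [exact (surface_partial_y_0 X x t d Hd PX AX' r Hr)|exact (surface_partial_y_0 Y y t d Hd PY AY' r Hr)]. }
  set (V := rect (t, 0) d) in *. assert (HV : open V) by apply open_rect.
  set (A := surface_coord X) in *. set (B := surface_coord Y) in *.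
  assert (J0 : jacobian A B (t, 0) <> 0).
  { destruct (Axis t) as (_ & _ & E1 & E2 & E3 & E4).
    { unfold Rminus; rewrite Rplus_opp_r, Rabs_R0; auto. }
    destruct (HN (t, 0) (rect_center (t, 0) e He)) as [N1 N2]. simpl in N1.
    intros E. unfold jacobian in E.
    (* Lagrange's identity [|R|^2 |T|^2 = det(R, T)^2 + (R.T)^2] with [|R| = 1] on the axis: a zero
       Jacobian would give [T = - sigma'' / 2 = 0]. *)
    assert (S : partial_y A (t, 0) ^ 2 + partial_y B (t, 0) ^ 2 = 0).
    { replace (partial_y A (t, 0) ^ 2 + partial_y B (t, 0) ^ 2) with
       ((partial_x A (t, 0) ^ 2 + partial_x B (t, 0) ^ 2) * (partial_y A (t, 0) ^ 2 + partial_y B (t, 0) ^ 2)).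
      2:{ simpl; rewrite N1; ring. }
      replace (_ * _) with
       ((partial_x A (t, 0) * partial_y B (t, 0) - partial_y A (t, 0) * partial_x B (t, 0)) ^ 2
       + (partial_x A (t, 0) * partial_y A (t, 0) + partial_x B (t, 0) * partial_y B (t, 0)) ^ 2) by ring.
      rewrite E, N2; ring. }
    apply (locally_convex t Ht). rewrite E3, E4 in S.
    split; nra. }
  assert (JA := analytic_on_jacobian V A B HV AX' AY').
  assert (CJ := analytic_on_continuous V _ (t, 0) HV (rect_center (t, 0) d Hd) JA).
  rewrite continuous_rect in CJ.
  destruct (CJ (Rabs (jacobian A B (t, 0)))) as [d2 [Hd2 H2]]; [apply Rabs_pos_lt; auto|].
  destruct (exists_below3 e d1 d2 He Hd1 Hd2) as (m & Hm & M0 & M1 & M2).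
  assert (SV : subset (rect (t, 0) m) V) by (intros q Hq; eapply rect_le; [|exact Hq]; lra).
  exists m. unfold good_rect; cbv zeta.
  split; [auto|]. split; [eapply analytic_on_subset; eauto|]. split; [eapply analytic_on_subset; eauto|].
  split; [intros r s Hrs; apply HP; eapply rect_le; [|exact Hrs]; auto|].
  split; [|split].
  - intros r s Hrs. unfold phi_hat, real_point; rewrite fold_id; simpl.
    specialize (IX (r, s)). specialize (IY (r, s)). simpl in IX, IY.
    f_equal; [f_equal|].
    + rewrite (surjective_pairing (fold X r s)), IX; [reflexivity|]. eapply rect_le; [|exact Hrs]; lra.
    + rewrite (surjective_pairing (fold Y r s)), IY; [reflexivity|]. eapply rect_le; [|exact Hrs]; lra.
  - intros q Hq; split; [apply HN; eapply rect_le; [|exact Hq]; auto|].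
    intros E. specialize (H2 q ltac:(eapply rect_le; [|exact Hq]; auto)).
    fold A B in E. rewrite E in H2. unfold Rminus in H2; rewrite Rplus_0_l, Rabs_Ropp in H2. lra.
  - intros r Hr. apply Axis. destruct Hr as [Hr _]; simpl in Hr; lra.
Qed.

(** * The inverse function theorem in the plane *)

Lemma dist1_pos p q : 0 <= dist1 p q.
Proof. apply Rplus_le_le_0_compat; apply Rabs_pos. Qed.

Lemma dist1_triang p q r : dist1 p r <= dist1 p q + dist1 q r.
Proof.
  unfold dist1.
  replace (fst r - fst p) with ((fst q - fst p) + (fst r - fst q)) by ring.
  replace (snd r - snd p) with ((snd q - snd p) + (snd r - snd q)) by ring.
  assert (H1 := Rabs_triang (fst q - fst p) (fst r - fst q)).
  assert (H2 := Rabs_triang (snd q - snd p) (snd r - snd q)). lra.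
Qed.

Lemma dist1_sym p q : dist1 p q = dist1 q p.
Proof. unfold dist1; rewrite (Rabs_minus_sym (fst q)), (Rabs_minus_sym (snd q)); reflexivity. Qed.

Lemma dist1_eq p q : dist1 p q <= 0 -> p = q.
Proof.
  destruct p as [a b], q as [c d]; unfold dist1; simpl; intros H.
  assert (H1 := Rabs_pos (c - a)). assert (H2 := Rabs_pos (d - b)).
  assert (E1 : Rabs (c - a) = 0) by lra. assert (E2 : Rabs (d - b) = 0) by lra.
  apply Rabs_eq_0 in E1; apply Rabs_eq_0 in E2. f_equal; lra.
Qed.

Lemma dist1_rect p q d : dist1 p q < d -> rect p d q.
Proof.
  unfold dist1; intros H. assert (H1 := Rabs_pos (fst q - fst p)). assert (H2 := Rabs_pos (snd q - snd p)).
  split; lra.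
Qed.

(** [T] need not map the square into itself: the first step is short enough for the iterates to stay
    within [2 h < d] of [p0]. Their limit is taken coordinate by coordinate, as the sum of a
    geometrically dominated series. *)
Lemma contraction_fixpoint (T : R * R -> R * R) (p0 : R * R) (d h : R) :
  (forall p p', rect p0 d p -> rect p0 d p' -> dist1 (T p) (T p') <= / 2 * dist1 p p') ->
  dist1 p0 (T p0) <= h -> 2 * h < d -> exists p, rect p0 d p /\ T p = p.
Proof.
  intros HT H0 Hh.
  assert (h0 : 0 <= h) by (eapply Rle_trans; [apply dist1_pos|exact H0]).
  set (u := fun n => Nat.iter n T p0).
  (* [2 h - 2 h 2^-n] is the sum of the first [n] step bounds [h 2^-j]. *)
  assert (P : forall n, dist1 p0 (u n) <= 2 * h - 2 * h * (/ 2) ^ n /\ dist1 (u n) (u (S n)) <= h * (/ 2) ^ n).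
  { induction n as [|n [IH1 IH2]].
    - simpl. split; [|simpl in *; lra]. unfold dist1, Rminus; rewrite !Rplus_opp_r, Rabs_R0; lra.
    - assert (Pn : 0 < (/ 2) ^ n) by (apply pow_lt; lra).
      assert (D1 : dist1 p0 (u (S n)) <= 2 * h - 2 * h * (/ 2) ^ S n).
      { eapply Rle_trans; [apply (dist1_triang _ (u n))|]. simpl pow. lra. }
      split; [exact D1|]. change (u (S (S n))) with (T (u (S n))). change (u (S n)) with (T (u n)) at 1.
      eapply Rle_trans; [apply HT|simpl pow; lra].
      + apply dist1_rect; nra.
      + apply dist1_rect. assert (0 < (/ 2) ^ S n) by (apply pow_lt; lra). nra. }
  assert (L : forall pr : R * R -> R, (forall p q, Rabs (pr q - pr p) <= dist1 p q) ->
     ex_finite_lim_seq (fun n => pr (u n))).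
  { intros pr Hpr.
    assert (E : ex_series (fun n => pr (u (S n)) - pr (u n))).
    { apply ex_series_dominated with (fun n => h * (/ 2) ^ n).
      - intros n; eapply Rle_trans; [apply Hpr|apply P].
      - apply ex_series_Rscal, ex_series_geom. rewrite Rabs_pos_eq; lra. }
    destruct E as [l Hl]. exists (pr p0 + l). apply is_lim_seq_incr_1.
    apply is_lim_seq_ext with (fun n => pr p0 + sum_n (fun n => pr (u (S n)) - pr (u n)) n).
    - induction n as [|n IH]; [rewrite sum_O; simpl; ring|].
      rewrite sum_Sn. unfold plus; simpl plus. rewrite <- Rplus_assoc, IH. ring.
    - apply (is_lim_seq_plus' (fun _ => pr p0)); [apply is_lim_seq_const|exact Hl]. }
  destruct (L fst) as [l1 L1].
  { intros p q; unfold dist1; assert (X := Rabs_pos (snd q - snd p)); lra. }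
  destruct (L snd) as [l2 L2].
  { intros p q; unfold dist1; assert (X := Rabs_pos (fst q - fst p)); lra. }
  assert (LD : forall q, is_lim_seq (fun n => dist1 q (u n)) (dist1 q (l1, l2))).
  { intros q. unfold dist1; simpl.
    apply is_lim_seq_plus'.
    - apply (is_lim_seq_abs _ (Finite (l1 - fst q))). apply is_lim_seq_minus'; [exact L1|apply is_lim_seq_const].
    - apply (is_lim_seq_abs _ (Finite (l2 - snd q))). apply is_lim_seq_minus'; [exact L2|apply is_lim_seq_const]. }
  assert (R0 : rect p0 d (l1, l2)).
  { apply dist1_rect, Rle_lt_trans with (2 * h); auto.
    apply (is_lim_seq_le (fun n => dist1 p0 (u n)) (fun _ => 2 * h) (dist1 p0 (l1, l2)) (2 * h));
      [|apply LD|apply is_lim_seq_const].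
    intros n; destruct (P n) as [P1 _]. assert (0 < (/ 2) ^ n) by (apply pow_lt; lra). nra. }
  exists (l1, l2); split; auto. symmetry; apply dist1_eq.
  assert (Z : dist1 (l1, l2) (l1, l2) = 0) by (unfold dist1, Rminus; rewrite !Rplus_opp_r, Rabs_R0; ring).
  apply (is_lim_seq_le (fun _ => dist1 (l1, l2) (T (l1, l2)))
     (fun n => dist1 (l1, l2) (u (S n)) + / 2 * dist1 (l1, l2) (u n)) (dist1 (l1, l2) (T (l1, l2))) 0).
  - intros n. eapply Rle_trans; [apply (dist1_triang _ (u (S n)))|]. apply Rplus_le_compat_l.
    rewrite (dist1_sym (u (S n))). apply HT; auto. apply dist1_rect.
    destruct (P n) as [P1 _]. assert (0 < (/ 2) ^ n) by (apply pow_lt; lra). nra.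
  - apply is_lim_seq_const.
  - assert (X := LD (l1, l2)). rewrite Z in X.
    replace 0 with (0 + / 2 * 0) by ring. apply is_lim_seq_plus'.
    + apply (is_lim_seq_incr_1 (fun n => dist1 (l1, l2) (u n))); exact X.
    + apply (is_lim_seq_scal_l _ (/ 2) 0); exact X.
Qed.

(** Newton's iteration with the derivative frozen at [p0]: [P1], [P2] are the components of the
    inverse matrix and [S] bounds its norm. Strict differentiability with [1 / (4 S)] makes the map
    a contraction by [1/2]; the same estimate gives the Lipschitz bound for the inverse. *)
Lemma inverse_function (A B : R * R -> R) (p0 : R * R) (d0 : R) :
  C1_at A p0 -> C1_at B p0 -> jacobian A B p0 <> 0 -> 0 < d0 ->
  exists d h k, 0 < d <= d0 /\ 0 < h /\ 0 < k /\
    (forall p p', rect p0 d p -> rect p0 d p' ->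
       dist1 p p' <= k * dist1 (A p, B p) (A p', B p')) /\
    (forall q, rect (A p0, B p0) h q -> exists p, rect p0 d p /\ A p = fst q /\ B p = snd q).
Proof.
  intros HA HB HJ Hd0. unfold jacobian in HJ.
  set (a := partial_x A p0) in *. set (b := partial_y A p0) in *.
  set (c := partial_x B p0) in *. set (e := partial_y B p0) in *.
  set (J := a * e - b * c) in *.
  set (S := (Rabs a + Rabs b + Rabs c + Rabs e) / Rabs J + 1).
  assert (PJ : 0 < Rabs J) by (apply Rabs_pos_lt; auto).
  assert (Pa := Rabs_pos a). assert (Pb := Rabs_pos b). assert (Pc := Rabs_pos c). assert (Pe := Rabs_pos e).
  assert (PS : 1 <= S).
  { unfold S. assert (0 <= (Rabs a + Rabs b + Rabs c + Rabs e) / Rabs J); [|lra].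
    apply Rmult_le_pos; [lra|apply Rlt_le, Rinv_0_lt_compat; auto]. }
  assert (S1 : Rabs (e / J) + Rabs (b / J) + Rabs (c / J) + Rabs (a / J) <= S).
  { unfold Rdiv; rewrite !Rabs_mult, Rabs_inv. unfold S.
    replace ((Rabs a + Rabs b + Rabs c + Rabs e) / Rabs J) with
      (Rabs e * / Rabs J + Rabs b * / Rabs J + Rabs c * / Rabs J + Rabs a * / Rabs J) by (field; lra). lra. }
  set (P1 := fun u v : R => e / J * u - b / J * v).
  set (P2 := fun u v : R => a / J * v - c / J * u).
  assert (PB : forall u v, Rabs (P1 u v) + Rabs (P2 u v) <= S * (Rabs u + Rabs v)).
  { intros u v. unfold P1, P2.
    assert (T1 := Rabs_triang (e / J * u) (- (b / J * v))).
    assert (T2 := Rabs_triang (a / J * v) (- (c / J * u))).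
    rewrite Rabs_Ropp, !Rabs_mult in T1, T2. unfold Rminus.
    assert (Pu := Rabs_pos u). assert (Pv := Rabs_pos v).
    assert (Q1 := Rabs_pos (e / J)). assert (Q2 := Rabs_pos (b / J)).
    assert (Q3 := Rabs_pos (c / J)). assert (Q4 := Rabs_pos (a / J)). nra. }
  assert (PI : forall u v, P1 (a * u + b * v) (c * u + e * v) = u /\ P2 (a * u + b * v) (c * u + e * v) = v).
  { intros u v; unfold P1, P2; split; unfold J in *; field; auto. }
  assert (IP : forall u v, a * P1 u v + b * P2 u v = u /\ c * P1 u v + e * P2 u v = v).
  { intros u v; unfold P1, P2; split; unfold J in *; field; auto. }
  assert (Peps : 0 < / (4 * S)) by (apply Rinv_0_lt_compat; lra).
  destruct (strict_differential A p0 _ HA Peps) as [d1 [Hd1 H1]].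
  destruct (strict_differential B p0 _ HB Peps) as [d2 [Hd2 H2]].
  fold a b in H1. fold c e in H2.
  destruct (exists_below3 d0 d1 d2 Hd0 Hd1 Hd2) as (d & Hd & L & L1 & L2).
  assert (K : forall p p', rect p0 d p -> rect p0 d p' ->
     Rabs (P1 (A p' - A p) (B p' - B p) - (fst p' - fst p)) +
     Rabs (P2 (A p' - A p) (B p' - B p) - (snd p' - snd p)) <= / 2 * dist1 p p').
  { intros p p' Hp Hp'.
    specialize (H1 p p' (rect_le _ _ _ _ L1 Hp) (rect_le _ _ _ _ L1 Hp')).
    specialize (H2 p p' (rect_le _ _ _ _ L2 Hp) (rect_le _ _ _ _ L2 Hp')).
    destruct (PI (fst p' - fst p) (snd p' - snd p)) as [E1 E2].
    set (u := A p' - A p - (a * (fst p' - fst p) + b * (snd p' - snd p))) in *.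
    set (v := B p' - B p - (c * (fst p' - fst p) + e * (snd p' - snd p))) in *.
    replace (P1 (A p' - A p) (B p' - B p) - (fst p' - fst p)) with (P1 u v)
      by (rewrite <- E1; unfold P1, u, v; ring).
    replace (P2 (A p' - A p) (B p' - B p) - (snd p' - snd p)) with (P2 u v)
      by (rewrite <- E2; unfold P2, u, v; ring).
    eapply Rle_trans; [apply PB|].
    replace (/ 2 * dist1 p p') with (S * (/ (4 * S) * dist1 p p' + / (4 * S) * dist1 p p')) by (field; lra).
    apply Rmult_le_compat_l; lra. }
  (* A target within [d / (8 S)] in each coordinate gives a first Newton step of at most [d / 4], as
     [contraction_fixpoint] requires. [2 * S] results from moving [dist1 p p' / 2] to the left-hand
     side. *)
  exists d, (d / (8 * S)), (2 * S).
  split; [lra|]. split; [apply Rdiv_lt_0_compat; lra|]. split; [lra|]. split.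
  - intros p p' Hp Hp'. specialize (K p p' Hp Hp').
    assert (X := PB (A p' - A p) (B p' - B p)).
    unfold dist1 in *; simpl.
    set (x := fst p' - fst p) in *. set (y := snd p' - snd p) in *.
    set (X1 := P1 (A p' - A p) (B p' - B p)) in *. set (X2 := P2 (A p' - A p) (B p' - B p)) in *.
    assert (T1 := Rabs_triang_inv x X1). assert (T2 := Rabs_triang_inv y X2).
    rewrite (Rabs_minus_sym x) in T1. rewrite (Rabs_minus_sym y) in T2. lra.
  - intros q Hq.
    set (T := fun p => (fst p - P1 (A p - fst q) (B p - snd q), snd p - P2 (A p - fst q) (B p - snd q))).
    destruct (contraction_fixpoint T p0 d (d / 4)) as [p [Hp E]].
    + intros p p' Hp Hp'. eapply Rle_trans; [|apply (K p p' Hp Hp')].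
      unfold dist1, T; simpl. right. f_equal; rewrite <- Rabs_Ropp; f_equal; unfold P1, P2; ring.
    + unfold dist1, T; simpl. destruct Hq as [Hq1 Hq2]; simpl in Hq1, Hq2.
      replace (fst p0 - P1 (A p0 - fst q) (B p0 - snd q) - fst p0)
        with (P1 (fst q - A p0) (snd q - B p0)) by (unfold P1; ring).
      replace (snd p0 - P2 (A p0 - fst q) (B p0 - snd q) - snd p0)
        with (P2 (fst q - A p0) (snd q - B p0)) by (unfold P2; ring).
      eapply Rle_trans; [apply PB|].
      replace (d / 4) with (S * (d / (8 * S) + d / (8 * S))) by (field; lra).
      apply Rmult_le_compat_l; lra.
    + lra.
    + exists p; split; auto.
      assert (E1 := f_equal fst E). assert (E2 := f_equal snd E). simpl in E1, E2.
      destruct (IP (A p - fst q) (B p - snd q)) as [I1 I2].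
      assert (Z1 : P1 (A p - fst q) (B p - snd q) = 0) by lra.
      assert (Z2 : P2 (A p - fst q) (B p - snd q) = 0) by lra.
      rewrite Z1, Z2 in I1, I2. split; lra.
Qed.

(** The image under [(A, B)] moves on a line with velocity [(v1, v2)]. The Lipschitz bound makes the
    remainders of [A] and [B] small relative to [|s - t|], and Cramer's rule solves for the velocity
    upstairs; the two coordinate directions then give the partial derivatives of the inverse. *)
Lemma is_derive_inverse_curve (A B : R * R -> R) (g1 g2 : R -> R) (t v1 v2 k : R) :
  let p := (g1 t, g2 t) in
  C1_at A p -> C1_at B p -> jacobian A B p <> 0 -> 0 < k ->
  locally t (fun s => A (g1 s, g2 s) = A p + (s - t) * v1 /\ B (g1 s, g2 s) = B p + (s - t) * v2 /\
     dist1 p (g1 s, g2 s) <= k * Rabs (s - t)) ->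
  is_derive g1 t ((partial_y B p * v1 - partial_y A p * v2) / jacobian A B p) /\
  is_derive g2 t ((partial_x A p * v2 - partial_x B p * v1) / jacobian A B p).
Proof.
  intros p HA HB HJ Hk [r Hr].
  set (J := jacobian A B p) in *.
  set (a := partial_x A p) in *. set (b := partial_y A p) in *.
  set (c := partial_x B p) in *. set (e := partial_y B p) in *.
  assert (EJ : J = a * e - b * c) by reflexivity.
  assert (PJ : 0 < Rabs J) by (apply Rabs_pos_lt; auto).
  set (S := Rabs a + Rabs b + Rabs c + Rabs e + 1).
  assert (Pa := Rabs_pos a). assert (Pb := Rabs_pos b). assert (Pc := Rabs_pos c). assert (Pe := Rabs_pos e).
  assert (PS : 1 <= S) by (unfold S; lra).
  assert (M : forall eps, 0 < eps -> exists d, 0 < d /\ forall h, h <> 0 -> Rabs h < d ->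
     Rabs ((g1 (t + h) - g1 t) / h - (e * v1 - b * v2) / J) <= eps /\
     Rabs ((g2 (t + h) - g2 t) / h - (a * v2 - c * v1) / J) <= eps).
  { intros eps Heps.
    (* Cramer's rule turns remainders [eta * k * |h|] into an error of at most
       [S * eta * k / |J| = eps]. *)
    set (eta := eps * Rabs J / (k * S)).
    assert (Peta : 0 < eta).
    { apply Rdiv_lt_0_compat; apply Rmult_lt_0_compat; lra. }
    destruct (strict_differential A p _ HA Peta) as [d1 [Hd1 H1]].
    destruct (strict_differential B p _ HB Peta) as [d2 [Hd2 H2]].
    fold a b in H1. fold c e in H2.
    destruct (exists_below3 r (d1 / k) (d2 / k)) as (d & Hd & L & L1 & L2);
      try (apply Rdiv_lt_0_compat; auto); [apply cond_pos|].
    exists d; split; [exact Hd|].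
    intros h h0 Hh.
    destruct (Hr (t + h)) as (E1 & E2 & E3).
    { apply Rabs_ball.
      replace (t + h - t) with h by ring. lra. }
    replace (t + h - t) with h in * by ring.
    set (p' := (g1 (t + h), g2 (t + h))) in *.
    assert (K1 : k * Rabs h < d1).
    { apply Rlt_le_trans with (k * (d1 / k)); [apply Rmult_lt_compat_l; lra|right; field; lra]. }
    assert (K2 : k * Rabs h < d2).
    { apply Rlt_le_trans with (k * (d2 / k)); [apply Rmult_lt_compat_l; lra|right; field; lra]. }
    specialize (H1 p p' (rect_center _ _ Hd1) (dist1_rect p p' _ (Rle_lt_trans _ _ _ E3 K1))).
    specialize (H2 p p' (rect_center _ _ Hd2) (dist1_rect p p' _ (Rle_lt_trans _ _ _ E3 K2))).
    rewrite E1 in H1; rewrite E2 in H2.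
    change (fst p' - fst p) with (g1 (t + h) - g1 t) in *.
    change (snd p' - snd p) with (g2 (t + h) - g2 t) in *.
    set (x := g1 (t + h) - g1 t) in *. set (y := g2 (t + h) - g2 t) in *.
    set (u := A p + h * v1 - A p - (a * x + b * y)) in *.
    set (v := B p + h * v2 - B p - (c * x + e * y)) in *.
    assert (X1 : x / h - (e * v1 - b * v2) / J = (b * v - e * u) / (J * h)).
    { unfold u, v; rewrite EJ; field. rewrite EJ in HJ; auto. }
    assert (X2 : y / h - (a * v2 - c * v1) / J = (c * u - a * v) / (J * h)).
    { unfold u, v; rewrite EJ; field. rewrite EJ in HJ; auto. }
    assert (Ph : 0 < Rabs h) by (apply Rabs_pos_lt; auto).
    assert (U : Rabs u <= eta * (k * Rabs h)).
    { eapply Rle_trans; [exact H1|apply Rmult_le_compat_l; lra]. }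
    assert (W : Rabs v <= eta * (k * Rabs h)).
    { eapply Rle_trans; [exact H2|apply Rmult_le_compat_l; lra]. }
    assert (Fin : forall z, Rabs z <= S * (eta * (k * Rabs h)) -> Rabs (z / (J * h)) <= eps).
    { intros z Hz. unfold Rdiv; rewrite Rabs_mult, Rabs_inv, Rabs_mult.
      apply Rmult_le_reg_r with (Rabs J * Rabs h); [apply Rmult_lt_0_compat; auto|].
      rewrite Rmult_assoc, Rinv_l, Rmult_1_r by (apply Rgt_not_eq, Rmult_lt_0_compat; auto).
      eapply Rle_trans; [exact Hz|]. right. unfold eta; field. lra. }
    assert (PU := Rabs_pos u). assert (PV := Rabs_pos v).
    rewrite X1, X2. split; apply Fin.
    - assert (T := Rabs_triang (b * v) (- (e * u))). rewrite Rabs_Ropp, !Rabs_mult in T.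
      unfold Rminus. unfold S. nra.
    - assert (T := Rabs_triang (c * u) (- (a * v))). rewrite Rabs_Ropp, !Rabs_mult in T.
      unfold Rminus. unfold S. nra. }
  split; apply is_derive_Reals; intros eps Heps;
    (destruct (M (eps / 2) ltac:(lra)) as [d [Hd H]]; exists (mkposreal d Hd); intros h h0 Hh;
     destruct (H h h0 Hh); lra).
Qed.

(** * The analytic inverse function theorem *)

Lemma smooth_bound_C1_at (V : R * R -> Prop) c f p : open V -> V p ->
  smooth_bound 2 V c f -> C1_at f p.
Proof.
  intros HV Hp [_ [H1 [[_ [H2 [[H3 _] [H4 _]]]] [_ [H5 [[H6 _] [H7 _]]]]]]].
  split; [generalize (HV p Hp); apply filter_imp; auto|].
  split; apply bounded_partials_continuous with V (c 2%nat); auto.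
Qed.

Lemma analytic_on_C1_at (V : R * R -> Prop) f p : open V -> V p -> analytic_on V f -> C1_at f p.
Proof. intros HV Hp (M & K & HM & HK & A). eapply smooth_bound_C1_at; eauto. Qed.

(** Mixing a weighted coefficient with a plain factorial bound does not enlarge [M]:
    [k! (m + k - j)! <= (k - j)! (m + k)!] leaves the sum of [1 / (j + 1)^2], at most 2. The shift
    [m] counts the derivatives already taken in [smooth_bound_comp]. *)
Lemma bconv_weight_fact (a M K : R) (m k : nat) : 0 < M -> 0 <= a -> 0 <= K ->
  bconv (fun i => a * weight M i) (fun i => K * (M ^ i * INR (fact (m + i)))) k
  <= 2 * a * K * (M ^ k * INR (fact (m + k))).
Proof.
  intros HM Ha HK. rewrite bconv_scal.
  replace (2 * a * K * (M ^ k * INR (fact (m + k)))) with (a * K * (M ^ k * INR (fact (m + k)) * 2)) by ring.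
  apply Rmult_le_compat_l; [apply Rmult_le_pos; auto|].
  rewrite bconv_sum.
  assert (Q : 0 < M ^ k * INR (fact (m + k))) by (apply Rmult_lt_0_compat; [apply pow_lt; auto|apply INR_fact_lt_0]).
  apply Rle_trans with (sum_f_R0 (fun j => (1 / (INR j + 1) ^ 2) * (M ^ k * INR (fact (m + k)))) k).
  - apply sum_Rle; intros j Hj.
    assert (E : (fact k * fact (m + (k - j)) <= fact (k - j) * fact (m + k))%nat).
    { clear -Hj. induction m as [|m IH]; [simpl; lia|].
      replace (S m + (k - j))%nat with (S (m + (k - j))) by lia.
      replace (S m + k)%nat with (S (m + k)) by lia.
      rewrite !fact_simpl.
      apply Nat.le_trans with (S (m + (k - j)) * (fact (k - j) * fact (m + k)))%nat; [nia|].
      replace (fact (k - j) * (S (m + k) * fact (m + k)))%nat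
        with (S (m + k) * (fact (k - j) * fact (m + k)))%nat by ring.
      apply Nat.mul_le_mono_r. lia. }
    apply le_INR in E. rewrite !mult_INR in E.
    assert (F1 := INR_fact_lt_0 j). assert (F2 := INR_fact_lt_0 (k - j)).
    assert (F3 := INR1_pos j).
    replace (Binomial.C k j * (weight M j * (M ^ (k - j) * INR (fact (m + (k - j))))))
      with (1 / (INR j + 1) ^ 2 * (M ^ k * (INR (fact k) * INR (fact (m + (k - j))) / INR (fact (k - j))))).
    2:{ unfold Binomial.C, weight. replace (M ^ k) with (M ^ (j + (k - j))) by (f_equal; lia).
        rewrite pow_add. field; repeat split; lra. }
    apply Rmult_le_compat_l; [apply Rlt_le, Rdiv_lt_0_compat; [lra|apply pow_lt; auto]|].
    apply Rmult_le_compat_l; [apply pow_le; lra|].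
    apply Rmult_le_reg_r with (INR (fact (k - j))); auto.
    unfold Rdiv; rewrite Rmult_assoc, Rinv_l by lra. lra.
  - rewrite <- scal_sum. apply Rmult_le_compat_l; [lra|].
    assert (HS := sum_inv_sq k). assert (0 < 1 / (INR k + 1)) by (apply Rdiv_lt_0_compat; [lra|apply INR1_pos]). lra.
Qed.

(** Differentiating [H o g] amounts to applying to [H] one of the vector fields
    given by the rows of the inverse Jacobian matrix. *)
Lemma smooth_bound_comp (V V' : R * R -> Prop) (M a : R) (n11 n12 n21 n22 : R * R -> R)
  (g : R * R -> R * R) :
  open V -> open V' -> 0 < M -> 0 < a ->
  analytic_norm V M a n11 -> analytic_norm V M a n12 ->
  analytic_norm V M a n21 -> analytic_norm V M a n22 ->
  (forall q, V' q -> V (g q)) ->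
  (forall q, V' q -> is_partials (fun p => fst (g p)) q (n11 (g q)) (n21 (g q)) /\
                     is_partials (fun p => snd (g p)) q (n12 (g q)) (n22 (g q))) ->
  forall n m K H, 0 <= K ->
    (forall N, smooth_bound N V (fun i => K * (M ^ i * INR (fact (m + i)))) H) ->
    smooth_bound n V' (fun k => K * (4 * a * M) ^ k * INR (fact (m + k))) (fun q => H (g q)).
Proof.
  intros HV HV' HM Ha A11 A12 A21 A22 Hg Dg.
  induction n as [|n IH]; intros m K H HK HH;
    assert (B0 : forall q, V' q -> Rabs (H (g q)) <= K * (4 * a * M) ^ 0 * INR (fact (m + 0)))
      by (intros q Hq; destruct (HH O) as [B _]; specialize (B _ (Hg q Hq)); rewrite pow_O in *; lra).
  - split; auto.
  - assert (P : forall b c, analytic_norm V M a b -> analytic_norm V M a c ->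
      smooth_bound n V' (fun k => K * (4 * a * M) ^ S k * INR (fact (m + S k)))
        (fun q => b (g q) * partial_x H (g q) + c (g q) * partial_y H (g q))).
    { intros b c Hb Hc.
      (* One derivative of [H o g] is again some [H' o g], with [m] raised by one. Each of the two
         products costs [2 a] and the shift of the order costs [M], so [K] grows by the factor
         [4 a M]. *)
      eapply smooth_bound_le; [|apply (IH (S m) (K * (4 * a * M)) (fun p => b p * partial_x H p + c p * partial_y H p))].
      - intros k _; cbv beta. rewrite <- plus_n_Sm. simpl. right; ring.
      - apply Rmult_le_pos; auto. repeat apply Rmult_le_pos; lra.
      - intros N. destruct (HH (S N)) as [_ [_ [Hx Hy]]].
        assert (W : forall f h, analytic_norm V M a f ->
          smooth_bound N V (fun k => K * (M ^ S k * INR (fact (m + S k)))) h ->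
          smooth_bound N V (fun k => 2 * a * (K * M) * (M ^ k * INR (fact (S m + k)))) (fun p => f p * h p)).
        { intros f h Hf Hh.
          assert (Hh' : smooth_bound N V (fun k => (K * M) * (M ^ k * INR (fact (S m + k)))) h).
          { eapply smooth_bound_le; [|exact Hh]. intros k _; cbv beta.
            rewrite <- plus_n_Sm. simpl. right; ring. }
          eapply smooth_bound_le; [|exact (smooth_bound_mult N V _ _ _ _ HV (Hf N) Hh')].
          intros k _; cbv beta. apply bconv_weight_fact; try lra. apply Rmult_le_pos; lra. }
        eapply smooth_bound_le; [|exact (smooth_bound_plus N V _ _ _ _ HV (W b _ Hb Hx) (W c _ Hc Hy))].
        intros k _; cbv beta. right; ring. }
    assert (L : forall q, V' q -> is_partials (fun q => H (g q)) q
       (n11 (g q) * partial_x H (g q) + n12 (g q) * partial_y H (g q))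
       (n21 (g q) * partial_x H (g q) + n22 (g q) * partial_y H (g q))).
    { intros [u v] Hq. destruct (Dg _ Hq) as [[D1 D2] [D3 D4]].
      destruct (smooth_bound_C1_at V _ H (g (u, v)) HV (Hg _ Hq) (HH 2%nat)) as (C0 & C1 & C2).
      simpl in D1, D2, D3, D4. split; simpl.
      - apply (is_derive_ext (fun s => H (fst (g (s, v)), snd (g (s, v)))));
          [intros s; rewrite <- surjective_pairing; reflexivity|].
        assert (E : (fst (g (u, v)), snd (g (u, v))) = g (u, v)) by (rewrite <- surjective_pairing; reflexivity).
        assert (X := is_derive_comp_2d H (fun s => fst (g (s, v))) (fun s => snd (g (s, v))) u _ _
          ltac:(cbv beta; rewrite E; exact C0) ltac:(cbv beta; rewrite E; exact C1) ltac:(cbv beta; rewrite E; exact C2) D1 D3).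
        cbv beta in X. rewrite E in X.
        rewrite (Rmult_comm (n11 _)), (Rmult_comm (n12 _)). exact X.
      - apply (is_derive_ext (fun s => H (fst (g (u, s)), snd (g (u, s)))));
          [intros s; rewrite <- surjective_pairing; reflexivity|].
        assert (E : (fst (g (u, v)), snd (g (u, v))) = g (u, v)) by (rewrite <- surjective_pairing; reflexivity).
        assert (X := is_derive_comp_2d H (fun s => fst (g (u, s))) (fun s => snd (g (u, s))) v _ _
          ltac:(cbv beta; rewrite E; exact C0) ltac:(cbv beta; rewrite E; exact C1) ltac:(cbv beta; rewrite E; exact C2) D2 D4).
        cbv beta in X. rewrite E in X.
        rewrite (Rmult_comm (n21 _)), (Rmult_comm (n22 _)). exact X. }
    apply (smooth_bound_S n V' _ _ _ _ HV' B0 L); apply P; auto.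
Qed.

Lemma analytic_inverse (V W : R * R -> Prop) (A B : R * R -> R) (p0 : R * R) :
  open V -> open W -> V p0 -> W p0 -> analytic_on V A -> analytic_on V B -> jacobian A B p0 <> 0 ->
  exists (h : R) (g : R * R -> R * R), 0 < h /\
    (forall q, rect (A p0, B p0) h q -> W (g q) /\ A (g q) = fst q /\ B (g q) = snd q) /\
    analytic_on (rect (A p0, B p0) h) (fun q => fst (g q)).
Proof.
  intros HV HW Vp Wp HA HB HJ.
  assert (JA := analytic_on_jacobian V A B HV HA HB).
  assert (PJ : 0 < Rabs (jacobian A B p0)) by (apply Rabs_pos_lt; auto).
  assert (CJ := analytic_on_continuous V _ p0 HV Vp JA). rewrite continuous_rect in CJ.
  destruct (CJ (Rabs (jacobian A B p0) / 2) ltac:(lra)) as [d1 [Hd1 H1]].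
  assert (HVW := filter_and _ _ (HV p0 Vp) (HW p0 Wp)). apply locally_rect in HVW.
  destruct HVW as [d2 [Hd2 H2]].
  assert (Hd0 : 0 < Rmin d1 d2) by (apply Rmin_pos; auto).
  destruct (inverse_function A B p0 (Rmin d1 d2) (analytic_on_C1_at V A p0 HV Vp HA)
    (analytic_on_C1_at V B p0 HV Vp HB) HJ Hd0) as (d & h & k & [Hd Hdd] & Hh & Hk & Lip & Sur).
  set (V0 := rect p0 d). assert (HV0 : open V0) by apply open_rect.
  assert (S1 : subset V0 (rect p0 d1)) by (intros q; apply rect_le; eapply Rle_trans; [exact Hdd|apply Rmin_l]).
  assert (S2 : subset V0 (fun q => V q /\ W q)).
  { intros q Hq; apply H2; revert Hq; apply rect_le; eapply Rle_trans; [exact Hdd|apply Rmin_r]. }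
  assert (HA0 : analytic_on V0 A) by (apply analytic_on_subset with V; auto; intros q Hq; apply S2, Hq).
  assert (HB0 : analytic_on V0 B) by (apply analytic_on_subset with V; auto; intros q Hq; apply S2, Hq).
  assert (JA0 : analytic_on V0 (jacobian A B)) by (apply analytic_on_subset with V; auto; intros q Hq; apply S2, Hq).
  (* A lower bound uniform on the square, as [analytic_on_inv] requires. *)
  assert (JB : forall q, V0 q -> Rabs (jacobian A B p0) / 2 <= Rabs (jacobian A B q)).
  { intros q Hq. specialize (H1 q (S1 q Hq)).
    assert (T := Rabs_triang_inv (jacobian A B p0) (jacobian A B q)).
    rewrite Rabs_minus_sym in H1. lra. }
  assert (J0 : forall q, V0 q -> jacobian A B q <> 0).
  { intros q Hq E; specialize (JB q Hq); rewrite E, Rabs_R0 in JB; lra. }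
  assert (PJ2 : 0 < Rabs (jacobian A B p0) / 2) by lra.
  assert (IJ := analytic_on_inv V0 _ _ HV0 PJ2 JB JA0).
  set (n11 := fun q => partial_y B q * / jacobian A B q).
  set (n12 := fun q => - 1 * (partial_x B q * / jacobian A B q)).
  set (n21 := fun q => - 1 * (partial_y A q * / jacobian A B q)).
  set (n22 := fun q => partial_x A q * / jacobian A B q).
  assert (N11 : analytic_on V0 n11) by (apply analytic_on_mult; auto using analytic_on_partial_y).
  assert (N22 : analytic_on V0 n22) by (apply analytic_on_mult; auto using analytic_on_partial_x).
  assert (N12 : analytic_on V0 n12).
  { apply (analytic_on_mult V0 (fun _ => -1)); auto using analytic_on_const.
    apply analytic_on_mult; auto using analytic_on_partial_x. }
  assert (N21 : analytic_on V0 n21).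
  { apply (analytic_on_mult V0 (fun _ => -1)); auto using analytic_on_const.
    apply analytic_on_mult; auto using analytic_on_partial_y. }
  destruct (analytic_on_coordinates p0 d Hd) as [Nf _]. fold V0 in Nf.
  assert (Common : exists M a, 0 < M /\ 0 < a /\ analytic_norm V0 M a n11 /\ analytic_norm V0 M a n12 /\
     analytic_norm V0 M a n21 /\ analytic_norm V0 M a n22 /\ analytic_norm V0 M a fst).
  { destruct N11 as (M1 & K1 & P1 & Q1 & N11), N12 as (M2 & K2 & P2 & Q2 & N12),
      N21 as (M3 & K3 & P3 & Q3 & N21), N22 as (M4 & K4 & P4 & Q4 & N22), Nf as (M5 & K5 & P5 & Q5 & Nf).
    exists (M1 + M2 + M3 + M4 + M5), (K1 + K2 + K3 + K4 + K5 + 1).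
    split; [lra|]; split; [lra|].
    repeat match goal with |- _ /\ _ => split end; (eapply analytic_norm_le; [| |eassumption]; lra). }
  destruct Common as (M & a & HM & Ha & N11' & N12' & N21' & N22' & Nf').
  (* Surjectivity onto [V'] makes the choice meaningful there; uniqueness of the preimage in [V0] is
     contained in the Lipschitz bound [Lip]. *)
  set (g := fun q : R * R => epsilon (inhabits p0) (fun p => V0 p /\ A p = fst q /\ B p = snd q)).
  set (V' := rect (A p0, B p0) h). assert (HV' : open V') by apply open_rect.
  assert (Hg : forall q, V' q -> V0 (g q) /\ A (g q) = fst q /\ B (g q) = snd q).
  { intros q Hq; unfold g; apply epsilon_spec. apply Sur, Hq. }
  exists h, g; split; auto. split.
  { intros q Hq; destruct (Hg q Hq) as [G1 G2]; split; auto. apply S2, G1. }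
  assert (Dg : forall q, V' q -> is_partials (fun p => fst (g p)) q (n11 (g q)) (n21 (g q)) /\
                     is_partials (fun p => snd (g p)) q (n12 (g q)) (n22 (g q))).
  { intros [u v] Hq. destruct (Hg _ Hq) as [G1 [G2 G3]]; simpl in G2, G3.
    assert (E : (fst (g (u, v)), snd (g (u, v))) = g (u, v)) by (rewrite <- surjective_pairing; reflexivity).
    assert (CA : C1_at A (g (u, v))) by (apply (analytic_on_C1_at V0 A _ HV0 G1 HA0)).
    assert (CB : C1_at B (g (u, v))) by (apply (analytic_on_C1_at V0 B _ HV0 G1 HB0)).
    assert (DX := is_derive_inverse_curve A B (fun s => fst (g (s, v))) (fun s => snd (g (s, v))) u 1 0 k).
    assert (DY := is_derive_inverse_curve A B (fun s => fst (g (u, s))) (fun s => snd (g (u, s))) v 0 1 k).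
    cbv zeta beta in DX, DY. rewrite E in DX, DY.
    destruct DX as [DX1 DX2]; auto.
    { assert (I : forall s : R, V' (s, v) ->
        A (fst (g (s, v)), snd (g (s, v))) = A (g (u, v)) + (s - u) * 1 /\
        B (fst (g (s, v)), snd (g (s, v))) = B (g (u, v)) + (s - u) * 0 /\
        dist1 (g (u, v)) (fst (g (s, v)), snd (g (s, v))) <= k * Rabs (s - u)).
      2:{ generalize (locally_fst_line (u, v) V' (HV' _ Hq)); apply filter_imp; exact I. }
      intros s Hs.
      rewrite <- surjective_pairing. destruct (Hg _ Hs) as [I1 [I2 I3]]; simpl in I2, I3.
      rewrite I2, I3, G2, G3. split; [ring|]; split; [ring|].
      eapply Rle_trans; [apply Lip; auto|]. rewrite I2, I3, G2, G3. unfold dist1; simpl.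
      right; replace (v - v) with 0 by ring; rewrite Rabs_R0; ring. }
    destruct DY as [DY1 DY2]; auto.
    { assert (I : forall s : R, V' (u, s) ->
        A (fst (g (u, s)), snd (g (u, s))) = A (g (u, v)) + (s - v) * 0 /\
        B (fst (g (u, s)), snd (g (u, s))) = B (g (u, v)) + (s - v) * 1 /\
        dist1 (g (u, v)) (fst (g (u, s)), snd (g (u, s))) <= k * Rabs (s - v)).
      2:{ generalize (locally_snd_line (u, v) V' (HV' _ Hq)); apply filter_imp; exact I. }
      intros s Hs.
      rewrite <- surjective_pairing. destruct (Hg _ Hs) as [I1 [I2 I3]]; simpl in I2, I3.
      rewrite I2, I3, G2, G3. split; [ring|]; split; [ring|].
      eapply Rle_trans; [apply Lip; auto|]. rewrite I2, I3, G2, G3. unfold dist1; simpl.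
      right; replace (u - u) with 0 by ring; rewrite Rabs_R0; ring. }
    assert (Jn := J0 _ G1).
    split; split; simpl; unfold n11, n12, n21, n22.
    - replace (_ * _) with ((partial_y B (g (u, v)) * 1 - partial_y A (g (u, v)) * 0) / jacobian A B (g (u, v))) by (field; auto). exact DX1.
    - replace (_ * _) with ((partial_y B (g (u, v)) * 0 - partial_y A (g (u, v)) * 1) / jacobian A B (g (u, v))) by (field; auto). exact DY1.
    - replace (_ * _) with ((partial_x A (g (u, v)) * 0 - partial_x B (g (u, v)) * 1) / jacobian A B (g (u, v))) by (field; auto). exact DX2.
    - replace (_ * _) with ((partial_x A (g (u, v)) * 1 - partial_x B (g (u, v)) * 0) / jacobian A B (g (u, v))) by (field; auto). exact DY2. }
  assert (L0 : 0 < 4 * a * M) by (repeat apply Rmult_lt_0_compat; lra).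
  (* The chain rule yields the rate [4 a M] against plain factorials; the outer 4 restores the
     weights. *)
  exists (4 * (4 * a * M)), a. split; [lra|]; split; [lra|].
  intros n. eapply smooth_bound_le; [|apply (smooth_bound_comp V0 V' M a n11 n12 n21 n22 g HV0 HV' HM Ha
     N11' N12' N21' N22' (fun q Hq => proj1 (Hg q Hq)) Dg n O a fst); [lra|]].
  - intros i _; cbv beta; simpl plus. rewrite Rmult_assoc. apply Rmult_le_compat_l; [lra|].
    apply fact_le_weight; auto.
  - intros N. eapply smooth_bound_le; [|apply Nf']. intros i _; cbv beta; simpl plus.
    apply Rmult_le_compat_l; [lra|apply weight_le_fact; auto].
Qed.

(** * Taylor expansion *)

Definition dir_deriv (h k : R) (f : R * R -> R) (q : R * R) : R :=
  h * partial_x f q + k * partial_y f q.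

Lemma smooth_bound_dir_deriv (h k : R) m (V : R * R -> Prop) c f : open V ->
  smooth_bound (S m) V c f ->
  smooth_bound m V (fun i => (Rabs h + Rabs k) * c (S i)) (dir_deriv h k f).
Proof.
  intros HV [_ [_ [H1 H2]]].
  eapply smooth_bound_le; [|exact (smooth_bound_plus m V _ _ _ _ HV
    (smooth_bound_scal h m V _ _ HV H1) (smooth_bound_scal k m V _ _ HV H2))].
  intros i _; cbv beta; right; ring.
Qed.

Lemma smooth_bound_iter_dir_deriv (h k : R) n : forall m (V : R * R -> Prop) c f, open V ->
  smooth_bound (n + m) V c f ->
  smooth_bound m V (fun i => (Rabs h + Rabs k) ^ n * c (n + i)%nat) (Nat.iter n (dir_deriv h k) f).
Proof.
  induction n as [|n IH]; intros m V c f HV H.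
  - eapply smooth_bound_le; [|exact H]. intros; simpl; lra.
  - assert (H' : smooth_bound (n + S m) V c f) by (rewrite <- plus_n_Sm; exact H).
    apply IH in H'; auto. cbn [Nat.iter].
    eapply smooth_bound_le; [|apply smooth_bound_dir_deriv; [auto|exact H']].
    intros i _; cbv beta. rewrite <- plus_n_Sm. simpl. right; ring.
Qed.

Lemma smooth_bound_iter_partial_x n : forall m (V : R * R -> Prop) c f,
  smooth_bound (n + m) V c f ->
  smooth_bound m V (fun k => c (n + k)%nat) (Nat.iter n partial_x f).
Proof.
  induction n as [|n IH]; intros m V c f H; [exact H|].
  assert (H' : smooth_bound (n + S m) V c f) by (rewrite <- plus_n_Sm; exact H).
  apply IH in H'. destruct H' as [_ [_ [H' _]]]. cbn [Nat.iter].
  eapply smooth_bound_le; [|exact H']. intros k _; cbv beta. rewrite <- plus_n_Sm. simpl. lra.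
Qed.

Definition mixed (f : R * R -> R) (j l : nat) : R * R -> R :=
  Nat.iter j partial_x (Nat.iter l partial_y f).

Lemma mixed_bound (V : R * R -> Prop) M K f j l q : 0 < M -> 0 <= K -> analytic_norm V M K f -> V q ->
  Rabs (mixed f j l q) <= K * (M ^ (j + l) * INR (fact (j + l))).
Proof.
  intros HM HK H Hq.
  assert (X := smooth_bound_iter_partial_x j 0 V _ _ (smooth_bound_iter_partial_y l (j + 0) V _ f (H (l + (j + 0))%nat))).
  destruct X as [X _]. specialize (X q Hq). cbv beta in X. rewrite Nat.add_0_r in X.
  eapply Rle_trans; [exact X|]. rewrite (Nat.add_comm l j).
  apply Rmult_le_compat_l; auto; apply weight_le_fact; auto.
Qed.

Lemma analytic_on_iter_x (V : R * R -> Prop) f j : analytic_on V f -> analytic_on V (Nat.iter j partial_x f).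
Proof. intros H; induction j; [exact H|apply analytic_on_partial_x, IHj]. Qed.

Lemma analytic_on_iter_y (V : R * R -> Prop) f j : analytic_on V f -> analytic_on V (Nat.iter j partial_y f).
Proof. intros H; induction j; [exact H|apply analytic_on_partial_y, IHj]. Qed.

Lemma partial_y_iter_x (V : R * R -> Prop) f j : open V -> analytic_on V f -> forall q, V q ->
  partial_y (Nat.iter j partial_x f) q = Nat.iter j partial_x (partial_y f) q.
Proof.
  intros HV H; induction j as [|j IH]; intros q Hq; [reflexivity|]. simpl.
  rewrite <- (analytic_on_mixed_partials V _ q HV Hq (analytic_on_iter_x V f j H)).
  apply partial_ext. generalize (HV q Hq); apply filter_imp; exact IH.
Qed.

Lemma is_partials_sum (F Fx Fy : nat -> R * R -> R) (q : R * R) (n : nat) :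
  (forall j, (j <= n)%nat -> is_partials (F j) q (Fx j q) (Fy j q)) ->
  is_partials (fun p => sum_f_R0 (fun j => F j p) n) q
    (sum_f_R0 (fun j => Fx j q) n) (sum_f_R0 (fun j => Fy j q) n).
Proof.
  induction n as [|n IH]; intros H; simpl; [apply H; lia|].
  apply is_partials_plus; [apply IH; intros; apply H; lia|apply H; lia].
Qed.

(** The binomial formula for [(h d/dx + k d/dy)^n], valid because the partial derivatives
    commute. *)
Lemma iter_dir_deriv_binomial (h k : R) (V : R * R -> Prop) f n : open V -> analytic_on V f ->
  forall q, V q -> Nat.iter n (dir_deriv h k) f q =
    sum_f_R0 (fun j => Binomial.C n j * (h ^ j * k ^ (n - j) * mixed f j (n - j) q)) n.
Proof.
  intros HV Hf; induction n as [|n IH]; intros q Hq.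
  - simpl. rewrite C_n_0. unfold mixed; simpl; ring.
  - change (Nat.iter (S n) (dir_deriv h k) f q) with
      (h * partial_x (Nat.iter n (dir_deriv h k) f) q + k * partial_y (Nat.iter n (dir_deriv h k) f) q).
    set (G := fun p => sum_f_R0 (fun j => Binomial.C n j * (h ^ j * k ^ (n - j) * mixed f j (n - j) p)) n).
    assert (L : locally q (fun p => Nat.iter n (dir_deriv h k) f p = G p))
      by (generalize (HV q Hq); apply filter_imp; exact IH).
    destruct (partial_ext (Nat.iter n (dir_deriv h k) f) G q L) as [-> ->].
    assert (D : is_partials G q
       (sum_f_R0 (fun j => Binomial.C n j * (h ^ j * k ^ (n - j) * mixed f (S j) (n - j) q)) n)
       (sum_f_R0 (fun j => Binomial.C n j * (h ^ j * k ^ (n - j) * mixed f j (S (n - j)) q)) n)).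
    { apply (is_partials_sum
       (fun j p => Binomial.C n j * (h ^ j * k ^ (n - j) * mixed f j (n - j) p))
       (fun j p => Binomial.C n j * (h ^ j * k ^ (n - j) * mixed f (S j) (n - j) p))
       (fun j p => Binomial.C n j * (h ^ j * k ^ (n - j) * mixed f j (S (n - j)) p)) q n).
      intros j _.
      assert (E : ex_partials (mixed f j (n - j)) q)
        by (apply (analytic_on_ex_partials V); auto; apply analytic_on_iter_x, analytic_on_iter_y, Hf).
      apply ex_partials_is in E. destruct E as [E1 E2].
      replace (mixed f j (S (n - j)) q) with (partial_y (mixed f j (n - j)) q)
        by apply (partial_y_iter_x V _ j HV (analytic_on_iter_y V f (n - j) Hf) q Hq).
      split.
      - exact (is_derive_scal _ _ (Binomial.C n j) _ (is_derive_scal _ _ (h ^ j * k ^ (n - j)) _ E1)).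
      - exact (is_derive_scal _ _ (Binomial.C n j) _ (is_derive_scal _ _ (h ^ j * k ^ (n - j)) _ E2)). }
    destruct (is_partials_unique _ _ _ _ D) as [-> ->].
    rewrite (sum_pascal (fun j => h ^ j * k ^ (S n - j) * mixed f j (S n - j) q)).
    rewrite !scal_sum.
    rewrite <- plus_sum. apply sum_eq; intros j Hj.
    replace (S n - j)%nat with (S (n - j)) by lia. simpl. ring.
Qed.

Lemma Derive_n_line (h k : R) (V : R * R -> Prop) f q0 : open V -> analytic_on V f ->
  forall n t, V (fst q0 + t * h, snd q0 + t * k) ->
    Derive_n (fun s => f (fst q0 + s * h, snd q0 + s * k)) n t
      = Nat.iter n (dir_deriv h k) f (fst q0 + t * h, snd q0 + t * k) /\
    ex_derive (Derive_n (fun s => f (fst q0 + s * h, snd q0 + s * k)) n) t.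
Proof.
  intros HV Hf.
  assert (DA : forall n, analytic_on V (Nat.iter n (dir_deriv h k) f)).
  { induction n as [|n IH]; [exact Hf|].
    apply analytic_on_plus; auto.
    - apply (analytic_on_mult V (fun _ => h)); auto using analytic_on_const, analytic_on_partial_x.
    - apply (analytic_on_mult V (fun _ => k)); auto using analytic_on_const, analytic_on_partial_y. }
  assert (LV : forall t, V (fst q0 + t * h, snd q0 + t * k) ->
     locally t (fun s => V (fst q0 + s * h, snd q0 + s * k))).
  { intros t Ht. specialize (HV _ Ht); apply locally_rect in HV; destruct HV as [d [Hd HV]].
    assert (P1 := Rabs_pos h). assert (P2 := Rabs_pos k).
    assert (Pe : 0 < d / (Rabs h + Rabs k + 1)) by (apply Rdiv_lt_0_compat; lra).
    exists (mkposreal _ Pe); intros s Hs.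
    apply ball_Rabs in Hs; simpl in Hs.
    assert (Hs' : Rabs (s - t) * (Rabs h + Rabs k + 1) < d).
    { apply (Rmult_lt_compat_r (Rabs h + Rabs k + 1)) in Hs; [|lra].
      replace (d / (Rabs h + Rabs k + 1) * (Rabs h + Rabs k + 1)) with d in Hs by (field; lra). exact Hs. }
    assert (P3 := Rabs_pos (s - t)).
    apply HV; split; simpl.
    - replace (_ - _) with ((s - t) * h) by ring. rewrite Rabs_mult. nra.
    - replace (_ - _) with ((s - t) * k) by ring. rewrite Rabs_mult. nra. }
  assert (D : forall n t, V (fst q0 + t * h, snd q0 + t * k) ->
     is_derive (fun s => Nat.iter n (dir_deriv h k) f (fst q0 + s * h, snd q0 + s * k)) t
       (Nat.iter (S n) (dir_deriv h k) f (fst q0 + t * h, snd q0 + t * k))).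
  { intros n t Ht. set (q := (fst q0 + t * h, snd q0 + t * k)).
    change (Nat.iter (S n) (dir_deriv h k) f q) with
      (h * partial_x (Nat.iter n (dir_deriv h k) f) q + k * partial_y (Nat.iter n (dir_deriv h k) f) q).
    rewrite (Rmult_comm h), (Rmult_comm k).
    apply (analytic_on_is_derive_comp V _ (fun s => fst q0 + s * h) (fun s => snd q0 + s * k)); auto;
      auto_derive; auto; ring. }
  assert (E : forall n t, V (fst q0 + t * h, snd q0 + t * k) ->
    Derive_n (fun s => f (fst q0 + s * h, snd q0 + s * k)) n t
      = Nat.iter n (dir_deriv h k) f (fst q0 + t * h, snd q0 + t * k)).
  { induction n as [|n IH]; intros t Ht; [reflexivity|]. simpl Derive_n.
    rewrite (Derive_ext_loc _ (fun s => Nat.iter n (dir_deriv h k) f (fst q0 + s * h, snd q0 + s * k))).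
    - apply is_derive_unique, D, Ht.
    - generalize (LV t Ht); apply filter_imp; exact IH. }
  intros n t Ht; split; [apply E, Ht|].
  eapply ex_derive_ext_loc; [|eexists; apply (D n t Ht)].
  generalize (LV t Ht); apply filter_imp; intros s Hs; symmetry; apply E, Hs.
Qed.

Lemma is_series_of_remainder (u : nat -> R) (l K : R) :
  (forall n, Rabs (l - sum_f_R0 u n) <= K * (/ 2) ^ n) -> is_series u l.
Proof.
  intros H. change (is_lim_seq (sum_n u) (Finite l)).
  apply (is_lim_seq_ext (sum_f_R0 u)); [intros; rewrite sum_n_Reals; reflexivity|].
  assert (G : is_lim_seq (fun n => K * (/ 2) ^ n) 0).
  { replace 0 with (K * 0) by ring. apply (is_lim_seq_scal_l _ K 0), is_lim_seq_geom.
    rewrite Rabs_pos_eq; lra. }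
  apply (is_lim_seq_le_le (fun n => l - K * (/ 2) ^ n) _ (fun n => l + K * (/ 2) ^ n)).
  - intros n; specialize (H n). apply Rabs_le_between in H. lra.
  - replace (Finite l) with (Finite (l - 0)) by (f_equal; ring).
    apply is_lim_seq_minus'; [apply is_lim_seq_const|exact G].
  - replace (Finite l) with (Finite (l + 0)) by (f_equal; ring).
    apply is_lim_seq_plus'; [apply is_lim_seq_const|exact G].
Qed.

(** Taylor's formula on the segment from [q0] to [q]: its term of order [n] is the homogeneous part
    of degree [n], and the remainder is at most [K (M (|h| + |k|))^(n+1)]. The radius [1 / (4 M)]
    makes the ratio at most [1/2], which also gives absolute convergence. *)
Lemma analytic_on_analytic2 (V : R * R -> Prop) f q0 : open V -> V q0 -> analytic_on V f ->
  analytic2_at f q0.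
Proof.
  intros HV Hq0 Hf. pose proof Hf as (M & K & HM & HK & A).
  assert (HV0 := HV q0 Hq0); apply locally_rect in HV0; destruct HV0 as [d [Hd HV0]].
  set (e := Rmin d (/ (4 * M))).
  assert (Pi : 0 < / (4 * M)) by (apply Rinv_0_lt_compat; lra).
  assert (L1 : e <= d) by apply Rmin_l. assert (L2 : e <= / (4 * M)) by apply Rmin_r.
  exists (fun j l => mixed f j l q0 / (INR (fact j) * INR (fact l))), e.
  split; [apply Rmin_pos; auto|].
  intros q H1 H2. set (h := fst q - fst q0) in *. set (k := snd q - snd q0) in *. cbv zeta.
  assert (Ph := Rabs_pos h). assert (Pk := Rabs_pos k).
  assert (Hm : 0 <= M * (Rabs h + Rabs k) <= / 2).
  { split; [apply Rmult_le_pos; lra|].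
    apply Rle_trans with (M * (/ (4 * M) + / (4 * M))); [apply Rmult_le_compat_l; lra|].
    right; field; lra. }
  assert (Pm : forall n, (M * (Rabs h + Rabs k)) ^ n <= (/ 2) ^ n) by (intros; apply pow_incr; auto).
  split.
  - apply ex_series_dominated with (fun n => K * (/ 2) ^ n).
    2:{ apply ex_series_Rscal, ex_series_geom. rewrite Rabs_pos_eq; lra. }
    intros n. rewrite Rabs_pos_eq by (apply cond_pos_sum; intros; apply Rabs_pos).
    apply Rle_trans with (K * (M * (Rabs h + Rabs k)) ^ n); [|apply Rmult_le_compat_l; auto].
    rewrite Rpow_mult_distr, binomial, <- Rmult_assoc, scal_sum.
    apply sum_Rle; intros j Hj.
    assert (B := mixed_bound V M K f j (n - j) q0 HM HK A Hq0).
    replace (j + (n - j))%nat with n in B by lia.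
    rewrite !Rabs_mult, !RPow_abs.
    assert (F1 := INR_fact_lt_0 j). assert (F2 := INR_fact_lt_0 (n - j)).
    unfold Rdiv; rewrite Rabs_mult, Rabs_inv, (Rabs_pos_eq (_ * _)) by (apply Rlt_le, Rmult_lt_0_compat; auto).
    replace (Binomial.C n j * Rabs (h ^ j) * Rabs (k ^ (n - j)) * (K * M ^ n)) with
      (K * (M ^ n * INR (fact n)) * / (INR (fact j) * INR (fact (n - j))) * Rabs (h ^ j) * Rabs (k ^ (n - j))).
    2:{ unfold Binomial.C; field; lra. }
    apply Rmult_le_compat_r; [apply Rabs_pos|]. apply Rmult_le_compat_r; [apply Rabs_pos|].
    apply Rmult_le_compat_r; [|exact B].
    apply Rlt_le, Rinv_0_lt_compat, Rmult_lt_0_compat; auto.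
  - apply is_series_of_remainder with K. intros n.
    assert (Seg : forall t, 0 <= t <= 1 -> V (fst q0 + t * h, snd q0 + t * k)).
    { intros t Ht; apply HV0; split; simpl.
      - replace (_ - _) with (t * h) by ring. rewrite Rabs_mult, (Rabs_pos_eq t) by lra. nra.
      - replace (_ - _) with (t * k) by ring. rewrite Rabs_mult, (Rabs_pos_eq t) by lra. nra. }
    assert (DL := Derive_n_line h k V f q0 HV Hf).
    destruct (Taylor_Lagrange (fun s => f (fst q0 + s * h, snd q0 + s * k)) n 0 1 Rlt_0_1) as [z [Hz E]].
    { intros t Ht i _. destruct i as [|i]; [exact I|]. apply (DL i t (Seg t Ht)). }
    rewrite !Rmult_1_l in E.
    replace (fst q0 + h, snd q0 + k) with q in E
      by (unfold h, k; destruct q, q0; simpl; f_equal; ring).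
    rewrite (sum_eq _ (fun j : nat => (1 - 0) ^ j / INR (fact j) *
       Derive_n (fun s : R => f (fst q0 + s * h, snd q0 + s * k)) j 0)).
    2:{ intros i _. rewrite (proj1 (DL i 0 (Seg 0 ltac:(lra)))).
        rewrite !Rmult_0_l, !Rplus_0_r, <- surjective_pairing.
        rewrite (iter_dir_deriv_binomial h k V f i HV Hf q0 Hq0).
        rewrite Rminus_0_r, pow1, scal_sum. apply sum_eq; intros j Hj.
        unfold Binomial.C. field. repeat split; apply INR_fact_neq_0. }
    rewrite E.
    replace (_ - _) with ((1 - 0) ^ S n / INR (fact (S n)) *
       Derive_n (fun s : R => f (fst q0 + s * h, snd q0 + s * k)) (S n) z) by ring.
    rewrite (proj1 (DL (S n) z (Seg z ltac:(lra)))).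
    destruct (smooth_bound_iter_dir_deriv h k (S n) 0 V _ f HV (A (S n + 0)%nat)) as [B _].
    specialize (B _ (Seg z ltac:(lra))). cbv beta in B. rewrite Nat.add_0_r in B.
    assert (F := INR_fact_lt_0 (S n)).
    rewrite Rminus_0_r, pow1, Rabs_mult, (Rabs_pos_eq (1 / _)) by (apply Rlt_le, Rdiv_lt_0_compat; lra).
    apply Rle_trans with (1 / INR (fact (S n)) * ((Rabs h + Rabs k) ^ S n * (K * (M ^ S n * INR (fact (S n)))))).
    { apply Rmult_le_compat_l; [apply Rlt_le, Rdiv_lt_0_compat; lra|].
      eapply Rle_trans; [exact B|]. apply Rmult_le_compat_l; [apply pow_le; lra|].
      apply Rmult_le_compat_l; auto; apply weight_le_fact; auto. }
    replace (1 / INR (fact (S n)) * ((Rabs h + Rabs k) ^ S n * (K * (M ^ S n * INR (fact (S n))))))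
      with (K * (M * (Rabs h + Rabs k)) ^ S n) by (rewrite Rpow_mult_distr; field; lra).
    apply Rmult_le_compat_l; auto. eapply Rle_trans; [apply Pm|].
    assert (P2 : 0 < (/ 2) ^ n) by (apply pow_lt; lra). simpl; lra.
Qed.

(** * The graph function of a surface with the null identities *)

Lemma chain_partials (V V' : R * R -> Prop) (A B G : R * R -> R) (p : R * R) :
  open V' -> V p -> V' (A p, B p) -> analytic_on V A -> analytic_on V B -> analytic_on V' G ->
  is_partials (fun z => G (A z, B z)) p
    (partial_x G (A p, B p) * partial_x A p + partial_y G (A p, B p) * partial_x B p)
    (partial_x G (A p, B p) * partial_y A p + partial_y G (A p, B p) * partial_y B p).
Proof.
  destruct p as [r s]; intros HV' Hp Hq HA HB HG.
  destruct (ex_partials_is A (r, s) (analytic_on_ex_partials V A _ Hp HA)) as [A1 A2].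
  destruct (ex_partials_is B (r, s) (analytic_on_ex_partials V B _ Hp HB)) as [B1 B2].
  split.
  - exact (analytic_on_is_derive_comp V' G (fun a => A (a, s)) (fun a => B (a, s)) r _ _ HV' HG Hq A1 B1).
  - exact (analytic_on_is_derive_comp V' G (fun b => A (r, b)) (fun b => B (r, b)) s _ _ HV' HG Hq A2 B2).
Qed.

Lemma is_partials_eq (f g : R * R -> R) (q : R * R) (l m l' m' : R) :
  locally q (fun p => f p = g p) -> is_partials f q l m -> is_partials g q l' m' -> l = l' /\ m = m'.
Proof.
  intros H Hf Hg. apply (is_partials_ext _ _ _ _ _ H) in Hf.
  destruct (is_partials_unique _ _ _ _ Hf) as [<- <-], (is_partials_unique _ _ _ _ Hg) as [<- <-]; auto.
Qed.

Definition type_discriminant (psi : R * R -> R) (q : R * R) : R :=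
  1 - partial_x psi q ^ 2 - partial_y psi q ^ 2.

Lemma analytic_on_type_discriminant (V : R * R -> Prop) (psi : R * R -> R) :
  open V -> analytic_on V psi -> analytic_on V (type_discriminant psi).
Proof.
  intros HV H.
  assert (HPx := analytic_on_partial_x V psi H). assert (HPy := analytic_on_partial_y V psi H).
  apply (analytic_on_ext V (fun z => 1 - partial_x psi z * partial_x psi z - partial_y psi z * partial_y psi z)); auto.
  - intros z _; unfold type_discriminant; ring.
  - apply analytic_on_minus; auto; [|apply analytic_on_mult; auto].
    apply (analytic_on_minus V (fun _ => 1)); auto using analytic_on_const. apply analytic_on_mult; auto.
Qed.

(** [(a, c)] and [(b, e)] stand for [R] and [T], [(p1, p2)] for [grad psi]. *)
Lemma gradient_algebra (a b c e p1 p2 s : R) :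
  a * p1 + c * p2 = 1 -> b * p1 + e * p2 = 0 ->
  a ^ 2 + c ^ 2 = 1 + 4 * s * (b ^ 2 + e ^ 2) -> a * b + c * e = 0 -> a * e - b * c <> 0 ->
  0 < a ^ 2 + c ^ 2 /\ 0 < b ^ 2 + e ^ 2 /\
  p1 = a / (a ^ 2 + c ^ 2) /\ p2 = c / (a ^ 2 + c ^ 2) /\
  1 - p1 ^ 2 - p2 ^ 2 = 4 * s * (b ^ 2 + e ^ 2) / (a ^ 2 + c ^ 2).
Proof.
  intros H1 H2 H3 H4 HJ.
  assert (N : 0 < a ^ 2 + c ^ 2).
  { destruct (Req_dec a 0) as [Ea|Ea]; [destruct (Req_dec c 0) as [Ec|Ec]|].
    - exfalso; apply HJ; rewrite Ea, Ec; ring.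
    - assert (0 < c ^ 2) by (apply pow2_gt_0; auto). assert (0 <= a ^ 2) by apply pow2_ge_0. lra.
    - assert (0 < a ^ 2) by (apply pow2_gt_0; auto). assert (0 <= c ^ 2) by apply pow2_ge_0. lra. }
  assert (M : 0 < b ^ 2 + e ^ 2).
  { destruct (Req_dec b 0) as [Ea|Ea]; [destruct (Req_dec e 0) as [Ec|Ec]|].
    - exfalso; apply HJ; rewrite Ea, Ec; ring.
    - assert (0 < e ^ 2) by (apply pow2_gt_0; auto). assert (0 <= b ^ 2) by apply pow2_ge_0. lra.
    - assert (0 < b ^ 2) by (apply pow2_gt_0; auto). assert (0 <= e ^ 2) by apply pow2_ge_0. lra. }
  (* [grad psi] and [R] are both orthogonal to the nonzero vector [T], hence parallel. *)
  assert (Z : p1 * c - p2 * a = 0).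
  { apply Rmult_eq_reg_l with (b ^ 2 + e ^ 2); [|lra].
    replace ((b ^ 2 + e ^ 2) * (p1 * c - p2 * a)) with
      (b * (c * (b * p1 + e * p2) - p2 * (a * b + c * e)) + e * (p1 * (a * b + c * e) - a * (b * p1 + e * p2))) by ring.
    rewrite H2, H4; ring. }
  assert (E1 : p1 = a / (a ^ 2 + c ^ 2)).
  { apply Rmult_eq_reg_r with (a ^ 2 + c ^ 2); [|lra].
    replace (p1 * (a ^ 2 + c ^ 2)) with (a * (a * p1 + c * p2) + c * (p1 * c - p2 * a)) by ring.
    rewrite H1, Z; field; lra. }
  assert (E2 : p2 = c / (a ^ 2 + c ^ 2)).
  { apply Rmult_eq_reg_r with (a ^ 2 + c ^ 2); [|lra].
    replace (p2 * (a ^ 2 + c ^ 2)) with (c * (a * p1 + c * p2) - a * (p1 * c - p2 * a)) by ring.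
    rewrite H1, Z; field; lra. }
  repeat split; auto.
  rewrite E1, E2.
  apply Rmult_eq_reg_r with (a ^ 2 + c ^ 2); [|lra].
  replace (4 * s * (b ^ 2 + e ^ 2) / (a ^ 2 + c ^ 2) * (a ^ 2 + c ^ 2)) with (4 * s * (b ^ 2 + e ^ 2)) by (field; lra).
  replace (4 * s * (b ^ 2 + e ^ 2)) with (a ^ 2 + c ^ 2 - 1) by lra. field; lra.
Qed.

(** In the orthogonal frame [R = (a, c)], [T = (b, e)] the equation reads
    [Hess(R, R) + 4 s Hess(T, T) = 0]. *)
Lemma stream_algebra (a b c e p1 p2 s h11 h12 h22 R1 R2 M1 M2 T1 T2 : R) :
  a * p1 + c * p2 = 1 -> b * p1 + e * p2 = 0 ->
  a ^ 2 + c ^ 2 = 1 + 4 * s * (b ^ 2 + e ^ 2) -> a * b + c * e = 0 -> a * e - b * c <> 0 ->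
  (h11 * a + h12 * c) * a + (h12 * a + h22 * c) * c + (p1 * R1 + p2 * R2) = 0 ->
  (h11 * b + h12 * e) * b + (h12 * b + h22 * e) * e + (p1 * T1 + p2 * T2) = 0 ->
  a * R1 + c * R2 = 4 * s * (b * M1 + e * M2) ->
  M1 * b + M2 * e + (a * T1 + c * T2) = 0 ->
  (1 - p2 ^ 2) * h11 + 2 * p1 * p2 * h12 + (1 - p1 ^ 2) * h22 = 0.
Proof.
  intros H1 H2 H3 H4 HJ HR HT HE HF.
  (* [(R1, R2)], [(M1, M2)], [(T1, T2)] are the [rr], [rs], [ss] derivatives of [(A, B)]. [HR] and
     [HT] are second derivatives of [psi(A, B) = r]; [HE] is the [r]-derivative of the first null
     identity and [HF] the [s]-derivative of the second. *)
  destruct (gradient_algebra a b c e p1 p2 s H1 H2 H3 H4 HJ) as (N & M & E1 & E2 & _).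
  set (n := a ^ 2 + c ^ 2) in *.
  (* [T] is [R] turned by a right angle and scaled by [l]. *)
  set (l := (a * e - b * c) / n).
  assert (Eb : b = - l * c).
  { unfold l. apply Rmult_eq_reg_r with n; [|lra].
    replace (- ((a * e - b * c) / n) * c * n) with (b * c ^ 2 - (a * b + c * e) * a + a ^ 2 * b) by (field; lra).
    rewrite H4; unfold n; ring. }
  assert (Ee : e = l * a).
  { unfold l. apply Rmult_eq_reg_r with n; [|lra].
    replace ((a * e - b * c) / n * a * n) with (a ^ 2 * e - (a * b + c * e) * c + c ^ 2 * e) by (field; lra).
    rewrite H4; unfold n; ring. }
  assert (El : 4 * s * l ^ 2 * n = n - 1).
  { clearbody l. replace (n - 1) with (4 * s * (b ^ 2 + e ^ 2)) by lra. rewrite Eb, Ee. unfold n; ring. }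
  clearbody l.
  assert (l0 : l <> 0).
  { intros Z. apply HJ. rewrite Eb, Ee, Z; ring. }
  assert (HR' : n * (h11 * a ^ 2 + 2 * h12 * a * c + h22 * c ^ 2) = - (a * R1 + c * R2)).
  { apply Rmult_eq_reg_r with (/ n); [|apply Rinv_neq_0_compat; lra].
    replace (n * (h11 * a ^ 2 + 2 * h12 * a * c + h22 * c ^ 2) * / n)
      with ((h11 * a + h12 * c) * a + (h12 * a + h22 * c) * c) by (field; lra).
    replace (- (a * R1 + c * R2) * / n) with (- (p1 * R1 + p2 * R2)) by (rewrite E1, E2; field; lra). lra. }
  assert (HT' : n * l ^ 2 * (h11 * c ^ 2 - 2 * h12 * a * c + h22 * a ^ 2) = - (a * T1 + c * T2)).
  { apply Rmult_eq_reg_r with (/ n); [|apply Rinv_neq_0_compat; lra].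
    replace (n * l ^ 2 * (h11 * c ^ 2 - 2 * h12 * a * c + h22 * a ^ 2) * / n)
      with ((h11 * b + h12 * e) * b + (h12 * b + h22 * e) * e) by (rewrite Eb, Ee; field; lra).
    replace (- (a * T1 + c * T2) * / n) with (- (p1 * T1 + p2 * T2)) by (rewrite E1, E2; field; lra). lra. }
  apply Rmult_eq_reg_r with (n ^ 2); [|apply pow_nonzero; lra].
  rewrite E1, E2.
  replace (((1 - (c / n) ^ 2) * h11 + 2 * (a / n) * (c / n) * h12 + (1 - (a / n) ^ 2) * h22) * n ^ 2)
    with ((n ^ 2 - c ^ 2) * h11 + 2 * a * c * h12 + (n ^ 2 - a ^ 2) * h22) by (field; lra).
  (* The operator is [n Hess(R, R) + (n - 1) Hess(R', R')] with [R'] the rotated [R];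
     [n - 1 = 4 s l^2 n] turns the second term into a multiple of [Hess(T, T)]. *)
  replace ((n ^ 2 - c ^ 2) * h11 + 2 * a * c * h12 + (n ^ 2 - a ^ 2) * h22)
    with (n * (h11 * a ^ 2 + 2 * h12 * a * c + h22 * c ^ 2)
          + (n - 1) * (h11 * c ^ 2 - 2 * h12 * a * c + h22 * a ^ 2)) by (unfold n; ring).
  rewrite <- El, HR'.
  replace (4 * s * l ^ 2 * n * (h11 * c ^ 2 - 2 * h12 * a * c + h22 * a ^ 2))
    with (4 * s * (n * l ^ 2 * (h11 * c ^ 2 - 2 * h12 * a * c + h22 * a ^ 2))) by ring.
  rewrite HT', HE. replace (a * T1 + c * T2) with (- (M1 * b + M2 * e)) by lra. ring.
Qed.

Lemma graph_gradient (V V' W : R * R -> Prop) (A B psi : R * R -> R) (p : R * R) :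
  open V' -> open W -> V p -> W p -> V' (A p, B p) ->
  analytic_on V A -> analytic_on V B -> analytic_on V' psi ->
  (forall z, W z -> psi (A z, B z) = fst z) ->
  partial_x A p * partial_x psi (A p, B p) + partial_x B p * partial_y psi (A p, B p) = 1 /\
  partial_y A p * partial_x psi (A p, B p) + partial_y B p * partial_y psi (A p, B p) = 0.
Proof.
  intros HV' HW Vp Wp Vq HA HB Hpsi H.
  destruct (is_partials_eq (fun z => psi (A z, B z)) fst p _ _ _ _
    ltac:(generalize (HW p Wp); apply filter_imp; exact H)
    (chain_partials V V' A B psi p HV' Vp Vq HA HB Hpsi) (is_partials_fst p)) as [E1 E2].
  split; [rewrite <- E1|rewrite <- E2]; ring.
Qed.

(** [A] and [B] are controlled on [V], [psi] on [V'], and [psi(A, B) = r] holds on [W]; the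
    identities are differentiated where all three conditions hold, which is a neighbourhood of
    [p]. *)
Lemma graph_stream_equation (V V' W : R * R -> Prop) (A B psi : R * R -> R) (p : R * R) :
  open V -> open V' -> open W -> V p -> W p -> V' (A p, B p) ->
  analytic_on V A -> analytic_on V B -> analytic_on V' psi ->
  (forall z, W z -> psi (A z, B z) = fst z) ->
  (forall z, V z -> null_identities A B z /\ jacobian A B z <> 0) ->
  stream_equation 1 psi (A p, B p).
Proof.
  intros HV HV' HW Vp Wp Vq HA HB Hpsi H HN.
  set (q := (A p, B p)) in *.
  assert (CA := analytic_on_continuous V A p HV Vp HA).
  assert (CB := analytic_on_continuous V B p HV Vp HB).
  assert (LV' : locally p (fun z => V' (A z, B z))).
  { specialize (HV' q Vq). apply locally_rect in HV'. destruct HV' as [d [Hd HV']].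
    rewrite continuous_rect in CA, CB.
    destruct (CA d Hd) as [d1 [Hd1 K1]], (CB d Hd) as [d2 [Hd2 K2]].
    apply locally_rect. exists (Rmin d1 d2); split; [apply Rmin_pos; auto|].
    intros z Hz; apply HV'; split; simpl.
    - apply K1; revert Hz; apply rect_le, Rmin_l.
    - apply K2; revert Hz; apply rect_le, Rmin_r. }
  assert (L : locally p (fun z => V z /\ W z /\ V' (A z, B z))).
  { apply filter_and; [exact (HV p Vp)|apply filter_and; [exact (HW p Wp)|exact LV']]. }
  assert (G : forall z, V z /\ W z /\ V' (A z, B z) ->
     partial_x A z * partial_x psi (A z, B z) + partial_x B z * partial_y psi (A z, B z) = 1 /\
     partial_y A z * partial_x psi (A z, B z) + partial_y B z * partial_y psi (A z, B z) = 0).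
  { intros z (Z1 & Z2 & Z3). exact (graph_gradient V V' W A B psi z HV' HW Z1 Z2 Z3 HA HB Hpsi H). }
  assert (DA := fun f (Hf : analytic_on V f) => ex_partials_is f p (analytic_on_ex_partials V f p Vp Hf)).
  assert (HAx := analytic_on_partial_x V A HA). assert (HAy := analytic_on_partial_y V A HA).
  assert (HBx := analytic_on_partial_x V B HB). assert (HBy := analytic_on_partial_y V B HB).
  assert (Px := chain_partials V V' A B _ p HV' Vp Vq HA HB (analytic_on_partial_x V' psi Hpsi)).
  assert (Py := chain_partials V V' A B _ p HV' Vp Vq HA HB (analytic_on_partial_y V' psi Hpsi)).
  assert (Mx := analytic_on_mixed_partials V' psi q HV' Vq Hpsi).
  assert (MA := analytic_on_mixed_partials V A p HV Vp HA).
  assert (MB := analytic_on_mixed_partials V B p HV Vp HB).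
  fold q in Px, Py. rewrite Mx in Py.
  destruct (is_partials_eq
    (fun z => partial_x A z * partial_x psi (A z, B z) + partial_x B z * partial_y psi (A z, B z))
    (fun _ => 1) p _ _ _ _ ltac:(revert L; apply filter_imp; intros z Hz; apply (G z Hz))
    (is_partials_plus _ _ _ _ _ _ _ (is_partials_mult _ _ _ _ _ _ _ (DA _ HAx) Px)
       (is_partials_mult _ _ _ _ _ _ _ (DA _ HBx) Py)) (is_partials_const 1 p)) as [ER _].
  destruct (is_partials_eq
    (fun z => partial_y A z * partial_x psi (A z, B z) + partial_y B z * partial_y psi (A z, B z))
    (fun _ => 0) p _ _ _ _ ltac:(revert L; apply filter_imp; intros z Hz; apply (G z Hz))
    (is_partials_plus _ _ _ _ _ _ _ (is_partials_mult _ _ _ _ _ _ _ (DA _ HAy) Px)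
       (is_partials_mult _ _ _ _ _ _ _ (DA _ HBy) Py)) (is_partials_const 0 p)) as [_ ET].
  assert (LN : locally p (fun z => null_identities A B z)).
  { generalize (HV p Vp); apply filter_imp; intros z Hz; apply (HN z Hz). }
  destruct (is_partials_eq
    (fun z => partial_x A z * partial_x A z + partial_x B z * partial_x B z)
    (fun z => 1 + 4 * snd z * (partial_y A z * partial_y A z + partial_y B z * partial_y B z)) p _ _ _ _
    ltac:(revert LN; apply filter_imp; intros z [Hz _]; simpl in Hz; rewrite !Rmult_1_r in Hz; exact Hz)
    (is_partials_plus _ _ _ _ _ _ _ (is_partials_mult _ _ _ _ _ _ _ (DA _ HAx) (DA _ HAx))
       (is_partials_mult _ _ _ _ _ _ _ (DA _ HBx) (DA _ HBx)))
    (is_partials_plus _ _ _ _ _ _ _ (is_partials_const 1 p)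
      (is_partials_mult _ _ _ _ _ _ _ (is_partials_mult _ _ _ _ _ _ _ (is_partials_const 4 p) (is_partials_snd p))
        (is_partials_plus _ _ _ _ _ _ _ (is_partials_mult _ _ _ _ _ _ _ (DA _ HAy) (DA _ HAy))
       (is_partials_mult _ _ _ _ _ _ _ (DA _ HBy) (DA _ HBy)))))) as [EE _].
  destruct (is_partials_eq
    (fun z => partial_x A z * partial_y A z + partial_x B z * partial_y B z)
    (fun _ => 0) p _ _ _ _
    ltac:(revert LN; apply filter_imp; intros z [_ Hz]; exact Hz)
    (is_partials_plus _ _ _ _ _ _ _ (is_partials_mult _ _ _ _ _ _ _ (DA _ HAx) (DA _ HAy))
       (is_partials_mult _ _ _ _ _ _ _ (DA _ HBx) (DA _ HBy))) (is_partials_const 0 p)) as [_ EF].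
  destruct (G p (conj Vp (conj Wp Vq))) as [G1 G2]. destruct (HN p Vp) as [[N1 N2] NJ].
  fold q in G1, G2, ER, ET. unfold jacobian in NJ. unfold stream_equation.
  rewrite <- MA, <- MB in EF.
  eapply (stream_algebra (partial_x A p) (partial_y A p) (partial_x B p) (partial_y B p) _ _ (snd p) _ _ _
    (partial_x (partial_x A) p) (partial_x (partial_x B) p) (partial_x (partial_y A) p) (partial_x (partial_y B) p)
    (partial_y (partial_y A) p) (partial_y (partial_y B) p)); try eassumption; try lra.
Qed.

(** * The flow *)

Lemma continuous_Rmult_at (f g : R * R -> R) (q : R * R) :
  continuous f q -> continuous g q -> continuous (fun p => f p * g p) q.
Proof. exact (continuous_mult (K := R_AbsRing) f g q). Qed.

Lemma continuous_Rplus_at (f g : R * R -> R) (q : R * R) :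
  continuous f q -> continuous g q -> continuous (fun p => f p + g p) q.
Proof. exact (continuous_plus (K := R_AbsRing) (V := R_NormedModule) f g q). Qed.

Lemma C1_at_intro (f fx fy : R * R -> R) (q : R * R) :
  locally q (fun p => is_partials f p (fx p) (fy p)) -> continuous fx q -> continuous fy q ->
  C1_at f q.
Proof.
  intros H Cx Cy. split; [|split].
  - revert H; apply filter_imp; intros p Hp; exact (is_partials_ex _ _ _ _ Hp).
  - apply (continuous_ext_loc _ fx); auto. revert H; apply filter_imp; intros p Hp.
    symmetry; apply (is_partials_unique _ _ _ _ Hp).
  - apply (continuous_ext_loc _ fy); auto. revert H; apply filter_imp; intros p Hp.
    symmetry; apply (is_partials_unique _ _ _ _ Hp).
Qed.

Lemma C1_at_continuous (f : R * R -> R) (q : R * R) : C1_at f q -> continuous f q.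
Proof.
  intros H. apply continuous_rect; intros e He.
  destruct (strict_differential f q 1 H Rlt_0_1) as [d [Hd K]].
  set (a := Rabs (partial_x f q)). set (b := Rabs (partial_y f q)).
  assert (Pa : 0 <= a) by apply Rabs_pos. assert (Pb : 0 <= b) by apply Rabs_pos.
  set (e' := e / (a + b + 2)). assert (Pe : 0 < e') by (apply Rdiv_lt_0_compat; lra).
  exists (Rmin d e'); split; [apply Rmin_pos; auto|]. intros p Hp.
  specialize (K q p (rect_center _ _ Hd) (rect_le _ _ _ _ (Rmin_l _ _) Hp)). unfold dist1 in K.
  destruct (rect_le _ _ _ _ (Rmin_r _ _) Hp) as [H1 H2].
  set (x := fst p - fst q) in *. set (y := snd p - snd q) in *.
  replace (f p - f q) with ((f p - f q - (partial_x f q * x + partial_y f q * y))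
     + (partial_x f q * x + partial_y f q * y)) by ring.
  assert (T1 := Rabs_triang (f p - f q - (partial_x f q * x + partial_y f q * y))
     (partial_x f q * x + partial_y f q * y)).
  assert (T2 := Rabs_triang (partial_x f q * x) (partial_y f q * y)).
  rewrite !Rabs_mult in T2. fold a b in T2.
  assert (Px := Rabs_pos x). assert (Py := Rabs_pos y).
  replace e with ((a + b + 2) * e') by (unfold e'; field; lra). nra.
Qed.

Lemma C1_at_is_partials (f : R * R -> R) (q : R * R) : C1_at f q ->
  locally q (fun p => is_partials f p (partial_x f p) (partial_y f p)).
Proof. intros [H _]; revert H; apply filter_imp; intros p Hp; apply ex_partials_is, Hp. Qed.

Lemma C1_at_mult (f g : R * R -> R) (q : R * R) : C1_at f q -> C1_at g q -> C1_at (fun p => f p * g p) q.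
Proof.
  intros Hf Hg. pose proof Hf as (_ & Fx & Fy). pose proof Hg as (_ & Gx & Gy).
  assert (Cf := C1_at_continuous f q Hf). assert (Cg := C1_at_continuous g q Hg).
  apply (C1_at_intro _ (fun p => partial_x f p * g p + f p * partial_x g p)
                       (fun p => partial_y f p * g p + f p * partial_y g p)).
  - generalize (filter_and _ _ (C1_at_is_partials f q Hf) (C1_at_is_partials g q Hg)).
    apply filter_imp; intros p [H1 H2]; apply is_partials_mult; auto.
  - apply (continuous_Rplus_at (fun p => partial_x f p * g p)); apply continuous_Rmult_at; auto.
  - apply (continuous_Rplus_at (fun p => partial_y f p * g p)); apply continuous_Rmult_at; auto.
Qed.

Lemma C1_at_comp (f : R * R -> R) (k k' : R -> R) (q : R * R) : C1_at f q ->
  locally (f q) (fun z => is_derive k z (k' z)) -> continuous k' (f q) -> C1_at (fun p => k (f p)) q.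
Proof.
  intros Hf Hk Ck. pose proof Hf as (_ & Fx & Fy).
  assert (Cf := C1_at_continuous f q Hf).
  assert (Ckf : continuous (fun p => k' (f p)) q) by (apply (continuous_comp f k'); auto).
  apply (C1_at_intro _ (fun p => k' (f p) * partial_x f p) (fun p => k' (f p) * partial_y f p)).
  - generalize (filter_and _ _ (C1_at_is_partials f q Hf) (Cf _ Hk)).
    apply filter_imp; intros p [H1 H2]; apply is_partials_comp; auto.
  - apply continuous_Rmult_at; auto.
  - apply continuous_Rmult_at; auto.
Qed.

(** Dividing the value itself by [2 z] gives one formula for both signs of [z], so the flow
    equations need no split into subsonic and supersonic points. *)
Lemma is_derive_sqrt_abs (k z : R) : z <> 0 ->
  is_derive (fun w => k * sqrt (Rabs w)) z (k * sqrt (Rabs z) / (2 * z)).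
Proof.
  intros Hz. apply is_derive_Reals.
  assert (P : 0 < Rabs z) by (apply Rabs_pos_lt; auto).
  assert (S : 0 < sqrt (Rabs z)) by (apply sqrt_lt_R0; auto).
  assert (SS : sqrt (Rabs z) * sqrt (Rabs z) = Rabs z) by (apply sqrt_sqrt; lra).
  apply is_derive_Reals. destruct (Rdichotomy _ _ Hz) as [N|N].
  - rewrite Rabs_left in * by auto.
    apply is_derive_ext_loc with (fun w => k * sqrt (- w)).
    { exists (mkposreal (- z) ltac:(lra)); intros w Hw.
      apply ball_Rabs in Hw; simpl in Hw.
      apply Rabs_lt_between in Hw. rewrite Rabs_left; auto. lra. }
    auto_derive; [lra|]. replace z with (- (sqrt (- z) * sqrt (- z))) at 3 by lra. field; lra.
  - rewrite Rabs_right in * by lra.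
    apply is_derive_ext_loc with (fun w => k * sqrt w).
    { exists (mkposreal z N); intros w Hw.
      apply ball_Rabs in Hw; simpl in Hw.
      apply Rabs_lt_between in Hw. rewrite Rabs_right; auto. lra. }
    auto_derive; [lra|]. replace z with (sqrt z * sqrt z) at 3 by lra. field; lra.
Qed.

Lemma is_derive_inv_sqrt_abs (k z : R) : 0 < k -> z <> 0 ->
  is_derive (fun w => 1 / (k * sqrt (Rabs w))) z (- (1 / (k * sqrt (Rabs z))) / (2 * z)).
Proof.
  intros Hk Hz.
  assert (P : 0 < sqrt (Rabs z)) by (apply sqrt_lt_R0, Rabs_pos_lt; auto).
  apply (is_derive_ext (fun w => / (k * sqrt (Rabs w)))); [intros w; unfold Rdiv; rewrite Rmult_1_l; reflexivity|].
  replace (- (1 / (k * sqrt (Rabs z))) / (2 * z))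
    with (- (k * sqrt (Rabs z) / (2 * z)) / (k * sqrt (Rabs z)) ^ 2) by (field; lra).
  apply (is_derive_inv (fun w => k * sqrt (Rabs w))); [apply is_derive_sqrt_abs; auto|].
  apply Rgt_not_eq, Rmult_lt_0_compat; auto.
Qed.

Lemma locally_neq_0 (z : R) : z <> 0 -> locally z (fun w => w <> 0).
Proof.
  intros Hz. exists (mkposreal _ (Rabs_pos_lt z Hz)); intros w Hw E; subst w.
  apply ball_Rabs in Hw; simpl in Hw.
  rewrite Rminus_0_l, Rabs_Ropp in Hw; lra.
Qed.

(** [d] is the type discriminant, [w = 1 / rho] and [w' = - w / (2 d)] its derivative in [d]. *)
Lemma euler_algebra (p1 p2 h11 h12 h22 d w r : R) :
  d = 1 - p1 ^ 2 - p2 ^ 2 -> d <> 0 -> r * w = 1 ->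
  (1 - p2 ^ 2) * h11 + 2 * p1 * p2 * h12 + (1 - p1 ^ 2) * h22 = 0 ->
  let d1 := - 2 * (p1 * h11 + p2 * h12) in
  let d2 := - 2 * (p1 * h12 + p2 * h22) in
  let w' := - w / (2 * d) in
  let u := w * p2 in let v := w * - p1 in
  let u1 := w' * d1 * p2 + w * h12 in let u2 := w' * d2 * p2 + w * h22 in
  let v1 := w' * d1 * - p1 + w * - h11 in let v2 := w' * d2 * - p1 + w * - h12 in
  v1 - u2 = 0 /\ r * (u * u1 + v * u2) = w' * d1 /\ r * (u * v1 + v * v2) = w' * d2.
Proof.
  intros Ed Hd Hr Hs; cbv zeta.
  (* The vorticity is [- w / d] times the left-hand side of the stream equation, because
     [d + p1^2 = 1 - p2^2] and [d + p2^2 = 1 - p1^2]. *)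
  assert (V : - w / (2 * d) * (- 2 * (p1 * h11 + p2 * h12)) * - p1 + w * - h11 -
     (- w / (2 * d) * (- 2 * (p1 * h12 + p2 * h22)) * p2 + w * h22) = 0).
  { replace (_ - _) with (- w / d * (h11 * (d + p1 ^ 2) + 2 * p1 * p2 * h12 + h22 * (d + p2 ^ 2))) by (field; auto).
    replace (h11 * (d + p1 ^ 2) + 2 * p1 * p2 * h12 + h22 * (d + p2 ^ 2)) with
      ((1 - p2 ^ 2) * h11 + 2 * p1 * p2 * h12 + (1 - p1 ^ 2) * h22) by (rewrite Ed; ring).
    rewrite Hs; field; auto. }
  split; [exact V|].
  (* Bernoulli's law: without vorticity the convective term is the gradient of
     [(u^2 + v^2) / 2 = w^2 (1 - d) / 2]. Its derivative in [d] is [w w'], and multiplying by [r]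
     with [r w = 1] leaves [w'], the derivative of [- p]. *)
  apply Rminus_diag_uniq in V. split.
  - rewrite <- V.
    replace (r * _) with (r * w * (w / d * ((p1 * h11 + p2 * h12) * (p1 ^ 2 + p2 ^ 2 + d)))) by (field; auto).
    rewrite Hr, Ed. field. rewrite <- Ed; auto.
  - rewrite V.
    replace (r * _) with (r * w * (w / d * ((p1 * h12 + p2 * h22) * (p1 ^ 2 + p2 ^ 2 + d)))) by (field; auto).
    rewrite Hr, Ed. field. rewrite <- Ed; auto.
Qed.

Lemma is_derive_pressure (p0 d : R) : d <> 0 -> is_derive (pressure p0) d (1 / d ^ 2).
Proof. intros Hd; unfold pressure; auto_derive; auto. field; auto. Qed.

Lemma density_pos (rho0 : R) (psi : R * R -> R) (q : R * R) : 0 < rho0 ->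
  type_discriminant psi q <> 0 -> 0 < density rho0 psi q.
Proof.
  intros H0 H; apply Rmult_lt_0_compat; auto. apply sqrt_lt_R0, Rabs_pos_lt, H.
Qed.

Lemma sound_speed_pressure (p0 : R) (rho : R * R -> R) (q : R * R) : 0 < rho q ->
  sound_speed (pressure p0) rho q = 1 / rho q.
Proof.
  intros H. unfold sound_speed.
  rewrite (is_derive_unique _ _ _ (is_derive_pressure p0 (rho q) ltac:(lra))).
  replace (1 / rho q ^ 2) with ((1 / rho q) ^ 2) by (field; lra).
  apply sqrt_pow2, Rlt_le, Rdiv_lt_0_compat; lra.
Qed.

(** Stated for a single point because derivative bounds for [psi] are available only near each point
    separately. *)
Lemma flow_at (V : R * R -> Prop) (psi : R * R -> R) (q : R * R) (p0 rho0 : R) :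
  0 < rho0 -> open V -> V q -> analytic_on V psi -> type_discriminant psi q <> 0 ->
  stream_equation 1 psi q ->
  let rho := density rho0 psi in
  steady_flow (fun q' => q' = q) (pressure p0)
    (fun q' => 1 / rho q' * partial_y psi q') (fun q' => 1 / rho q' * (- partial_x psi q')) rho.
Proof.
  intros Hr0 HV Vq Hpsi Hd Hs rho q' ->.
  set (d := type_discriminant psi) in *.
  assert (HPx := analytic_on_partial_x V psi Hpsi). assert (HPy := analytic_on_partial_y V psi Hpsi).
  assert (Hdis := analytic_on_type_discriminant V psi HV Hpsi). fold d in Hdis.
  assert (C1d := analytic_on_C1_at V d q HV Vq Hdis).
  set (w := fun z => 1 / rho z).
  assert (Cinv : continuous (fun z : R => / (2 * z)) (d q)).
  { apply (continuous_Rinv_comp (fun z => 2 * z)); [|lra].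
    apply (continuous_scal_r (K := R_AbsRing) (V := R_NormedModule) 2), continuous_id. }
  assert (Csq : continuous (fun z => rho0 * sqrt (Rabs z)) (d q)).
  { apply (ex_derive_continuous (K := R_AbsRing) (V := R_NormedModule)).
    eexists; apply is_derive_sqrt_abs; auto. }
  assert (Cisq : continuous (fun z => 1 / (rho0 * sqrt (Rabs z))) (d q)).
  { apply (ex_derive_continuous (K := R_AbsRing) (V := R_NormedModule)).
    eexists; apply is_derive_inv_sqrt_abs; auto. }
  assert (C1rho : C1_at rho q).
  { apply (C1_at_comp d (fun z => rho0 * sqrt (Rabs z)) (fun z => rho0 * sqrt (Rabs z) / (2 * z))); auto.
    - generalize (locally_neq_0 _ Hd); apply filter_imp; intros z Hz; apply is_derive_sqrt_abs; auto.
    - apply (continuous_mult (K := R_AbsRing) (fun z => rho0 * sqrt (Rabs z)) (fun z => / (2 * z))); auto. }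
  assert (C1w : C1_at w q).
  { apply (C1_at_comp d (fun z => 1 / (rho0 * sqrt (Rabs z))) (fun z => - (1 / (rho0 * sqrt (Rabs z))) / (2 * z))); auto.
    - generalize (locally_neq_0 _ Hd); apply filter_imp; intros z Hz; apply is_derive_inv_sqrt_abs; auto.
    - apply (continuous_mult (K := R_AbsRing) (fun z => - (1 / (rho0 * sqrt (Rabs z)))) (fun z => / (2 * z))); auto.
      apply (continuous_opp (K := R_AbsRing) (V := R_NormedModule)); auto. }
  assert (HNx : analytic_on V (fun z => - partial_x psi z)).
  { apply (analytic_on_ext V (fun z => -1 * partial_x psi z)); auto; [intros; ring|].
    apply (analytic_on_mult V (fun _ => -1)); auto using analytic_on_const. }
  assert (Prho := density_pos rho0 psi q Hr0 Hd). fold rho in Prho.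
  assert (DP := is_derive_pressure p0 (rho q) ltac:(lra)).
  assert (DPx := ex_partials_is _ _ (analytic_on_ex_partials V _ q Vq HPx)).
  assert (DPy := ex_partials_is _ _ (analytic_on_ex_partials V _ q Vq HPy)).
  assert (Mx := analytic_on_mixed_partials V psi q HV Vq Hpsi).
  rewrite Mx in DPy.
  set (h11 := partial_x (partial_x psi) q) in *. set (h12 := partial_y (partial_x psi) q) in *.
  set (h22 := partial_y (partial_y psi) q) in *.
  set (p1 := partial_x psi q) in *. set (p2 := partial_y psi q) in *.
  assert (Dd : is_partials d q (-2 * (p1 * h11 + p2 * h12)) (-2 * (p1 * h12 + p2 * h22))).
  { apply (is_partials_ext (fun z => 1 + (-1 * (partial_x psi z * partial_x psi z) + -1 * (partial_y psi z * partial_y psi z)))).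
    { apply filter_forall; intros z; unfold d, type_discriminant; ring. }
    replace (-2 * (p1 * h11 + p2 * h12)) with (0 + ((0 * (p1 * p1) + -1 * (h11 * p1 + p1 * h11)) + (0 * (p2 * p2) + -1 * (h12 * p2 + p2 * h12)))) by ring.
    replace (-2 * (p1 * h12 + p2 * h22)) with (0 + ((0 * (p1 * p1) + -1 * (h12 * p1 + p1 * h12)) + (0 * (p2 * p2) + -1 * (h22 * p2 + p2 * h22)))) by ring.
    apply (is_partials_plus (fun _ => 1)); [apply is_partials_const|].
    apply is_partials_plus.
    - apply (is_partials_mult (fun _ => -1)); [apply is_partials_const|apply is_partials_mult; auto].
    - apply (is_partials_mult (fun _ => -1)); [apply is_partials_const|apply is_partials_mult; auto]. }
  assert (Dw : is_partials w q (- w q / (2 * d q) * (-2 * (p1 * h11 + p2 * h12)))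
     (- w q / (2 * d q) * (-2 * (p1 * h12 + p2 * h22))))
    by exact (is_partials_comp d (fun z => 1 / (rho0 * sqrt (Rabs z))) q _ _ _ Dd
     (is_derive_inv_sqrt_abs rho0 (d q) Hr0 Hd)).
  assert (DNx : is_partials (fun z => - partial_x psi z) q (- h11) (- h12)).
  { destruct DPx as [X1 X2]; split; [exact (is_derive_opp _ _ _ X1)|exact (is_derive_opp _ _ _ X2)]. }
  assert (Du := is_partials_mult _ _ _ _ _ _ _ Dw DPy).
  assert (Dv := is_partials_mult _ _ _ _ _ _ _ Dw DNx).
  destruct (is_partials_unique _ _ _ _ Du) as [U1 U2], (is_partials_unique _ _ _ _ Dv) as [V1 V2].
  assert (Hrw : rho q * w q = 1) by (unfold w; field; lra).
  destruct (euler_algebra p1 p2 h11 h12 h22 (d q) (w q) (rho q) eq_refl Hd Hrw Hs) as (E1 & E2 & E3).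
  assert (DQ : is_partials (fun z => pressure p0 (rho z)) q
     (- (- w q / (2 * d q) * (-2 * (p1 * h11 + p2 * h12)))) (- (- w q / (2 * d q) * (-2 * (p1 * h12 + p2 * h22))))).
  { apply (is_partials_ext (fun z => p0 + - 1 * w z)).
    { apply filter_forall; intros z; unfold pressure, w; ring. }
    replace (- (- w q / (2 * d q) * (-2 * (p1 * h11 + p2 * h12)))) with
      (0 + (0 * w q + -1 * (- w q / (2 * d q) * (-2 * (p1 * h11 + p2 * h12))))) by ring.
    replace (- (- w q / (2 * d q) * (-2 * (p1 * h12 + p2 * h22)))) with
      (0 + (0 * w q + -1 * (- w q / (2 * d q) * (-2 * (p1 * h12 + p2 * h22))))) by ring.
    apply (is_partials_plus (fun _ => p0)); [apply is_partials_const|].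
    apply (is_partials_mult (fun _ => -1)); [apply is_partials_const|exact Dw]. }
  destruct (is_partials_unique _ _ _ _ DQ) as [Q1 Q2].
  assert (Lr : locally q (fun z => rho z <> 0)).
  { exact (C1_at_continuous rho q C1rho _ (locally_neq_0 _ (Rgt_not_eq _ _ Prho))). }
  assert (F1 : partial_x (fun z => rho z * (1 / rho z * partial_y psi z)) q = h12).
  { assert (L : locally q (fun z => rho z * (1 / rho z * partial_y psi z) = partial_y psi z))
      by (revert Lr; apply filter_imp; intros z Hz; field; exact Hz).
    rewrite <- Mx; exact (proj1 (partial_ext (fun z => rho z * (1 / rho z * partial_y psi z)) (partial_y psi) q L)). }
  assert (F2 : partial_y (fun z => rho z * (1 / rho z * - partial_x psi z)) q = - h12).
  { assert (L : locally q (fun z => rho z * (1 / rho z * - partial_x psi z) = - partial_x psi z))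
      by (revert Lr; apply filter_imp; intros z Hz; field; exact Hz).
    rewrite <- (proj2 (is_partials_unique _ _ _ _ DNx)).
    exact (proj2 (partial_ext (fun z => rho z * (1 / rho z * - partial_x psi z)) (fun z => - partial_x psi z) q L)). }
  split; [exact (C1_at_mult w (partial_y psi) q C1w (analytic_on_C1_at V _ q HV Vq HPy))|].
  split; [exact (C1_at_mult w (fun z => - partial_x psi z) q C1w (analytic_on_C1_at V _ q HV Vq HNx))|].
  split; [exact C1rho|]. split; [exact Prho|]. split; [eexists; exact DP|].
  split; [rewrite (is_derive_unique _ _ _ DP); apply Rdiv_lt_0_compat; [lra|apply pow_lt; lra]|].
  change (fun q' : R * R => 1 / rho q' * partial_y psi q') with (fun p => w p * partial_y psi p).
  change (fun q' : R * R => 1 / rho q' * - partial_x psi q') with (fun p => w p * - partial_x psi p).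
  split; [rewrite F1, F2; ring|].
  rewrite U1, U2, V1, V2, Q1, Q2. fold (w q). fold p1 p2. rewrite !Ropp_involutive.
  split; [exact E2|]. split; [exact E3|exact E1].
Qed.

(** * Graphs of the surface *)

Lemma real_point_inj (r t : R) (z q : R * R) : real_point r z = real_point t q -> r = t /\ z = q.
Proof.
  unfold real_point; intros E. injection E as E1 E2 E3.
  destruct z, q; simpl in *; subst; auto.
Qed.

(** [W] is a square on which [(A, B)] is injective, and [U] is its image; [U] is open because a
    local inverse with values in [W] exists at every point of [W]. *)
Lemma graph_exists (J : R -> Prop) (D : C -> Prop) (X Y : C -> C) (x y : R -> R) (t d : R) :
  good_rect J D X Y x y t d ->
  exists (W U : R * R -> Prop) (psi : R * R -> R),
    subset W (rect (t, 0) d) /\ W (t, 0) /\ is_graph (phi_hat X Y) W U psi.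
Proof.
  intros (Hd & HA & HB & _ & HP & HN & _).
  set (A := surface_coord X) in *. set (B := surface_coord Y) in *.
  set (V := rect (t, 0) d) in *. assert (HV : open V) by apply open_rect.
  assert (V0 : V (t, 0)) by (apply rect_center; auto).
  destruct (inverse_function A B (t, 0) d (analytic_on_C1_at V A _ HV V0 HA)
    (analytic_on_C1_at V B _ HV V0 HB) (proj2 (HN _ V0)) Hd) as (e & h & k & [He Hed] & Hh & Hk & Lip & _).
  set (W := rect (t, 0) e). assert (HW : open W) by apply open_rect.
  assert (SW : subset W V) by (intros p; apply rect_le; auto).
  set (U := fun q => exists p, W p /\ (A p, B p) = q).
  (* Off [U] the value is an arbitrary choice; [is_graph] constrains [psi] only on [U]. *)
  set (psi := fun q => fst (epsilon (inhabits (t, 0)) (fun p => W p /\ (A p, B p) = q))).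
  assert (Inj : forall p p', W p -> W p' -> (A p, B p) = (A p', B p') -> p = p').
  { intros p p' Hp Hp' E. apply dist1_eq. specialize (Lip p p' Hp Hp'). rewrite E in Lip.
    unfold dist1 at 2, Rminus in Lip. rewrite !Rplus_opp_r, Rabs_R0 in Lip. lra. }
  exists W, U, psi. split; [exact SW|]. split; [apply rect_center; auto|].
  split; [exact HW|]. split.
  - intros q [p [Wp <-]].
    destruct (analytic_inverse V W A B p HV HW (SW p Wp) Wp HA HB (proj2 (HN _ (SW p Wp)))) as (r & g & Hr & Hg & _).
    apply locally_rect. exists r; split; auto. intros q Hq. destruct (Hg q Hq) as (G1 & G2 & G3).
    exists (g q); split; auto. rewrite G2, G3, <- surjective_pairing; reflexivity.
  - intros u q; split.
    + intros (r & s & Wp & E). rewrite (HP r s (SW _ Wp)) in E. apply real_point_inj in E.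
      destruct E as [<- <-]. split; [exists (r, s); auto|].
      unfold psi. assert (S := epsilon_spec (inhabits (t, 0)) (fun p => W p /\ (A p, B p) = (A (r, s), B (r, s)))
        (ex_intro _ (r, s) (conj Wp eq_refl))). cbv beta in S. destruct S as [S1 S2].
      rewrite (Inj _ _ S1 Wp S2). reflexivity.
    + intros [Uq ->]. assert (S := epsilon_spec (inhabits (t, 0)) (fun p => W p /\ (A p, B p) = q) Uq).
      cbv beta in S. unfold psi.
      destruct (epsilon (inhabits (t, 0)) (fun p => W p /\ (A p, B p) = q)) as [r s].
      destruct S as [S1 <-]. exists r, s; split; [exact S1|exact (HP r s (SW _ S1))].
Qed.

(** For an arbitrary sheet [W], the graph condition itself gives [psi(A, B) = r]. A local inverse
    [g] of [(A, B)] with values in [W] therefore has [psi] as its first component, which is how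
    [psi] becomes analytic. *)
Lemma graph_local (J : R -> Prop) (D : C -> Prop) (X Y : C -> C) (x y : R -> R)
  (W U : R * R -> Prop) (psi : R * R -> R) :
  (forall p, W p -> exists t d, good_rect J D X Y x y t d /\ rect (t, 0) d p) ->
  is_graph (phi_hat X Y) W U psi ->
  let A := surface_coord X in
  let B := surface_coord Y in
  (forall p, W p -> U (A p, B p) /\ psi (A p, B p) = fst p) /\
  (forall q, U q -> exists p, W p /\ q = (A p, B p)) /\
  (forall q, U q -> exists h, 0 < h /\ subset (rect q h) U /\ analytic_on (rect q h) psi) /\
  (forall p, W p ->
     0 < partial_x A p ^ 2 + partial_x B p ^ 2 /\ 0 < partial_y A p ^ 2 + partial_y B p ^ 2 /\
     (partial_x A p ^ 2 + partial_x B p ^ 2) * type_discriminant psi (A p, B p)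
       = 4 * snd p * (partial_y A p ^ 2 + partial_y B p ^ 2) /\
     stream_equation 1 psi (A p, B p)).
Proof.
  intros HW (OW & OU & HG) A B.
  assert (F1 : forall p, W p -> U (A p, B p) /\ psi (A p, B p) = fst p).
  { intros p Wp. destruct (HW p Wp) as (t & d & (_ & _ & _ & _ & HP & _) & Vp).
    destruct p as [r s]. destruct (proj1 (HG r (A (r, s), B (r, s)))) as [H1 H2]; auto.
    exists r, s; split; auto. }
  assert (F2 : forall q, U q -> exists p, W p /\ q = (A p, B p)).
  { intros q Uq. destruct (proj2 (HG (psi q) q) (conj Uq eq_refl)) as (r & s & Wp & E).
    destruct (HW _ Wp) as (t & d & (_ & _ & _ & _ & HP & _) & Vp).
    rewrite (HP r s Vp) in E. apply real_point_inj in E. exists (r, s); split; auto. symmetry; apply E. }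
  assert (F3 : forall q, U q -> exists h, 0 < h /\ subset (rect q h) U /\ analytic_on (rect q h) psi).
  { intros q Uq. destruct (F2 q Uq) as (p & Wp & ->).
    destruct (HW p Wp) as (t & d & (Hd & HA & HB & _ & HP & HN & _) & Vp).
    destruct (analytic_inverse (rect (t, 0) d) W A B p (open_rect _ _) OW Vp Wp HA HB (proj2 (HN _ Vp)))
      as (h & g & Hh & Hg & Ag).
    assert (K : forall q, rect (A p, B p) h q -> U q /\ fst (g q) = psi q).
    { intros q Hq. destruct (Hg q Hq) as (G1 & G2 & G3). destruct (F1 _ G1) as [K1 K2].
      rewrite G2, G3, <- surjective_pairing in K1, K2. auto. }
    exists h; split; auto. split; [intros q Hq; apply (K q Hq)|].
    apply analytic_on_ext with (fun q => fst (g q)); auto; [apply open_rect|].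
    intros q Hq; apply (K q Hq). }
  split; [exact F1|]. split; [exact F2|]. split; [exact F3|].
  intros p Wp. destruct (HW p Wp) as (t & d & (Hd & HA & HB & _ & _ & HN & _) & Vp).
  fold A B in HA, HB, HN.
  destruct (F1 p Wp) as [Up _]. destruct (F3 _ Up) as (h & Hh & _ & Hpsi).
  assert (G := graph_gradient (rect (t, 0) d) (rect (A p, B p) h) W A B psi p (open_rect _ _) OW Vp Wp
     (rect_center _ _ Hh) HA HB Hpsi (fun z Hz => proj2 (F1 z Hz))).
  destruct G as [G1 G2]. destruct (HN p Vp) as [[N1 N2] NJ].
  destruct (gradient_algebra _ _ _ _ _ _ _ G1 G2 N1 N2 NJ) as (P1 & P2 & _ & _ & E).
  split; [exact P1|]. split; [exact P2|]. split.
  - unfold type_discriminant. rewrite E. field. lra.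
  - exact (graph_stream_equation (rect (t, 0) d) (rect (A p, B p) h) W A B psi p (open_rect _ _) (open_rect _ _)
     OW Vp Wp (rect_center _ _ Hh) HA HB Hpsi (fun z Hz => proj2 (F1 z Hz)) HN).
Qed.

(** * Sign of the discriminant near the curve, and the speed of the flow *)

(** Differentiate [|R|^2 D = 4 s |T|^2] at [s = 0]: there [D = 0] and [s = 0] remove the derivatives
    of [|R|^2] and [|T|^2]. So [grad D] is normal to the tangent [R] and has positive product with
    [T]. *)
Lemma discriminant_gradient (V V' W : R * R -> Prop) (A B D : R * R -> R) (p : R * R) :
  open V' -> open W -> V p -> W p -> V' (A p, B p) ->
  analytic_on V A -> analytic_on V B -> analytic_on V' D ->
  (forall z, W z -> (partial_x A z ^ 2 + partial_x B z ^ 2) * D (A z, B z)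
     = 4 * snd z * (partial_y A z ^ 2 + partial_y B z ^ 2)) ->
  snd p = 0 -> partial_x A p ^ 2 + partial_x B p ^ 2 = 1 ->
  partial_x A p * partial_x D (A p, B p) + partial_x B p * partial_y D (A p, B p) = 0 /\
  partial_y A p * partial_x D (A p, B p) + partial_y B p * partial_y D (A p, B p)
    = 4 * (partial_y A p ^ 2 + partial_y B p ^ 2).
Proof.
  intros HV' HW Vp Wp Vq HA HB HD H Hs Hn.
  assert (DA := fun f (Hf : analytic_on V f) => ex_partials_is f p (analytic_on_ex_partials V f p Vp Hf)).
  assert (HAx := analytic_on_partial_x V A HA). assert (HAy := analytic_on_partial_y V A HA).
  assert (HBx := analytic_on_partial_x V B HB). assert (HBy := analytic_on_partial_y V B HB).
  assert (PD := chain_partials V V' A B D p HV' Vp Vq HA HB HD).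
  assert (Z : D (A p, B p) = 0).
  { assert (E := H p Wp). rewrite Hs, Hn in E. lra. }
  destruct (is_partials_eq
    (fun z => (partial_x A z * partial_x A z + partial_x B z * partial_x B z) * D (A z, B z))
    (fun z => 4 * snd z * (partial_y A z * partial_y A z + partial_y B z * partial_y B z)) p _ _ _ _
    ltac:(generalize (HW p Wp); apply filter_imp; intros z Hz; generalize (H z Hz); simpl; rewrite !Rmult_1_r; auto)
    (is_partials_mult _ _ _ _ _ _ _
      (is_partials_plus _ _ _ _ _ _ _ (is_partials_mult _ _ _ _ _ _ _ (DA _ HAx) (DA _ HAx))
       (is_partials_mult _ _ _ _ _ _ _ (DA _ HBx) (DA _ HBx))) PD)
    (is_partials_mult _ _ _ _ _ _ _ (is_partials_mult _ _ _ _ _ _ _ (is_partials_const 4 p) (is_partials_snd p))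
        (is_partials_plus _ _ _ _ _ _ _ (is_partials_mult _ _ _ _ _ _ _ (DA _ HAy) (DA _ HAy))
       (is_partials_mult _ _ _ _ _ _ _ (DA _ HBy) (DA _ HBy))))) as [E1 E2].
  cbv beta in E1, E2. rewrite Z, Hs in E1, E2.
  replace (partial_x A p * partial_x A p + partial_x B p * partial_x B p) with 1 in E1, E2 by (rewrite <- Hn; ring).
  split; [apply eq_trans with (0 * 0); [|ring]|]; lra.
Qed.

(** Signs are recorded through products with [k], so that one statement covers both signs of [k]. *)
Lemma sign_of_derivative (f : R -> R) (k : R) : is_derive f 0 k -> f 0 = 0 -> k <> 0 ->
  exists e, 0 < e /\ forall h, 0 < h < e -> 0 < f h * k /\ f (- h) * k < 0.
Proof.
  intros D F0 Hk. apply is_derive_Reals in D.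
  destruct (D (Rabs k) (Rabs_pos_lt k Hk)) as [e He].
  assert (S : forall h, h <> 0 -> Rabs h < e -> 0 < f h / h * k).
  { intros h h0 Hh. specialize (He h h0 Hh).
    rewrite Rplus_0_l, F0, Rminus_0_r in He. apply Rabs_lt_between in He.
    revert He; generalize (f h / h); intros z He.
    destruct (Rdichotomy _ _ Hk); [rewrite Rabs_left in He by auto|rewrite Rabs_right in He by lra]; nra. }
  exists e; split; [apply cond_pos|]. intros h Hh.
  assert (S1 := S h ltac:(lra) ltac:(rewrite Rabs_pos_eq; lra)).
  assert (S2 := S (- h) ltac:(lra) ltac:(rewrite Rabs_Ropp, Rabs_pos_eq; lra)).
  replace (f h * k) with (h * (f h / h * k)) by (field; lra).
  replace (f (- h) * k) with (- (h * (f (- h) / - h * k))) by (field; lra). nra.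
Qed.

(** Since [c = 1 / rho], the squared speed is [c^2 (1 - D)] with [D] the discriminant. *)
Lemma speed_lt_sound (p0 rho0 : R) (psi : R * R -> R) (q : R * R) : 0 < rho0 ->
  let rho := density rho0 psi in
  let c := sound_speed (pressure p0) rho in
  let u := fun q : R * R => 1 / rho q * partial_y psi q in
  let v := fun q : R * R => 1 / rho q * (- partial_x psi q) in
  (0 < type_discriminant psi q -> speed u v q < c q) /\
  (type_discriminant psi q < 0 -> c q < speed u v q).
Proof.
  intros H0 rho c u v.
  assert (E : type_discriminant psi q <> 0 -> 0 < 1 / rho q /\ c q = sqrt ((1 / rho q) ^ 2) /\
    u q ^ 2 + v q ^ 2 = (1 / rho q) ^ 2 * (1 - type_discriminant psi q)).
  { intros Hd. assert (P := density_pos rho0 psi q H0 Hd). fold rho in P.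
    assert (P' : 0 < 1 / rho q) by (apply Rdiv_lt_0_compat; lra).
    split; [exact P'|]. split.
    - unfold c. rewrite sound_speed_pressure by exact P. rewrite sqrt_pow2; lra.
    - unfold u, v, type_discriminant; ring. }
  split; intros Hd; destruct (E ltac:(lra)) as (P & Ec & Eu); rewrite Ec; unfold speed; rewrite Eu;
    apply sqrt_lt_1_alt; assert (0 < (1 / rho q) ^ 2) by (apply pow_lt; auto).
  - split; [apply Rmult_le_pos; [lra|]|nra].
    unfold type_discriminant. assert (Q1 := pow2_ge_0 (partial_x psi q)). assert (Q2 := pow2_ge_0 (partial_y psi q)). lra.
  - split; [lra|nra].
Qed.

(** The squared speed equals [(1 - D) / (rho0^2 |D|)], and [D] tends to 0. *)
Lemma speed_unbounded (rho0 : R) (psi : R * R -> R) (q : R * R) (E : R * R -> Prop) : 0 < rho0 ->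
  continuous (type_discriminant psi) q -> type_discriminant psi q = 0 ->
  (forall p, E p -> type_discriminant psi p <> 0) ->
  filterlim (fun p => (1 / density rho0 psi p * partial_y psi p) ^ 2
                    + (1 / density rho0 psi p * (- partial_x psi p)) ^ 2)
    (within E (locally q)) (Rbar_locally p_infty).
Proof.
  intros H0 Cd Dq HE P [M HM]. unfold within, filtermap.
  (* [|D| < 1/2] keeps the numerator above [1/2]; the second bound then pushes the quotient beyond
     [|M| + 1]. *)
  set (e := Rmin (/ 2) (/ (2 * rho0 ^ 2 * (Rabs M + 1)))).
  assert (R2 : 0 < rho0 ^ 2) by (apply pow_lt; auto).
  assert (PM : 0 < Rabs M + 1) by (assert (X := Rabs_pos M); lra).
  assert (P1 : 0 < / (2 * rho0 ^ 2 * (Rabs M + 1))).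
  { apply Rinv_0_lt_compat, Rmult_lt_0_compat; lra. }
  assert (Pe : 0 < e) by (apply Rmin_pos; lra).
  rewrite continuous_rect in Cd. destruct (Cd e Pe) as [d [Hd K]].
  apply locally_rect; exists d; split; auto. intros p Hp Ep. apply HM.
  specialize (K p Hp). rewrite Dq, Rminus_0_r in K. specialize (HE p Ep).
  set (D := type_discriminant psi p) in *.
  assert (PD : 0 < Rabs D) by (apply Rabs_pos_lt; auto).
  assert (K1 : Rabs D < / 2) by (eapply Rlt_le_trans; [exact K|apply Rmin_l]).
  assert (K2 : Rabs D < / (2 * rho0 ^ 2 * (Rabs M + 1))) by (eapply Rlt_le_trans; [exact K|apply Rmin_r]).
  assert (Ed : density rho0 psi p ^ 2 = rho0 ^ 2 * Rabs D).
  { unfold density. fold (type_discriminant psi p). fold D. rewrite Rpow_mult_distr.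
    f_equal. apply pow2_sqrt; lra. }
  assert (Pd := density_pos rho0 psi p H0 HE).
  replace ((1 / density rho0 psi p * partial_y psi p) ^ 2 + (1 / density rho0 psi p * - partial_x psi p) ^ 2)
    with ((1 - D) / density rho0 psi p ^ 2) by (unfold D, type_discriminant; field; lra).
  rewrite Ed. apply Rle_lt_trans with (Rabs M); [apply Rle_abs|].
  apply Rlt_trans with (Rabs M + 1); [lra|].
  apply Rmult_lt_reg_r with (rho0 ^ 2 * Rabs D); [apply Rmult_lt_0_compat; auto|].
  unfold Rdiv; rewrite Rmult_assoc, Rinv_l, Rmult_1_r by (apply Rgt_not_eq, Rmult_lt_0_compat; auto).
  apply (Rmult_lt_compat_l (2 * rho0 ^ 2 * (Rabs M + 1))) in K2; [|apply Rmult_lt_0_compat; lra].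
  rewrite Rinv_r in K2 by (apply Rgt_not_eq, Rmult_lt_0_compat; lra).
  assert (T := Rle_abs D). lra.
Qed.

Theorem theorem4p2
  (a b : Rbar) (x y : R -> R)
  (hx : forall t, interval a b t -> analytic_at x t)
  (hy : forall t, interval a b t -> analytic_at y t)
  (arc_length : forall t, interval a b t -> (Derive x t) ^ 2 + (Derive y t) ^ 2 = 1)
  (locally_convex : forall t, interval a b t ->
     ~ (Derive_n x 2 t = 0 /\ Derive_n y 2 t = 0))
  (D : C -> Prop) (X Y : C -> C)
  (hX : analytic_extension (interval a b) x D X)
  (hY : analytic_extension (interval a b) y D Y)
  (p0 rho0 : R) (hrho0 : 0 < rho0) :
  exists Omega : R * R -> Prop,
    open Omega /\
    (forall t, interval a b t -> Omega (t, 0)) /\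
    (forall r s, Omega (r, s) -> phi_defined (interval a b) D r s) /\
    (forall t, interval a b t ->
       exists (W U : R * R -> Prop) (psi : R * R -> R),
         subset W Omega /\ W (t, 0) /\ is_graph (phi_hat X Y) W U psi) /\
    (forall (W U : R * R -> Prop) (psi : R * R -> R),
       subset W Omega -> is_graph (phi_hat X Y) W U psi ->
       let p := pressure p0 in
       let rho := density rho0 psi in
       let c := sound_speed p rho in
       let u := fun q : R * R => 1 / rho q * partial_y psi q in
       let v := fun q : R * R => 1 / rho q * (- partial_x psi q) in
       let sigma := arc x y W in
       let E := fun q : R * R => U q /\ ~ sigma q in
       (forall q, U q -> analytic2_at psi q) /\
       steady_flow E p u v rho /\
       stream_function E psi u v rho /\
       (forall q, E q -> c q * rho q = 1 /\
                         stream_equation ((rho q) ^ 2 * (c q) ^ 2) psi q) /\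
       (forall q, U q -> stream_equation 1 psi q) /\
       (forall q, sigma q -> U q /\ rho q = 0) /\
       (* (1) *)
       (forall q, sigma q ->
          filterlim (fun q' => (u q') ^ 2 + (v q') ^ 2)
            (within E (locally q)) (Rbar_locally p_infty)) /\
       (* (2) *)
       (forall r s q, W (r, s) -> phi_hat X Y r s = real_point (psi q) q ->
          (0 < s -> subsonic E u v c q) /\
          (s < 0 -> supersonic E u v c q)) /\
       (forall t, W (t, 0) ->
          changes_across x y t (subsonic E u v c) (supersonic E u v c)) /\
       (* (3) *)
       (forall t, W (t, 0) ->
          points_into x y t (Derive_n x 2 t) (Derive_n y 2 t)
            (supersonic E u v c))).
Proof.
  set (A := surface_coord X). set (B := surface_coord Y).
  (* [Omega] is the union of all good squares centred on the axis, fixed before any sheet is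
     chosen. *)
  exists (fun q => exists t d, interval a b t /\ good_rect (interval a b) D X Y x y t d /\ rect (t, 0) d q).
  split; [|split; [|split; [|split]]].
  - intros q (t & d & Ht & Hg & Hq). generalize (open_rect (t, 0) d q Hq).
    apply filter_imp; intros p Hp; exists t, d; auto.
  - intros t Ht. destruct (good_rect_exists a b x y D X Y arc_length locally_convex hX hY t Ht) as [d Hd].
    exists t, d; split; [auto|]; split; [auto|]. apply rect_center, Hd.
  - intros r s (t & d & _ & (_ & _ & _ & HP & _) & Hq). apply HP, Hq.
  - intros t Ht. destruct (good_rect_exists a b x y D X Y arc_length locally_convex hX hY t Ht) as [d Hd].
    destruct (graph_exists _ _ _ _ _ _ _ _ Hd) as (W & U & psi & S & W0 & G).
    exists W, U, psi; split; [|auto]. intros q Hq; exists t, d; auto.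
  - intros W U psi HW HG p rho c u v sigma E.
    assert (HW' : forall q, W q -> exists t d, good_rect (interval a b) D X Y x y t d /\ rect (t, 0) d q).
    { intros q Wq. destruct (HW q Wq) as (t & d & _ & H1 & H2). exists t, d; auto. }
    destruct (graph_local _ D X Y x y W U psi HW' HG) as (F1 & F2 & F3 & F4). fold A B in F1, F2, F3, F4.
    set (dis := type_discriminant psi) in *.
    assert (Axis : forall t, W (t, 0) ->
      A (t, 0) = x t /\ B (t, 0) = y t /\
      partial_x A (t, 0) = Derive x t /\ partial_x B (t, 0) = Derive y t /\
      partial_y A (t, 0) = - / 2 * Derive_n x 2 t /\ partial_y B (t, 0) = - / 2 * Derive_n y 2 t).
    { intros t Wt. destruct (HW' _ Wt) as (t' & d & (_ & _ & _ & _ & _ & _ & H) & Hq). apply (H t Hq). }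
    assert (Sig : forall q, sigma q -> U q /\ dis q = 0).
    { intros q [t [Wt ->]]. destruct (Axis t Wt) as (<- & <- & _).
      destruct (F4 _ Wt) as (P1 & _ & E1 & _). split; [apply (F1 _ Wt)|].
      simpl snd in E1. rewrite Rmult_0_r, Rmult_0_l in E1. apply Rmult_integral in E1.
      destruct E1 as [E1|E1]; [lra|exact E1]. }
    assert (Off : forall q, U q -> dis q <> 0 -> E q).
    { intros q Uq Hd; split; auto. intros Sq; apply Hd, (Sig q Sq). }
    (* As [T] never vanishes, the discriminant is zero on the sheet only where [s = 0], that is, on
       [sigma]. *)
    assert (EDis : forall q, E q -> dis q <> 0).
    { intros q [Uq Nq]. destruct (F2 q Uq) as (z & Wz & ->). intros Dz.
      destruct (F4 z Wz) as (_ & P2 & E1 & _). rewrite Dz, Rmult_0_r in E1.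
      apply Nq. destruct z as [r s]. simpl in E1.
      assert (Hs : s = 0).
      { symmetry in E1. apply Rmult_integral in E1. simpl in P2. destruct E1 as [E1|E1]; lra. }
      subst s. exists r; split; auto. destruct (Axis r Wz) as (<- & <- & _); reflexivity. }
    assert (SE : forall q, U q -> stream_equation 1 psi q).
    { intros q Uq. destruct (F2 q Uq) as (z & Wz & ->). apply (F4 z Wz). }
    assert (Rpos : forall q, E q -> 0 < rho q) by (intros q Eq; apply density_pos; auto; apply EDis, Eq).
    assert (Dcont : forall q, U q -> continuous dis q).
    { intros q Uq. destruct (F3 q Uq) as (h & Hh & _ & Hpsi).
      apply (analytic_on_continuous (rect q h)); [apply open_rect|apply rect_center; auto|].
      apply analytic_on_type_discriminant; auto; apply open_rect. }
    assert (Speed := fun q => speed_lt_sound p0 rho0 psi q hrho0).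
    (* [k] is the derivative of the discriminant along a line through the curve; its sign decides
       both the change of type and the side to which the acceleration points. *)
    assert (Line : forall t w1 w2, W (t, 0) -> exists k e, 0 < e /\
      is_derive (fun h => dis (x t + h * w1, y t + h * w2)) 0 k /\
      (forall h, Rabs h < e -> U (x t + h * w1, y t + h * w2)) /\
      (Derive x t * w2 - Derive y t * w1 <> 0 -> k <> 0) /\
      (w1 = Derive_n x 2 t -> w2 = Derive_n y 2 t -> k < 0)).
    { intros t w1 w2 Wt. destruct (HW' _ Wt) as (t' & d & (_ & HA & HB & HD & _ & HN & _) & Vt).
      fold A B in HA, HB, HN.
      destruct (Axis t Wt) as (E1 & E2 & E3 & E4 & E5 & E6).
      destruct (F1 _ Wt) as [Ut _]. destruct (F3 _ Ut) as (h & Hh & HU & Hpsi).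
      assert (Hdis := analytic_on_type_discriminant _ _ (open_rect _ h) Hpsi). fold dis in Hdis.
      assert (Hn : partial_x A (t, 0) ^ 2 + partial_x B (t, 0) ^ 2 = 1).
      { rewrite E3, E4. apply arc_length, (HD t 0 Vt). }
      assert (Hid : forall z, W z -> (partial_x A z ^ 2 + partial_x B z ^ 2) * dis (A z, B z)
         = 4 * snd z * (partial_y A z ^ 2 + partial_y B z ^ 2)) by (intros z Wz; apply (F4 z Wz)).
      destruct (discriminant_gradient (rect (t', 0) d) _ W A B dis (t, 0) (open_rect _ h) (proj1 HG) Vt Wt
        (rect_center _ _ Hh) HA HB Hdis Hid eq_refl Hn) as [G1 G2].
      destruct (F4 _ Wt) as (_ & P2 & _). destruct (HN _ Vt) as [_ NJ]. unfold jacobian in NJ.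
      rewrite E1, E2 in *. rewrite E3, E4 in *.
      set (q := (x t, y t)) in *.
      set (v1 := partial_x dis q) in *. set (v2 := partial_y dis q) in *.
      set (b1 := partial_y A (t, 0)) in *. set (b2 := partial_y B (t, 0)) in *.
      exists (v1 * w1 + v2 * w2), (h / (Rabs w1 + Rabs w2 + 1)).
      assert (Q1 := Rabs_pos w1). assert (Q2 := Rabs_pos w2).
      split; [apply Rdiv_lt_0_compat; lra|]. split; [|split; [|split]].
      - assert (X0 : (x t + 0 * w1, y t + 0 * w2) = q) by (unfold q; f_equal; ring).
        assert (X1 := analytic_on_is_derive_comp (rect q h) dis (fun h => x t + h * w1) (fun h => y t + h * w2)
          0 w1 w2 (open_rect _ _) Hdis).
        cbv beta in X1. rewrite X0 in X1.
        apply X1; [apply rect_center; auto| |]; auto_derive; auto; ring.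
      - intros k Hk. apply HU.
        assert (Hk' : Rabs k * (Rabs w1 + Rabs w2 + 1) < h).
        { apply (Rmult_lt_compat_r (Rabs w1 + Rabs w2 + 1)) in Hk; [|lra].
          replace (h / (Rabs w1 + Rabs w2 + 1) * (Rabs w1 + Rabs w2 + 1)) with h in Hk by (field; lra). exact Hk. }
        assert (Q3 := Rabs_pos k). split; simpl.
        + replace (_ - _) with (k * w1) by ring. rewrite Rabs_mult; nra.
        + replace (_ - _) with (k * w2) by ring. rewrite Rabs_mult; nra.
      - intros Nw K0.
        (* With [v = grad dis] and [x] for the planar determinant, [(R x w)(T.v) = (v.w)(R x T) +
           (R.v)(T x w)]. As [R.v = 0], a zero [k = v.w] with [w] transversal to [R] would force
           [T.v = 0], although [T.v = 4 |T|^2]. *)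
        assert (Hz : (Derive x t * w2 - Derive y t * w1) * (4 * (b1 ^ 2 + b2 ^ 2)) = 0).
        { rewrite <- G2.
          replace (_ * _) with ((v1 * w1 + v2 * w2) * (Derive x t * b2 - b1 * Derive y t)
            + (Derive x t * v1 + Derive y t * v2) * (b1 * w2 - b2 * w1)) by ring.
          rewrite K0, G1; ring. }
        apply Rmult_integral in Hz. destruct Hz as [Hz|Hz]; [auto|lra].
      - intros -> ->.
        (* [sigma'' = - 2 T], so [k = - 2 T.v = - 8 |T|^2]. *)
        replace (v1 * Derive_n x 2 t + v2 * Derive_n y 2 t) with (-2 * (b1 * v1 + b2 * v2))
          by (rewrite E5, E6; field). lra. }
    assert (Zero : forall t, W (t, 0) -> forall w1 w2, dis (x t + 0 * w1, y t + 0 * w2) = 0).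
    { intros t Wt w1 w2. rewrite !Rmult_0_l, !Rplus_0_r. apply Sig. exists t; auto. }
    assert (Sign : forall t w1 w2, W (t, 0) -> exists k,
      (Derive x t * w2 - Derive y t * w1 <> 0 -> k <> 0) /\
      (w1 = Derive_n x 2 t -> w2 = Derive_n y 2 t -> k < 0) /\
      (k <> 0 -> exists e, 0 < e /\ forall h, 0 < h < e ->
         U (x t + h * w1, y t + h * w2) /\ 0 < dis (x t + h * w1, y t + h * w2) * k /\
         U (x t - h * w1, y t - h * w2) /\ dis (x t - h * w1, y t - h * w2) * k < 0)).
    { intros t w1 w2 Wt. destruct (Line t w1 w2 Wt) as (k & e & He & HD & HU & K1 & K2).
      exists k; split; [exact K1|]; split; [exact K2|]. intros Hk.
      destruct (sign_of_derivative _ k HD (Zero t Wt w1 w2) Hk) as [e' [He' S]].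
      exists (Rmin e e'); split; [apply Rmin_pos; auto|]. intros h Hh.
      assert (L1 := Rmin_l e e'). assert (L2 := Rmin_r e e'). destruct (S h ltac:(lra)) as [S1 S2].
      replace (x t - h * w1) with (x t + - h * w1) by ring.
      replace (y t - h * w2) with (y t + - h * w2) by ring.
      split; [apply HU; rewrite Rabs_pos_eq; lra|]. split; [exact S1|].
      split; [apply HU; rewrite Rabs_Ropp, Rabs_pos_eq; lra|exact S2]. }
    assert (Sub : forall q, U q -> 0 < dis q -> subsonic E u v c q).
    { intros q Uq Hd; split; [apply Off; auto; lra|apply (Speed q), Hd]. }
    assert (Sup : forall q, U q -> dis q < 0 -> supersonic E u v c q).
    { intros q Uq Hd; split; [apply Off; auto; lra|apply (Speed q), Hd]. }
    split; [|split; [|split; [|split; [|split; [|split; [|split; [|split; [|split]]]]]]]].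
    + intros q Uq. destruct (F3 q Uq) as (h & Hh & _ & Hpsi).
      exact (analytic_on_analytic2 (rect q h) psi q (open_rect _ _) (rect_center _ _ Hh) Hpsi).
    + intros q Eq. destruct (F3 q (proj1 Eq)) as (h & Hh & _ & Hpsi).
      exact (flow_at (rect q h) psi q p0 rho0 hrho0 (open_rect _ _) (rect_center _ _ Hh) Hpsi
        (EDis q Eq) (SE q (proj1 Eq)) q eq_refl).
    + intros q Eq. assert (Hr := Rpos q Eq). unfold u, v. split; field; lra.
    + intros q Eq. assert (Hr := Rpos q Eq).
      assert (Ec : c q * rho q = 1).
      { unfold c, p. rewrite sound_speed_pressure by exact Hr. field; lra. }
      split; [exact Ec|]. replace (rho q ^ 2 * c q ^ 2) with 1; [apply SE, Eq|].
      replace (rho q ^ 2 * c q ^ 2) with ((c q * rho q) ^ 2) by ring. rewrite Ec; ring.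
    + exact SE.
    + intros q Sq. destruct (Sig q Sq) as [Uq Dq]. split; auto.
      unfold rho, density. fold (type_discriminant psi q). fold dis. rewrite Dq, Rabs_R0, sqrt_0. ring.
    + intros q Sq. destruct (Sig q Sq) as [Uq Dq].
      apply (speed_unbounded rho0 psi q E hrho0 (Dcont q Uq) Dq EDis).
    + intros r s q Wrs Hphi.
      destruct (HW' _ Wrs) as (t & d & (_ & _ & _ & _ & HP & _) & Vp).
      rewrite (HP r s Vp) in Hphi. apply real_point_inj in Hphi. destruct Hphi as [_ <-].
      fold A B. destruct (F1 _ Wrs) as [Uq _]. destruct (F4 _ Wrs) as (P1 & P2 & E1 & _). simpl snd in E1.
      set (n := partial_x A (r, s) ^ 2 + partial_x B (r, s) ^ 2) in *.
      set (m := partial_y A (r, s) ^ 2 + partial_y B (r, s) ^ 2) in *.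
      assert (Ed : dis (A (r, s), B (r, s)) = s * (4 * m / n)).
      { apply Rmult_eq_reg_l with n; [|lra]. rewrite E1; field; lra. }
      assert (Pk : 0 < 4 * m / n) by (apply Rdiv_lt_0_compat; lra).
      split; intros Hs; [apply Sub|apply Sup]; auto; rewrite Ed; nra.
    + intros t Wt w1 w2 Nw. destruct (Sign t w1 w2 Wt) as (k & K1 & _ & K).
      destruct (K (K1 Nw)) as [e [He S]]. exists e; split; auto.
      (* For [k < 0] the discriminant is positive before the crossing, so the line passes from
         subsonic to supersonic; for [k > 0] it passes the other way. *)
      destruct (Rdichotomy _ _ (K1 Nw)); [left|right]; intros h Hh; destruct (S h Hh) as (U1 & S1 & U2 & S2);
        split; (apply Sub + apply Sup); auto; nra.
    + intros t Wt. destruct (Sign t (Derive_n x 2 t) (Derive_n y 2 t) Wt) as (k & _ & K2 & K).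
      specialize (K2 eq_refl eq_refl). destruct (K ltac:(lra)) as [e [He S]].
      exists e; split; auto. intros h Hh; destruct (S h Hh) as (U1 & S1 & _). apply Sup; auto; nra.
Qed.
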